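(* Let $(R,\mathfrak m,K)$ be a local ring of Krull dimension $d$ and let $\{M_n\}_n$ be a sequence of finitely generated $R$-modules of Krull dimension $d$. Assume that $\operatorname{rank}(M_n)$ is defined for all $n$. Let $\underline x$ be a system of parameters for $R$. Then $\ell(H_i(\underline x;M_n))=\mathrm o(\nu(M_n))$ for all $i\ge1$ if and only if $\ell(H_i(\underline x;M_n))=\mathrm o(\operatorname{rank}(M_n))$ for all $i\ge1$. Moreover, $\chi_1(\underline x;M_n)=\mathrm o(\nu(M_n))$ if and only if $\chi_1(\underline x;M_n)=\mathrm o(\operatorname{rank}(M_n))$. Hence, $\{M_n\}_n$ is lim Cohen-Macaulay if and only if for some (equivalently, every) system of parameters $\underline x$, $\ell(H_i(\underline x;M_n))=\mathrm o(\operatorname{rank}(M_n))$ for all $i\ge1$; and $\{M_n\}_n$ is weakly lim Cohen-Macaulay if and only if for some (equivalently, every) system of parameters $\underline x$, $\chi_1(\underline x;M_n)=\mathrm o(\operatorname{rank}(M_n))$.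
   Context: A local ring $(R,\mathfrak m,K)$ is Noetherian. $\ell$ is length, $\nu(M)=\dim_K(K\otimes_RM)$, $H_i(\underline x;M)$ is Koszul homology, and $\chi_1(\underline x;M)=\sum_{i=1}^d(-1)^{i-1}\ell(H_i(\underline x;M))$. A sequence $\{M_n\}_n$ of nonzero finitely generated $R$-modules is lim Cohen-Macaulay if for some (equivalently, every) system of parameters $\underline x$ of $R$, $\ell(H_i(\underline x;M_n))=\mathrm o(\nu(M_n))$ for all $i\ge1$. A sequence of finitely generated $R$-modules of Krull dimension $d=\dim R$ is weakly lim Cohen-Macaulay if for every (equivalently, some) system of parameters $\underline x$ of $R$, $\chi_1(\underline x;M_n)=\mathrm o(\nu(M_n))$. A finitely generated $R$-module $M$ has rank $r$ (written $\operatorname{rank}(M)=r$) if $\ell_{R_{\mathfrak p}}(M_{\mathfrak p})=r\,\ell_{R_{\mathfrak p}}(R_{\mathfrak p})$ for every minimal prime $\mathfrak p$ of $R$ with $\dim(R/\mathfrak p)=\dim R$; when $R$ is a domain this is the torsion-free rank and is always defined. *)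

(* Defs.v *)
From HB Require Import structures.
From mathcomp Require Import all_boot all_order all_algebra.
From mathcomp Require Import generic_quotient ring_quotient.
From mathcomp Require Import boolp classical_sets reals topology normedtype.
From mathcomp Require Import sequences landau.
From mathcomp Require Import freeg ring.

Set Implicit Arguments.
Unset Strict Implicit.
Unset Printing Implicit Defensive.

Import Order.TTheory GRing.Theory Num.Theory.
Import numFieldNormedType.Exports.

Local Open Scope ring_scope.
Local Open Scope classical_set_scope.
Local Open Scope quotient_scope.

Definition little_o (a b : nat -> rat) : Prop :=
  (a : nat -> rat^o) =o_\oo (b : nat -> rat^o).

Definition is_max (P : nat -> Prop) (k : nat) : Prop :=
  P k /\ forall j, P j -> (j <= k)%N.

Definition psub (T : Type) (A B : {pred T}) : Prop :=
  {subset A <= B} /\ exists2 v, v \in B & v \notin A.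

(* [submodClosed] lives over semirings and does not provide opposites, which
   [Quotient.quot] requires; hence this copy of the predicate. *)
Definition zpred (R : pzRingType) (V : lmodType R) (N : submodClosed V) :
  {pred V} := N.

Section QuotMod.
Variables (R : pzRingType) (V : lmodType R) (N : submodClosed V).

Fact zpred_zmod : zmod_closed (zpred N).
Proof.
split=> [|u v Nu Nv]; first exact: (rpred0 N).
by rewrite addrC -scaleN1r; apply: (submodClosedP N).2.
Qed.
HB.instance Definition _ := GRing.isZmodClosed.Build V (zpred N) zpred_zmod.

Definition quotmod := Quotient.quot (zpred N).
HB.instance Definition _ := GRing.Zmodule.on quotmod.

Definition quotmod_pi (v : V) : quotmod := \pi_(quotmod) v.

Fact quotmod_piB u v : quotmod_pi (u - v) = quotmod_pi u - quotmod_pi v.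
Proof. exact: (raddfB (\pi_(Quotient.quot (zpred N)))). Qed.
HB.instance Definition _ :=
  GRing.isZmodMorphism.Build V quotmod quotmod_pi quotmod_piB.

Definition quotmod_scale (a : R) (q : quotmod) : quotmod :=
  quotmod_pi (a *: (repr q : V)).

Fact quotmod_piZ a v : quotmod_scale a (quotmod_pi v) = quotmod_pi (a *: v).
Proof.
apply/eqP; rewrite -Quotient.idealrBE -scalerBr.
apply: (@rpredZ _ _ N); change (repr (quotmod_pi v) - v \in zpred N).
by rewrite Quotient.idealrBE reprK.
Qed.

Fact quotmod_reprK q : quotmod_pi (repr q) = q.
Proof. exact: reprK. Qed.

Fact quotmod_scaleA a b q :
  quotmod_scale a (quotmod_scale b q) = quotmod_scale (a * b) q.
Proof. by rewrite -[q]quotmod_reprK !quotmod_piZ scalerA. Qed.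
Fact quotmod_scale1 : left_id 1 quotmod_scale.
Proof. by move=> q; rewrite -[q]quotmod_reprK quotmod_piZ scale1r. Qed.
Fact quotmod_scaleDr : right_distributive quotmod_scale +%R.
Proof.
move=> a q1 q2; rewrite -[q1]quotmod_reprK -[q2]quotmod_reprK -raddfD.
by rewrite !quotmod_piZ scalerDr raddfD.
Qed.
Fact quotmod_scaleDl q : {morph quotmod_scale^~ q : a b / a + b}.
Proof.
by move=> a b; rewrite -[q]quotmod_reprK !quotmod_piZ scalerDl raddfD.
Qed.
HB.instance Definition _ := GRing.Zmodule_isLmodule.Build R quotmod
  quotmod_scaleA quotmod_scale1 quotmod_scaleDr quotmod_scaleDl.

End QuotMod.

Section Span.
Variables (R : pzRingType) (V : lmodType R) (S : set V).

Definition span : {pred V} :=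
  [pred v | `[< forall N : submodClosed V,
                  (forall u, S u -> u \in N) -> v \in N >]].

Fact span_submod : submod_closed span.
Proof.
split=> [|a u v]; first by apply/asboolP => N _; apply: rpred0.
move=> /asboolP Su /asboolP Sv; apply/asboolP => N SN.
by apply: rpredD; [apply: rpredZ; apply: Su | apply: Sv].
Qed.
HB.instance Definition _ := GRing.isSubmodClosed.Build R V span span_submod.

End Span.

Section Homology.
Variables (R : pzRingType) (A B C : lmodType R).
Variables (f : {linear A -> B}) (g : {linear B -> C}).

Definition kerp : {pred B} := [pred v | g v == 0].
Fact kerp_submod : submod_closed kerp.
Proof.
split=> [|a u v]; first by rewrite inE linear0.
by rewrite !inE linearP => /eqP-> /eqP->; rewrite scaler0 addr0.
Qed.
HB.instance Definition _ := GRing.isSubmodClosed.Build R B kerp kerp_submod.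
HB.instance Definition _ := GRing.isZmodClosed.Build B kerp
  (zpred_zmod (kerp : submodClosed B)).

Definition kermod := {v : B | v \in kerp}.
HB.instance Definition _ := SubChoice.on kermod.
HB.instance Definition _ := [SubChoice_isSubZmodule of kermod by <:].
HB.instance Definition _ := [SubZmodule_isSubLmodule of kermod by <:].

Definition imp : {pred kermod} := [pred z | `[< exists x, f x = val z >]].
Fact imp_submod : submod_closed imp.
Proof.
split=> [|a u v]; first by apply/asboolP; exists 0; rewrite linear0 linear0.
move=> /asboolP[x fx] /asboolP[y fy]; apply/asboolP; exists (a *: x + y).
by rewrite !linearP fx fy.
Qed.
HB.instance Definition _ := GRing.isSubmodClosed.Build R kermod imp imp_submod.

(* ker g / (im f :&: ker g); here g \o f = 0 in all uses. *)
Definition homology := quotmod (imp : submodClosed kermod).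
HB.instance Definition _ := GRing.Lmodule.on homology.

End Homology.

Definition submod_chain (R : pzRingType) (V : lmodType R) (k : nat) : Prop :=
  exists N : 'I_k.+1 -> submodClosed V,
    forall i j : 'I_k.+1, (i < j)%N -> psub (N i) (N j).

(* An infinite length is sent to 0; this is only applied to R_p and M_p for p a
   minimal prime, and to Koszul homology on a system of parameters, where the
   length is finite. *)
Definition mlength (R : pzRingType) (V : lmodType R) : nat :=
  xget 0%N [set k | is_max (submod_chain V) k].

Definition fingen (R : pzRingType) (V : lmodType R) : Prop :=
  exists (n : nat) (g : 'I_n -> V),
    forall v, exists c : 'I_n -> R, v = \sum_(i < n) c i *: g i.

Definition noetherian (R : comNzRingType) : Prop :=
  forall I : idealr R, exists (n : nat) (g : 'I_n -> R),
    forall a, (a \in I) = `[< exists c : 'I_n -> R, a = \sum_(i < n) c i * g i >].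

Definition maximal_ideal (R : comNzRingType) (m : idealr R) : Prop :=
  forall I : idealr R, {subset m <= I} -> I =i m.

Definition local_ring (R : comNzRingType) (m : idealr R) : Prop :=
  [/\ noetherian R, maximal_ideal m &
      forall I : idealr R, maximal_ideal I -> I =i m].

(* Chains p_0 < ... < p_k of primes of R / I, i.e. of primes of R containing
   I. There is none if I is the unit ideal. *)
Definition prime_chain (R : comNzRingType) (I : {pred R}) (k : nat) : Prop :=
  exists p : 'I_k.+1 -> prime_idealr R,
    (forall i, {subset I <= p i}) /\
    (forall i j : 'I_k.+1, (i < j)%N -> psub (p i) (p j)).

Definition quot_dim (R : comNzRingType) (I : {pred R}) (d : nat) : Prop :=
  is_max (prime_chain I) d.

Definition krull_dim (R : comNzRingType) (d : nat) : Prop :=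
  quot_dim (pred1 (0 : R)) d.

Definition ann (R : comNzRingType) (M : lmodType R) : {pred R} :=
  [pred a | `[< forall v : M, a *: v = 0 >]].

(* dim M = dim (R / Ann M); the zero module has no dimension in nat. *)
Definition mod_dim (R : comNzRingType) (M : lmodType R) (d : nat) : Prop :=
  quot_dim (ann M) d.

Definition minimal_prime (R : comNzRingType) (p : prime_idealr R) : Prop :=
  forall q : prime_idealr R, {subset q <= p} -> q =i p.

Definition sop (R : comNzRingType) (m : idealr R) (d : nat) (x : 'I_d -> R) :
  Prop :=
  [/\ krull_dim R d, forall i, x i \in m &
      forall y, y \in m ->
        exists (k : nat) (c : 'I_d -> R), y ^+ k = \sum_(i < d) c i * x i].

Section Loc.
Variables (R : comNzRingType) (p : prime_idealr R).

Definition denom := {s : R | s \notin p}.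
HB.instance Definition _ := Choice.on denom.

Fact denom1P : (1 : R) \notin p. Proof. by rewrite idealr1. Qed.
Definition denom1 : denom := exist _ (1 : R) denom1P.
Definition dval (s : denom) : R := val s.
Fact denomMP (s t : denom) : dval s * dval t \notin p.
Proof. by rewrite prime_idealrM negb_or (valP s) (valP t). Qed.
Definition denomM (s t : denom) : denom :=
  exist _ (dval s * dval t : R) (denomMP s t).

Fact denomE : (dval denom1 = 1) * (forall s t, dval (denomM s t) = dval s * dval t).
Proof. by []. Qed.

Section LocMod.
Variable M : lmodType R.

Definition loc_equiv (x y : M * denom) : bool :=
  `[< exists t : denom,
        dval t *: (dval y.2 *: x.1) = dval t *: (dval x.2 *: y.1) >].

Fact loc_equivP : equiv_class_of loc_equiv.
Proof.
split=> [x|x y|y x z].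
- by apply/asboolP; exists denom1.
- by apply/asboolP/asboolP => -[t e]; exists t.
move=> /asboolP[t e1] /asboolP[u e2]; apply/asboolP.
exists (denomM (denomM t u) y.2); rewrite /= ?denomE !scalerA.
transitivity (dval u * dval z.2 * (dval t * dval y.2) *: x.1).
  by congr (_ *: _); ring.
rewrite -[LHS]scalerA -[_ * _ *: x.1]scalerA e1.
transitivity (dval t * dval x.2 * (dval u * dval z.2) *: y.1).
  by rewrite !scalerA; congr (_ *: _); ring.
rewrite -[LHS]scalerA -[_ * _ *: y.1]scalerA e2 !scalerA.
by congr (_ *: _); ring.
Qed.
Canonical loc_equiv_rel := EquivRelPack loc_equivP.

Definition loc := {eq_quot loc_equiv}.
HB.instance Definition _ := Choice.on loc.
HB.instance Definition _ : EqQuotient (M * denom)%type loc_equiv loc :=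
  EqQuotient.on loc.

Definition frac (v : M) (s : denom) : loc := \pi_(loc) (v, s).

Fact fracP (x : loc) : exists v s, x = frac v s.
Proof. by exists (repr x).1, (repr x).2; rewrite /frac -surjective_pairing reprK. Qed.

Fact fracE v s w t : frac v s = frac w t <->
  exists u : denom, dval u *: (dval t *: v) = dval u *: (dval s *: w).
Proof.
rewrite /frac; split=> [/eqP|e]; last apply/eqP.
  by rewrite -[_ == _]/(\pi_(loc) (v, s) == \pi_(loc) (w, t)) eqquotE => /asboolP.
by rewrite eqquotE; apply/asboolP.
Qed.

Fact repr_frac v s : exists u : denom,
  dval u *: (dval s *: (repr (frac v s)).1)
  = dval u *: (dval (repr (frac v s)).2 *: v).
Proof.
by apply/fracE; rewrite -[in RHS](reprK (frac v s)) /frac -surjective_pairing.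
Qed.

Definition loc_add (x y : loc) : loc :=
  frac (dval (repr y).2 *: (repr x).1 + dval (repr x).2 *: (repr y).1)
       (denomM (repr x).2 (repr y).2).
Definition loc_opp (x : loc) : loc := frac (- (repr x).1) (repr x).2.
Definition loc_zero : loc := frac 0 denom1.

Fact loc_addE v s w t :
  loc_add (frac v s) (frac w t) = frac (dval t *: v + dval s *: w) (denomM s t).
Proof.
have [a ea] := repr_frac v s; have [b eb] := repr_frac w t.
apply/fracE; rewrite /loc_add.
move: (repr (frac v s)) (repr (frac w t)) ea eb => [v' s'] [w' t'] /= ea eb.
exists (denomM a b); rewrite /= ?denomE !scalerDr !scalerA; congr (_ + _).
  transitivity ((dval b * dval t * dval t') *: (dval a *: (dval s *: v'))).
    by rewrite !scalerA; congr (_ *: _); ring.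
  by rewrite ea !scalerA; congr (_ *: _); ring.
transitivity ((dval a * dval s * dval s') *: (dval b *: (dval t *: w'))).
  by rewrite !scalerA; congr (_ *: _); ring.
by rewrite eb !scalerA; congr (_ *: _); ring.
Qed.

Fact loc_oppE v s : loc_opp (frac v s) = frac (- v) s.
Proof.
have [a ea] := repr_frac v s; apply/fracE; exists a.
by rewrite !scalerN ea.
Qed.

Fact loc_addA : associative loc_add.
Proof.
move=> x y z; have [u [r ->]] := fracP x; have [v [s ->]] := fracP y.
have [w [t ->]] := fracP z; rewrite !loc_addE; apply/fracE; exists denom1.
by rewrite /= ?denomE !scalerDr !scalerA addrA; congr (_ + _ + _); congr (_ *: _); ring.
Qed.
Fact loc_addC : commutative loc_add.
Proof.
move=> x y; have [u [r ->]] := fracP x; have [v [s ->]] := fracP y.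
rewrite !loc_addE; apply/fracE; exists denom1.
by rewrite /= ?denomE addrC !scalerDr !scalerA; congr (_ + _); congr (_ *: _); ring.
Qed.
Fact loc_add0 : left_id loc_zero loc_add.
Proof.
move=> x; have [u [r ->]] := fracP x; rewrite loc_addE; apply/fracE.
by exists denom1; rewrite /= ?denomE scaler0 add0r !scalerA; congr (_ *: _); ring.
Qed.
Fact loc_addN : left_inverse loc_zero loc_opp loc_add.
Proof.
move=> x; have [u [r ->]] := fracP x; rewrite loc_oppE loc_addE; apply/fracE.
by exists denom1; rewrite /= ?denomE scalerN addNr !scaler0.
Qed.
HB.instance Definition _ :=
  GRing.isZmodule.Build loc loc_addA loc_addC loc_add0 loc_addN.

Fact fracD v s w t :
  frac v s + frac w t = frac (dval t *: v + dval s *: w) (denomM s t).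
Proof. exact: loc_addE. Qed.

End LocMod.

Definition loc_scale (M : lmodType R) (a : loc R^o) (x : loc M) : loc M :=
  frac ((repr a).1 *: (repr x).1) (denomM (repr a).2 (repr x).2).

Fact loc_scaleE (M : lmodType R) (a : R^o) s (v : M) t :
  loc_scale (frac a s) (frac v t) = frac ((a : R) *: v) (denomM s t).
Proof.
have [b eb] := repr_frac a s; have [c ec] := repr_frac v t.
apply/fracE; rewrite /loc_scale.
move: (repr (frac a s)) (repr (frac v t)) eb ec => [a' s'] [v' t'] /= eb ec.
exists (denomM b c); rewrite /= ?denomE !scalerA.
transitivity ((dval b * (dval s * a')) *: (dval c *: (dval t *: v'))).
  by rewrite !scalerA; congr (_ *: _); ring.
rewrite ec -[_ * (_ * _)]/(dval b *: (dval s *: a')) eb !scalerA.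
by congr (_ *: _); rewrite /GRing.scale /=; ring.
Qed.

(* The local ring R_p, with underlying group the localization of R^o. *)
Definition locR := loc R^o.
HB.instance Definition _ := GRing.Zmodule.on locR.

Definition locR1 : locR := frac (1 : R^o) denom1.
Definition locR_mul (a b : locR) : locR := loc_scale a b.

Section LocScale.
Variable M : lmodType R.

Fact loc_scaleA (a b : locR) (x : loc M) :
  loc_scale a (loc_scale b x) = loc_scale (locR_mul a b) x.
Proof.
have [u [r ->]] := fracP a; have [v [s ->]] := fracP b.
have [w [t ->]] := fracP x; rewrite /locR_mul (loc_scaleE v s w t).
rewrite (loc_scaleE u r v s) !loc_scaleE.
apply/fracE; exists denom1; rewrite /= ?denomE !scalerA.
by congr (_ *: _); rewrite [in RHS]/GRing.scale /=; ring.
Qed.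
Fact loc_scale1 : left_id locR1 (@loc_scale M).
Proof.
move=> x; have [u [r ->]] := fracP x; rewrite loc_scaleE; apply/fracE.
by exists denom1; rewrite /= ?denomE !scalerA; congr (_ *: _); ring.
Qed.
Fact loc_scaleDr : right_distributive (@loc_scale M) +%R.
Proof.
move=> a x y; have [u [r ->]] := fracP a; have [v [s ->]] := fracP x.
have [w [t ->]] := fracP y; rewrite fracD !loc_scaleE fracD; apply/fracE.
exists denom1; rewrite /= ?denomE !scalerDr !scalerA.
by congr (_ + _); congr (_ *: _); ring.
Qed.
Fact loc_scaleDl (x : loc M) : {morph (@loc_scale M)^~ x : a b / a + b}.
Proof.
move=> a b; have [u [r ->]] := fracP a; have [v [s ->]] := fracP b.
have [w [t ->]] := fracP x; rewrite fracD !loc_scaleE fracD; apply/fracE.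
exists denom1; rewrite /= ?denomE !scalerA -!scalerDl !scalerA.
by congr (_ *: _); rewrite /GRing.scale /=; ring.
Qed.

End LocScale.

Fact locR_mulC : commutative locR_mul.
Proof.
move=> a b; have [u [r ->]] := fracP a; have [v [s ->]] := fracP b.
rewrite /locR_mul !loc_scaleE; apply/fracE; exists denom1.
by rewrite /= ?denomE /GRing.scale /=; ring.
Qed.
Fact locR_mulA : associative locR_mul.
Proof. by move=> a b c; apply: loc_scaleA. Qed.
Fact locR_mul1 : left_id locR1 locR_mul.
Proof. exact: loc_scale1. Qed.
Fact locR_mulDl : left_distributive locR_mul +%R.
Proof. by move=> a b c; apply: loc_scaleDl. Qed.
Fact locR1_neq0 : locR1 != 0.
Proof.
apply/eqP => /fracE[u] /=; rewrite /GRing.scale /= !mulr0 !mulr1 => u0.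
have: dval u \notin p by exact: (valP u).
by rewrite u0 rpred0.
Qed.
HB.instance Definition _ := GRing.Zmodule_isComNzRing.Build locR
  locR_mulA locR_mulC locR_mul1 locR_mulDl locR1_neq0.

HB.instance Definition _ (M : lmodType R) :=
  GRing.Zmodule_isLmodule.Build locR (loc M)
    (@loc_scaleA M) (@loc_scale1 M) (@loc_scaleDr M) (@loc_scaleDl M).

End Loc.

(* rank M = r. R need not be reduced, so r need not be an integer: k has rank
   1/2 over k[t]/(t^2). *)
Definition has_rank (R : comNzRingType) (M : lmodType R) (r : rat) : Prop :=
  forall (p : prime_idealr R) (d : nat),
    minimal_prime p -> krull_dim R d -> quot_dim p d ->
    (mlength (loc p M : lmodType (locR p)))%:R
      = r * (mlength ((locR p)^o : lmodType (locR p)))%:R.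

(* S (x)_R M for S = R / I, as the free S-module on the set M modulo the
   relations making v |-> 1 (x) v additive and R-linear. *)
Section BaseChange.
Variables (R : comNzRingType) (I : idealr R) (M : lmodType R).
Local Notation S := {ideal_quot I}.
Local Notation gen v := (<< v >> : {freeg M / S}).

Definition tensor_rel : set {freeg M / S} := [set z |
  (exists u v : M, z = gen (u + v) - gen u - gen v) \/
  (exists (a : R) (v : M), z = gen (a *: v) - (\pi_(S) a : S) *: gen v)].

Definition base_change : lmodType S :=
  quotmod (span tensor_rel : submodClosed {freeg M / S}).

End BaseChange.

(* Over the field R / m, [Vector.axiom n V] says that V has dimension n. *)
Definition nu (R : comNzRingType) (m : idealr R) (M : lmodType R) : nat :=
  xget 0%N [set n | inhabited (Vector.axiom n (base_change m M))].

Section Koszul.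
Variables (R : comNzRingType) (d : nat) (x : 'I_d -> R) (M : lmodType R).

Definition isubset (i : nat) := {S : {set 'I_d} | #|S| == i}.

(* K_i(x; M), the coordinate of f on e_S = e_{s_1} /\ ... /\ e_{s_i} being f S
   for S = {s_1 < ... < s_i}. *)
Definition koszul (i : nat) : lmodType R := {ffun isubset i -> M}.

Definition kcoord (i : nat) (f : koszul i) (S : {set 'I_d}) : M :=
  oapp f 0 (insub S : option (isubset i)).

(* K_i -> K_{i-1}, e_S |-> \sum_k (-1)^(k-1) x_{s_k} e_{S \ s_k}: the coordinate
   on e_T collects the terms S = j |: T. It vanishes for i = 0. *)
Definition kdiff (i : nat) (f : koszul i) : koszul i.-1 :=
  [ffun T : isubset i.-1 =>
     \sum_(j < d | j \notin val T)
        ((-1) ^+ #|[set t in val T | (t < j)%N]| * x j) *: kcoord f (j |: val T)].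

Fact kdiff_linear i : linear (@kdiff i).
Proof.
move=> a f g; apply/ffunP => T; rewrite !ffunE scaler_sumr -big_split /=.
apply: eq_bigr => j _; rewrite /kcoord; case: insub => [S|] /=.
  by rewrite !ffunE scalerDr !scalerA; congr (_ *: _ + _); ring.
by rewrite !scaler0 addr0.
Qed.
HB.instance Definition _ i :=
  GRing.isLinear.Build R (koszul i) (koszul i.-1) *:%R (@kdiff i)
    (@kdiff_linear i).

Definition koszul_homology (i : nat) : lmodType R :=
  homology (@kdiff i.+1) (@kdiff i).

Definition lengthH (i : nat) : nat := mlength (koszul_homology i).

Definition chi1 : int :=
  \sum_(1 <= i < d.+1) (-1) ^+ i.-1 * (lengthH i)%:Z.

End Koszul.

Section LimCM.
Variables (R : comNzRingType) (m : idealr R) (d : nat).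
Variable M : nat -> lmodType R.

Definition homology_o (x : 'I_d -> R) (b : nat -> rat) : Prop :=
  forall i : nat, (1 <= i)%N ->
    little_o (fun n => (lengthH x (M n) i)%:R) b.

Definition chi1_o (x : 'I_d -> R) (b : nat -> rat) : Prop :=
  little_o (fun n => (chi1 x (M n))%:~R) b.

Definition nu_seq : nat -> rat := fun n => (nu m (M n))%:R.

(* Here d is dim R, as enforced by [sop]. *)
Definition lim_CM : Prop :=
  (forall n, fingen (M n) /\ exists v : M n, v != 0) /\
  exists x : 'I_d -> R, sop m x /\ homology_o x nu_seq.

Definition weakly_lim_CM : Prop :=
  (forall n, fingen (M n) /\ mod_dim (M n) d) /\
  forall x : 'I_d -> R, sop m x -> chi1_o x nu_seq.

End LimCM.

(* Main.v *)
(* Write h_i for the length of H_i(x; M), chi for their alternating sum and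
   chi_1 = h_0 - chi.  By a prime filtration of M, chi(x; M) is the sum of the
   chi(x; R/q) over the top dimensional factors R/q, the others contributing 0;
   counting those factors by localization gives chi(x; M) = rank(M) chi(x; R).
   Hence nu(M) <= h_0 = rank(M) chi(x; R) + chi_1, so that chi_1 = o(nu) forces
   nu = O(rank), whereas rank(M) <= nu(M) always: o(nu) and o(rank) agree.

   Independence of the system of parameters, for homology: as powers of the x_i
   kill H(y; M), h_i(y) is bounded by a constant times h_{i+d}(x, y; M), which
   in turn is bounded by a constant times the sum of the h_j(x; M), j >= 1.
   For chi_1: two systems are joined by a chain in which one element changes at
   a time, and for such an exchange a^t = b c modulo the common elements, where
   chi_1(.., b) <= chi_1(.., b c) = chi_1(.., a^t) <= t chi_1(.., a). *)
From HB Require Import structures.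
From mathcomp Require Import freeg.
From mathcomp Require Import all_boot all_order all_algebra ring_quotient generic_quotient.
From mathcomp Require Import boolp classical_sets reals topology normedtype sequences landau.
Require Import Defs.
From mathcomp Require Import zify ring lra.

Set Implicit Arguments.
Unset Strict Implicit.
Unset Printing Implicit Defensive.

Import GRing.Theory Num.Theory Order.TTheory.
Import numFieldNormedType.Exports.
Local Open Scope ring_scope.
#[local] Obligation Tactic := idtac.

(** * Submodules and lengths *)

(** Positivity takes the place of multiplicity theory: no Hilbert function occurs. On a prime factor
    R/q an element [c] either acts as zero, and the two terms of the cone recursion for chi cancel,
    or is regular, and the sequence gets shorter. This gives chi >= 0, the vanishing of chi below
    the top dimension, and the case of Krull's principal ideal theorem that the exchange of
    parameters requires. The recursion alternates between kernels and cokernels of elements; as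
    pairs of submodules of one fixed module they all stay in one type, and the induction goes
    through. The modules M_n vary, so a comparison of two systems must have a constant depending on
    R and the systems only. Hence powers and congruences are taken in R, before a module is chosen.
    The bound rank(M) <= nu(M) is read off at one minimal prime of top dimension, where a module
    with nu generators has at most nu times the length of R_p. In the other direction the constant
    is chi(x; R): once chi_1 <= nu/2, that term is absorbed on the left. *)

Section Smod.
Variable R : comNzRingType.

(* Submodules as Prop-valued predicates, so that extensionally equal ones are
   equal.  Throughout, a pair A <= B of submodules of V stands for the
   subquotient B / A; quotient modules are never formed. *)
Record smod (V : lmodType R) := Smod {
  smem :> V -> Prop;
  smem0 : smem 0;
  smemP : forall a u v, smem u -> smem v -> smem (a *: u + v) }.

Record lmap (V W : lmodType R) := Lmap {
  lfun :> V -> W;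
  lmapP : forall a u v, lfun (a *: u + v) = a *: lfun u + lfun v }.

Definition sle (V : lmodType R) (A B : smod V) := forall v, A v -> B v.

Lemma smod_eq (V : lmodType R) (A B : smod V) : sle A B -> sle B A -> A = B.
Proof.
case: A => A A0 AP; case: B => B B0 BP /= AB BA.
have E : A = B by apply: funext => v; apply: propext; split; [apply: AB|apply: BA].
by case: _ / E in B0 BP AB BA *; congr Smod; apply: Prop_irrelevance.
Qed.

Section Ops.
Variables (V W : lmodType R).
Implicit Types A B : smod V.

Lemma smemD A u v : A u -> A v -> A (u + v).
Proof. by move=> Au Av; rewrite -[u]scale1r; apply: smemP. Qed.
Lemma smemZ A a u : A u -> A (a *: u).
Proof. by move=> Au; rewrite -[_ *: _]addr0; apply: smemP => //; apply: smem0. Qed.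
Lemma smemN A u : A u -> A (- u).
Proof. by move=> Au; rewrite -scaleN1r; apply: smemZ. Qed.
Lemma smemB A u v : A u -> A v -> A (u - v).
Proof. by move=> Au Av; apply: smemD => //; apply: smemN. Qed.
Lemma smemNE A u : A (- u) -> A u.
Proof. by move=> /smemN; rewrite opprK. Qed.
Lemma smemBr A u v : A (u - v) -> A v -> A u.
Proof. by move=> Auv Av; rewrite -(subrK v u); apply: smemD. Qed.
Lemma smem_sum A I (r : seq I) (P : pred I) (F : I -> V) :
  (forall i, P i -> A (F i)) -> A (\sum_(i <- r | P i) F i).
Proof. by move=> AF; apply: big_ind => //; [apply: smem0|move=> *; apply: smemD]. Qed.

Lemma lmap0 (f : lmap V W) : f 0 = 0.
Proof. by have := lmapP f (-1) 0 0; rewrite !scaleN1r oppr0 addr0 addNr. Qed.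
Lemma lmapD (f : lmap V W) u v : f (u + v) = f u + f v.
Proof. by have := lmapP f 1 u v; rewrite !scale1r. Qed.
Lemma lmapZ (f : lmap V W) a u : f (a *: u) = a *: f u.
Proof. by have := lmapP f a u 0; rewrite lmap0 !addr0. Qed.
Lemma lmapN (f : lmap V W) u : f (- u) = - f u.
Proof. by rewrite -!scaleN1r lmapZ. Qed.
Lemma lmapB (f : lmap V W) u v : f (u - v) = f u - f v.
Proof. by rewrite lmapD lmapN. Qed.

Program Definition s0 : smod V := @Smod V (fun v => v = 0) _ _.
Next Obligation. by []. Qed.
Next Obligation. by move=> a u v -> ->; rewrite scaler0 addr0. Qed.
Definition sT : smod V := @Smod V (fun _ => True) I (fun _ _ _ _ _ => I).
Program Definition sadd A B : smod V :=
  @Smod V (fun v => exists u w, [/\ A u, B w & v = u + w]) _ _.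
Next Obligation. by move=> A B; exists 0, 0; split; rewrite ?addr0 //; apply: smem0. Qed.
Next Obligation.
move=> A B a u v [u1 [u2 [A1 B1 ->]]] [v1 [v2 [A2 B2 ->]]].
by exists (a *: u1 + v1), (a *: u2 + v2); split; [exact: smemP|exact: smemP|rewrite scalerDr addrACA].
Qed.
Program Definition scap A B : smod V := @Smod V (fun v => A v /\ B v) _ _.
Next Obligation. by move=> A B; split; apply: smem0. Qed.
Next Obligation. by move=> A B a u v [? ?] [? ?]; split; apply: smemP. Qed.
Program Definition simg (f : lmap V W) A : smod W :=
  @Smod W (fun w => exists2 v, A v & w = f v) _ _.
Next Obligation. by move=> f A; exists 0; [apply: smem0|rewrite lmap0]. Qed.
Next Obligation.
by move=> f A a u v [x Ax ->] [y Ay ->]; exists (a *: x + y); [apply: smemP|rewrite lmapP].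
Qed.
Program Definition spre (f : lmap V W) (A : smod W) : smod V :=
  @Smod V (fun v => A (f v)) _ _.
Next Obligation. by move=> f A /=; rewrite lmap0; apply: smem0. Qed.
Next Obligation. by move=> f A a u v /= Au Av; rewrite lmapP; apply: smemP. Qed.

Program Definition lscal (c : R) : lmap V V := @Lmap V V ( *:%R c) _.
Next Obligation. by move=> c a u v; rewrite /= scalerDr !scalerA mulrC. Qed.
Definition lid : lmap V V := @Lmap V V id (fun _ _ _ => erefl).

Lemma sle_refl A : sle A A. Proof. by []. Qed.
Lemma sle_trans B A C : sle A B -> sle B C -> sle A C.
Proof. by move=> AB BC v /AB /BC. Qed.
Lemma s0_le A : sle s0 A. Proof. by move=> v ->; apply: smem0. Qed.
Lemma sle_T A : sle A sT. Proof. by []. Qed.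
Lemma sadd_l A B : sle A (sadd A B).
Proof. by move=> v Av; exists v, 0; split; rewrite ?addr0 //; apply: smem0. Qed.
Lemma sadd_r A B : sle B (sadd A B).
Proof. by move=> v Av; exists 0, v; split; rewrite ?add0r //; apply: smem0. Qed.
Lemma sadd_le A B C : sle A C -> sle B C -> sle (sadd A B) C.
Proof. by move=> AC BC v [u [w [/AC ? /BC ? ->]]]; apply: smemD. Qed.
Lemma scap_l A B : sle (scap A B) A. Proof. by move=> v []. Qed.
Lemma scap_r A B : sle (scap A B) B. Proof. by move=> v []. Qed.

End Ops.

Section Length.
Variable V : lmodType R.
Implicit Types A B C X : smod V.

(* Strict chains of length k starting above A and ending at B. *)
Fixpoint schain k A B : Prop :=
  if k is k'.+1 then exists X, [/\ schain k' A X, sle X B & ~ sle B X] else sle A B.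

Lemma schain_le k A B : schain k A B -> sle A B.
Proof.
elim: k B => [|k IH] B //= [X [/IH AX XB _]]; exact: sle_trans XB.
Qed.
Lemma schain_up k A B C : schain k A B -> sle B C -> schain k A C.
Proof.
case: k => [|k] /= AB BC; first exact: sle_trans BC.
case: AB => X [AX XB nBX]; exists X; split=> //; first exact: sle_trans BC.
by move=> CX; apply: nBX; exact: sle_trans CX.
Qed.
Lemma schain_dn k A B C : sle A B -> schain k B C -> schain k A C.
Proof.
move=> AB; elim: k C => [|k IH] C /=; first exact: sle_trans.
by case=> X [/IH AX XC nCX]; exists X.
Qed.
Lemma schain_cat k l A B C : schain k A B -> schain l B C -> schain (k + l) A C.
Proof.
move=> AB; elim: l C => [|l IH] C /=; first by rewrite addn0; apply: schain_up.
by case=> X [/IH AX XC nCX]; rewrite addnS /=; exists X.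
Qed.
Lemma schain_lt k A B : schain k.+1 A B -> schain k A B.
Proof. by case=> X [AX XB _]; apply: schain_up XB. Qed.
Definition islen A B n := is_max (fun k => schain k A B) n.
Definition fin A B := exists n, islen A B n.
(* Junk value 0 when B / A has infinite length. *)
Definition len A B : nat := xget 0%N [set n | islen A B n].

Lemma islen_uniq A B n k : islen A B n -> islen A B k -> n = k.
Proof. by case=> n1 n2 [k1 k2]; apply/eqP; rewrite eqn_leq k2 // n2. Qed.
Lemma lenE A B n : islen A B n -> len A B = n.
Proof. by move=> H; apply: (islen_uniq _ H); apply: (xgetPex 0%N); exists n. Qed.
Lemma finP A B : fin A B -> islen A B (len A B).
Proof. by case=> n H; rewrite (lenE H). Qed.
Lemma fin_bound A B n : sle A B -> (forall k, schain k A B -> (k <= n)%N) -> fin A B.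
Proof.
move=> AB; elim: n => [|n IH] Hn; first by exists 0%N.
case: (pselect (schain n.+1 A B)) => H; first by exists n.+1.
apply: IH => k Hk; have := Hn _ Hk; rewrite leq_eqVlt => /orP[/eqP E|//].
by rewrite E in Hk.
Qed.
Lemma schain_len A B k : fin A B -> schain k A B -> (k <= len A B)%N.
Proof. by move=> /finP[_]; apply. Qed.
End Length.
End Smod.

Arguments sadd : simpl never.
Arguments simg : simpl never.
Arguments s0 {R V}.
Arguments sT {R V}.
Arguments lid {R V}.
Arguments lscal {R V} c.
Notation "A <=s B" := (sle A B) (at level 70).

#[local] Hint Resolve sle_refl s0_le sle_T sadd_l sadd_r scap_l scap_r : core.
#[local] Hint Resolve smem0 : core.

Section Isom.
Variables (R : comNzRingType) (V W : lmodType R) (f : lmap V W) (G : smod V).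
Implicit Types X Y T : smod W.
Implicit Types S : smod V.
Local Notation pr X := (scap G (spre f X)).

(** Strictness survives because [f] maps [G] onto [Y] modulo [X]: each element of [T] is an element
    of [X] plus some [f g], so an inclusion between preimages forces one between the submodules. *)
Lemma schain_pre k X Y T : Y <=s sadd X (simg f G) -> T <=s Y ->
  schain k X T -> schain k (pr X) (pr T).
Proof.
move=> HY; elim: k T => [|k IH] T /= TY.
  by move=> XT v [Gv Xv]; split=> //; apply: XT.
case=> T' [/[dup] XT' /IH HT' T'T nTT']; exists (pr T'); split.
- by apply: HT'; exact: sle_trans T'T TY.
- by move=> v [Gv T'v]; split=> //; apply: T'T.
move=> H; apply: nTT' => t Tt.
have [x [fg [Xx [g Gg ->] E]]] := HY _ (TY _ Tt).
have T'x : T' x by apply: (schain_le XT').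
have [_ T'g] : pr T' g.
  apply: H; split=> //=; have -> : f g = t - x by rewrite E addrC addKr.
  by apply: smemB => //; apply: T'T.
by rewrite E; apply: smemD.
Qed.

(** The chain lies above the preimage of [X], hence contains all elements of [G] that [f] sends into
    [X]; so its images stay distinct modulo [X]. *)
Lemma schain_img k X S : S <=s G -> schain k (pr X) S -> schain k X (sadd X (simg f S)).
Proof.
elim: k S => [|k IH] S /= SG; first by [].
case=> S' [/[dup] XS' /IH HS' S'S nSS']; exists (sadd X (simg f S')); split.
- by apply: HS'; exact: sle_trans S'S SG.
- apply: sadd_le => // _ [v S'v ->]; apply: sadd_r.
  by exists v => //; apply: S'S.
move=> H; apply: nSS' => s Ss.
have [|x [fs [Xx [s' S's' ->] E]]] := H (f s).
  by apply: sadd_r; exists s.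
apply: (@smemBr _ _ _ _ s') => //; apply: (schain_le XS'); split.
  by apply: SG; apply: smemB => //; apply: S'S.
by rewrite /= lmapB E addrK.
Qed.

(* All isomorphism theorems in one: f identifies the subquotient Y / X with the
   one cut out by preimages in G. *)
Lemma isom_islen X Y n : X <=s Y -> Y <=s sadd X (simg f G) ->
  islen (pr X) (pr Y) n <-> islen X Y n.
Proof.
move=> XY HY.
have E k : schain k (pr X) (pr Y) <-> schain k X Y.
  split; last exact: schain_pre HY _.
  move=> /schain_img H; apply: schain_up (H _) _ => //.
  by apply: sadd_le => // _ [v [Gv Yv] ->].
by rewrite /islen /is_max; split=> -[/E H1 H2]; split=> // k /E /H2.
Qed.

Lemma isom X Y : X <=s Y -> Y <=s sadd X (simg f G) ->
  (fin (pr X) (pr Y) <-> fin X Y) /\ len (pr X) (pr Y) = len X Y.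
Proof.
move=> XY HY; have E n := isom_islen n XY HY.
split; first by split=> -[n /E Hn]; exists n.
case: (pselect (fin X Y)) => [[n Hn]|nf].
  by rewrite (lenE Hn); apply/lenE/E.
rewrite /len !xgetPN // => n /= Hn; apply: nf; exists n => //; by apply/E.
Qed.

(** [S1] and [S2] are whatever submodules an application offers; their description as preimages is
    left as two equations, to be proved by extensionality. *)
Lemma isom_gen S1 S2 X Y : X <=s Y -> Y <=s sadd X (simg f G) ->
  S1 = pr X -> S2 = pr Y ->
  (fin S1 S2 <-> fin X Y) /\ len S1 S2 = len X Y.
Proof. by move=> XY HY -> ->; apply: isom. Qed.
End Isom.

Section LengthAdd.
Variables (R : comNzRingType) (V : lmodType R).
Implicit Types A B C X : smod V.

Lemma spre_id A : spre lid A = A.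
Proof. exact: smod_eq. Qed.

Lemma second_iso A B : 
  (fin (scap A B) A <-> fin B (sadd A B)) /\ len (scap A B) A = len B (sadd A B).
Proof.
apply: (@isom_gen _ _ _ lid A) => //.
- by apply: sadd_le => // v Av; apply: sadd_r; exists v.
- by rewrite spre_id.
- by apply: smod_eq => v; [move=> Av; split=> //; apply: (@sadd_l _ _ A B v Av)|case].
Qed.

(** The top step from [X] to [C] is charged to one side. If [B] lies in [X], it is a step above [B].
    Otherwise the intersection of [B] and [X] is strictly smaller than [B], and the part of the
    chain above that intersection is carried above [B] as in the second isomorphism theorem. *)
Lemma schain_split k A B C : A <=s B -> B <=s C -> schain k A C ->
  exists i j, [/\ schain i A B, schain j B C & (k <= i + j)%N].
Proof.
elim: k B C => [|k IH] B C AB BC /=; first by exists 0%N, 0%N.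
case=> X [AX XC nCX].
have [||i [j [Hi Hj le_k]]] := IH (scap B X) X _ _ AX => //.
  by move=> v Av; split; [apply: AB|apply: (schain_le AX)].
case: (pselect (B <=s X)) => BX.
  have E : scap B X = B by apply: smod_eq => // v Bv; split=> //; apply: BX.
  exists i, j.+1; rewrite E in Hi Hj; split=> //; last by rewrite addnS.
  by exists X.
exists i.+1, j; split=> //.
  by exists (scap B X); split=> // H; apply: BX => v /H[].
have : schain j B (sadd B (simg lid X)).
  apply: (@schain_img _ _ _ lid X) => //.
  have -> // : scap X (spre lid B) = scap B X.
  by apply: smod_eq => v [].
by move=> /schain_up; apply; apply: sadd_le => // _ [v Xv ->]; apply: XC.
Qed.

Lemma len_add A B C : A <=s B -> B <=s C ->
  (fin A C <-> fin A B /\ fin B C) /\ (fin A C -> len A C = len A B + len B C)%N.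
Proof.
move=> AB BC.
have F : fin A B -> fin B C -> islen A C (len A B + len B C).
  move=> fAB fBC; split; first by apply: schain_cat; [apply: (finP fAB).1|apply: (finP fBC).1].
  move=> k /(schain_split AB BC)[i [j [Hi Hj /leq_trans]]]; apply.
  by apply: leq_add; apply: schain_len.
have G : fin A C -> fin A B /\ fin B C.
  move=> [n [_ Hn]]; split; apply: (@fin_bound _ _ _ _ n) => // k Hk; apply: Hn.
    exact: schain_up Hk BC.
  exact: schain_dn AB Hk.
split; last by move=> /G[fAB fBC]; apply/lenE/F.
by split=> [/G//|[fAB fBC]]; eexists; apply: F.
Qed.

Lemma fin_refl A : fin A A /\ len A A = 0%N.
Proof.
have H : islen A A 0.
  split=> //= -[|k] //= [X [/schain_le AX _ nAX]]; by case: nAX.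
by split; [exists 0%N|apply: lenE].
Qed.
End LengthAdd.

(* The degree shift G[-1]; it is 0 in degree 0. *)
Definition shiftg (R : comNzRingType) (W : lmodType R) (G : nat -> smod W) (i : nat) : smod W :=
  if i is j.+1 then G j else s0.
Definition shiftn (h : nat -> nat) (i : nat) : nat := if i is j.+1 then h j else 0.

(** * Long exact sequences and mapping cones *)

Section Complex.
Variables (R : comNzRingType) (W : lmodType R) (D : lmap W W).
Implicit Types N P G : nat -> smod W.

(* A complex is a module W with D : W -> W and graded pieces given by a family
   of submodules; the families N <= G stand for the complex G / N, whose cycles
   and boundaries in degree i are then submodules of W. *)
Definition subcx G := forall i, sle (G i) (spre D (shiftg G i)).
Definition chcycles N G i := scap (G i) (spre D (shiftg N i)).
Definition chbounds N G i := sadd (simg D (G i.+1)) (N i).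
Definition hlen N G i := len (chbounds N G i) (chcycles N G i).
Definition hfin N G := forall i, fin (chbounds N G i) (chcycles N G i).

Lemma shiftg_le N G : (forall i, sle (N i) (G i)) -> forall i, sle (shiftg N i) (shiftg G i).
Proof. by move=> NG [|i] //=. Qed.

Hypothesis DD : forall w, D (D w) = 0.

Lemma chbounds_le_chcycles N G i : (forall i, sle (N i) (G i)) -> subcx N -> subcx G ->
  sle (chbounds N G i) (chcycles N G i).
Proof.
move=> NG sN sG _ [_ [n [[w Gw ->] Nn ->]]]; split.
  by apply: smemD; [apply: (sG _ _ Gw)|apply: NG].
by rewrite /= lmapD DD add0r; apply: (sN _ _ Nn).
Qed.

Section LES.
Variables N P G : nat -> smod W.
Hypotheses (NP : forall i, sle (N i) (P i)) (PG : forall i, sle (P i) (G i)).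
Hypotheses (sN : subcx N) (sP : subcx P) (sG : subcx G).

Let NG i : sle (N i) (G i). Proof. exact: sle_trans (PG (i:=i)). Qed.
(** [Y i] modulo [X i] is the image of the connecting map from H_i(G/P) to H_{i-1}(P/N): boundaries
    of G/N that lie in P, modulo boundaries of P/N. *)
Let X i := sadd (simg D (P i)) (shiftg N i).
Let Y i := scap (sadd (simg D (G i)) (shiftg N i)) (shiftg P i).

Let BP_le i : chbounds N P i <=s scap (chbounds N G i) (P i).
Proof.
move=> _ [_ [n [[w Pw ->] Nn ->]]]; split.
  by exists (D w), n; split=> //; exists w => //; apply: PG.
by apply: smemD; [apply: (sP Pw)|apply: NP].
Qed.

Let BP_Z i : scap (chbounds N G i) (P i) <=s chcycles N P i.
Proof.
move=> w [Bw Pw]; split=> //.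
by have [] := chbounds_le_chcycles NG sN sG Bw.
Qed.

(** Both sides are the image of H_i(P/N) in H_i(G/N). *)
Let iso1 i : (fin (scap (chbounds N G i) (P i)) (chcycles N P i) <->
              fin (chbounds N G i) (sadd (chbounds N G i) (chcycles N P i))) /\
  len (scap (chbounds N G i) (P i)) (chcycles N P i) =
  len (chbounds N G i) (sadd (chbounds N G i) (chcycles N P i)).
Proof.
apply: (@isom_gen _ _ _ lid (chcycles N P i)) => //.
- by apply: sadd_le => // v Av; apply: sadd_r; exists v.
- apply: smod_eq => v; last by case=> -[].
  by move=> Hv; split; [apply: BP_Z|case: Hv].
apply: smod_eq => v; last by case.
by move=> Hv; split=> //; apply: sadd_r (Hv).
Qed.

Let B'_le i : sadd (chbounds N G i) (chcycles N P i) <=s chcycles N G i.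
Proof.
apply: sadd_le; first exact: chbounds_le_chcycles.
by move=> v [Pv Dv]; split=> //; apply: PG.
Qed.

(** Exactness at H_i(G/N): its quotient by the image of H_i(P/N) is its image in H_i(G/P). *)
Let iso2 i : (fin (sadd (chbounds N G i) (chcycles N P i)) (chcycles N G i) <->
              fin (chbounds P G i) (sadd (chcycles N G i) (P i))) /\
  len (sadd (chbounds N G i) (chcycles N P i)) (chcycles N G i) =
  len (chbounds P G i) (sadd (chcycles N G i) (P i)).
Proof.
apply: (@isom_gen _ _ _ lid (chcycles N G i)).
- move=> _ [_ [p [[w Gw ->] Pp ->]]]; apply: smemD; last exact: sadd_r.
  apply: sadd_l; apply: (chbounds_le_chcycles NG sN sG); apply: sadd_l; by exists w.
- move=> _ [z [p [Zz Pp ->]]]; rewrite addrC; exists p, z; split=> //.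
    exact: sadd_r.
  by exists z.
- apply: smod_eq => v.
    move=> Hv; split; first exact: B'_le.
    case: Hv => _ [z [[_ [n [[w Gw ->] Nn ->]]] [Pz _] ->]].
    rewrite /= -addrA; exists (D w), (n + z); split=> //; first by exists w.
    by apply: smemD => //; apply: NP.
  case=> Zv [_ [p [[w Gw ->] Pp /= E]]]; rewrite E.
  have Bw : chbounds N G i (D w) by apply: sadd_l; exists w.
  exists (D w), p; split=> //; split=> //.
  have -> : p = v - D w by rewrite E /= addrC addKr.
  have [_ Dw] := chbounds_le_chcycles NG sN sG Bw; case: Zv => _ Dv; exact: smemB Dv Dw.
apply: smod_eq => v; last by case.
by move=> Hv; split=> //; apply: sadd_l (Hv).
Qed.

Let Z'_le i : sadd (chcycles N G i) (P i) <=s chcycles P G i.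
Proof.
apply: sadd_le.
  by move=> v [Gv Dv]; split=> //; apply: (shiftg_le NP).
by move=> v Pv; split; [apply: PG|apply: (sP Pv)].
Qed.

Let B''_le i : chbounds P G i <=s sadd (chcycles N G i) (P i).
Proof.
move=> _ [_ [p [[w Gw ->] Pp ->]]]; apply: smemD; last exact: sadd_r.
apply: sadd_l; apply: (chbounds_le_chcycles NG sN sG); apply: sadd_l; by exists w.
Qed.

(** Here [D] itself is the isomorphism: it carries what remains of H_i(G/P) onto the image of the
    connecting map. *)
Let iso3 i : (fin (sadd (chcycles N G i) (P i)) (chcycles P G i) <-> fin (X i) (Y i)) /\
  len (sadd (chcycles N G i) (P i)) (chcycles P G i) = len (X i) (Y i).
Proof.
apply: (@isom_gen _ _ _ D (G i)).
- move=> _ [_ [n [[w Pw ->] Nn ->]]]; split.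
    by exists (D w), n; split=> //; exists w => //; apply: PG.
  by apply: smemD; [apply: (sP Pw)|apply: (shiftg_le NP)].
- move=> _ [[_ [n [[w Gw ->] Nn ->]]] _]; rewrite addrC.
  by exists n, (D w); split=> //; [apply: sadd_r|exists w].
- apply: smod_eq => v.
    move=> [z [p [[Gz Dz] Pp ->]]]; split; first by apply: smemD => //; apply: PG.
    by rewrite /= addrC lmapD; exists (D p), (D z); split=> //; exists p.
  case=> Gv [_ [n [[p Pp ->] Nn E]]]; exists (v - p), p.
  split; rewrite ?subrK //; split; first by apply: smemB => //; apply: PG.
  by rewrite /= lmapB E addrC addKr.
apply: smod_eq => v.
  move=> [Gv Dv]; split=> //; split=> //.
  by apply: sadd_l; exists v.
by move=> [Gv [_ Dv]].
Qed.

(* The numerical content of the long exact sequence: dl i is the length of the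
   image of the connecting map H_{i+1}(G/P) -> H_i(P/N). *)
Lemma les_num : hfin N P -> hfin P G -> hfin N G /\
  exists dl : nat -> nat, forall i,
   (hlen N G i + dl i + shiftn dl i = hlen N P i + hlen P G i)%N /\ (dl i <= hlen N P i)%N.
Proof.
move=> fP fG.
have a1 i := len_add (@BP_le i) (@BP_Z i).
have a2 i := len_add (@sadd_l _ _ (chbounds N G i) (chcycles N P i)) (@B'_le i).
have a3 i := len_add (@B''_le i) (@Z'_le i).
have F1 i : fin (chbounds N P i) (scap (chbounds N G i) (P i)) /\
            fin (scap (chbounds N G i) (P i)) (chcycles N P i) by apply/(a1 i).1.
have F3 i : fin (chbounds P G i) (sadd (chcycles N G i) (P i)) /\
            fin (sadd (chcycles N G i) (P i)) (chcycles P G i) by apply/(a3 i).1.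
have F : hfin N G.
  move=> i; apply/(a2 i).1; split; first by apply/(iso1 i).1; case: (F1 i).
  by apply/(iso2 i).1; case: (F3 i).
split=> //; exists (fun i => len (X i.+1) (Y i.+1)) => i.
(* In degree 0 the degree shift is zero, so [X 0] and [Y 0] are both zero: no connecting map starts
   there, in accordance with [shiftn]. *)
have E : len (X i) (Y i) = shiftn (fun i => len (X i.+1) (Y i.+1)) i.
  case: i => //=; rewrite (_ : X 0 = Y 0); first exact: (fin_refl _).2.
  apply: smod_eq => w.
    move=> [_ [n [[p Pp ->] Nn ->]]]; have -> : D p = 0 by apply: (sP Pp).
    by rewrite add0r Nn; apply: smem0.
  by case=> _ ->; apply: smem0.
rewrite /hlen (a2 i).2 // (a1 i).2 // (a3 i).2 // (iso1 i).2 (iso2 i).2 (iso3 i).2 -E.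
rewrite -[len (X i.+1) _]/(len (chbounds N P i) (scap (chbounds N G i) (P i))); split; lia.
Qed.

End LES.
End Complex.

Section Cone.
Variables (R : comNzRingType) (W : lmodType R).
Implicit Types A B E T G : nat -> smod W.

Program Definition lfst : lmap (W * W)%type W := @Lmap _ _ _ (fun w => w.1) _.
Next Obligation. by []. Qed.
Program Definition lsnd : lmap (W * W)%type W := @Lmap _ _ _ (fun w => w.2) _.
Next Obligation. by []. Qed.

Program Definition sprod (A B : smod W) : smod (W * W)%type :=
  @Smod _ _ (fun w => A w.1 /\ B w.2) _ _.
Next Obligation. by move=> A B; split; apply: smem0. Qed.
Next Obligation. by move=> A B a u v [? ?] [? ?]; split; apply: smemP. Qed.

Program Definition coneD (c : R) (D : lmap W W) : lmap (W * W)%type (W * W)%type :=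
  @Lmap _ _ _ (fun w => (D w.1 + c *: w.2, - D w.2)) _.
Next Obligation.
move=> c D a [u1 u2] [v1 v2]; congr pair => /=.
  by rewrite lmapP !scalerDr !scalerA [c * a]mulrC addrACA.
by rewrite lmapP opprD scalerN.
Qed.

Definition coneG A T i := sprod (A i) (shiftg T i).

Lemma shiftg_coneG A T i w : shiftg (coneG A T) i w <-> shiftg A i w.1 /\ shiftg (shiftg T) i w.2.
Proof. by case: i => //=; split=> [-> //|[]]; case: w => u v /= -> ->. Qed.

Variables (c : R) (D : lmap W W).
Hypothesis DD : forall w, D (D w) = 0.

Lemma coneDD w : coneD c D (coneD c D w) = 0.
Proof.
by case: w => u v; congr pair => /=;
  rewrite ?lmapD ?lmapN ?lmapZ !DD ?add0r ?scalerN ?subrr ?oppr0.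
Qed.

Lemma coneG_sub A T : subcx D A -> subcx D T -> (forall i v, T i v -> A i (c *: v)) ->
  subcx (coneD c D) (coneG A T).
Proof.
move=> sA sT TA i [u v] [/= Au Tv]; apply/shiftg_coneG; split=> /=.
  apply: smemD; first exact: sA Au.
  by case: i Tv {Au} => [/= ->|i] /=; [rewrite scaler0|apply: TA].
by apply: smemN; case: i Tv {Au} => [/= ->|i /sT//]; rewrite lmap0.
Qed.

Section Fst.
Variables A T B T' E : nat -> smod W.
Hypotheses (sA : subcx D A) (sB : subcx D B) (sT' : subcx D T').
Hypotheses (AB : forall i, sle (A i) (B i)) (TB : forall i v, T' i v -> B i (c *: v)).
Hypothesis addmul : forall i, E i = sadd (A i) (simg (lscal c) (T' i)).
Hypothesis TE : forall i, T i = scap (T' i) (spre (lscal c) (A i)).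

Let shE i : shiftg E i = sadd (shiftg A i) (simg (lscal c) (shiftg T' i)).
Proof.
case: i => //=; apply: smod_eq => // _ [_ [_ [-> [_ -> ->] ->]]] /=.
by rewrite scaler0 addr0.
Qed.
Let shT i : shiftg T i = scap (shiftg T' i) (spre (lscal c) (shiftg A i)).
Proof. by case: i => //=; apply: smod_eq => // _ []. Qed.
Let shshT i : shiftg (shiftg T) i = scap (shiftg (shiftg T') i) (spre (lscal c) (shiftg (shiftg A) i)).
Proof. by case: i => [|i] //=; apply: smod_eq => // _ []. Qed.
Let sshA i v : shiftg A i v -> shiftg (shiftg A) i (D v).
Proof. by case: i => [/= ->|i /sA//]; rewrite lmap0. Qed.
Let sshT i v : shiftg T' i v -> shiftg (shiftg T') i (D v).
Proof. by case: i => [/= ->|i /sT'//]; rewrite lmap0. Qed.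

(** By the choice of [T], multiplication by [c] is injective from T'/T to B/A, so its cone has the
    homology of the cokernel B/E; the first projection induces the isomorphism. *)
Lemma hlen_cone_fst i :
  (fin (chbounds (coneD c D) (coneG A T) (coneG B T') i) (chcycles (coneD c D) (coneG A T) (coneG B T') i)
    <-> fin (chbounds D E B i) (chcycles D E B i)) /\
  hlen (coneD c D) (coneG A T) (coneG B T') i = hlen D E B i.
Proof.
have AE j v : A j v -> E j v by rewrite addmul => ?; apply: sadd_l.
have EB j v : E j v -> B j v.
  rewrite addmul => -[a [_ [Aa [t Tt ->] ->]]]; apply: smemD; first exact: AB.
  exact: TB.
have sE : subcx D E.
  move=> j v; rewrite /= shE addmul => -[a [_ [Aa [t Tt ->] ->]]].
  rewrite lmapD; exists (D a), (D (c *: t)); split=> //; first exact: sA.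
  by exists (D t); [apply: sT'|rewrite lmapZ].
apply: (@isom_gen _ _ _ lfst (chcycles (coneD c D) (coneG A T) (coneG B T') i)).
- exact: chbounds_le_chcycles.
- move=> u [Bu Eu]; have : shiftg E i (D u) := Eu; rewrite shE => -[a [_ [Aa [v Tv ->] Du]]].
  (* Since [D u = a + c *: v], the second entry [- v] cancels the term in [c] and makes the pair a
     cycle. *)
  apply: sadd_r; exists (u, - v) => //.
  split; first by split=> //=; apply: smemN.
  apply/shiftg_coneG; split=> /=; first by rewrite Du /= scalerN addrK.
  rewrite shshT lmapN opprK; split; first exact: sshT.
  move: (congr1 D Du); rewrite DD lmapD lmapZ => /esym/eqP.
  by rewrite addrC addr_eq0 /= => /eqP->; apply: smemN; apply: sshA.
- apply: smod_eq => -[u v]; last first.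
    move=> [[[/= Bu Tv] /shiftg_coneG[/= Duv Dv]] /= [_ [e [[u' Bu' ->] + E1]]]].
    rewrite addmul => -[a [_ [Aa [v' Tv' ->] Ee]]].
    exists (D u' + c *: v', - D v'), (a, v + D v'); split.
    + by exists (u', v').
    + split=> //=; rewrite shT; split; first by apply: smemD => //; apply: sT'.
      have E2 : c *: D v' = D u - D a.
        by move: E1; rewrite Ee /= => ->; rewrite !lmapD DD add0r lmapZ [D a + _]addrC addrK.
      rewrite /= scalerDr E2 addrA [c *: v + _]addrC; apply: smemB => //; exact: sA.
    by congr pair => /=; rewrite ?E1 ?Ee ?[- _ + _]addrC ?addrK //= -addrA [a + _]addrC.
  move=> H; split.
    apply: chbounds_le_chcycles H => //; first exact: coneDD.
    + by move=> j [u' v'] [/= ? ]; rewrite shT => -[Tv' _]; split=> //; apply: AB.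
    + apply: coneG_sub => //.
        move=> j t; rewrite TE => -[T't At] /=; rewrite shT; split; first exact: sT'.
        by rewrite /= -lmapZ; apply: sA.
      by move=> j t; rewrite TE => -[].
    exact: coneG_sub.
  case: H => _ [[a t] [[[u' v'] [/= Bu' Tv'] ->] [/= Aa Tt] [-> _]]] /=.
  rewrite -addrA; exists (D u'), (c *: v' + a); split=> //; first by exists u'.
  by rewrite addmul addrC; exists a, (c *: v'); split=> //; exists v'.
apply: smod_eq => -[u v]; last by case.
move=> [[/= Bu Tv] /shiftg_coneG[/= Duv Dv]]; do 2!split=> //; first by apply/shiftg_coneG.
rewrite /= shE -(addrK (c *: v) (D u)); exists (D u + c *: v), (- (c *: v)).
by split=> //; exists (- v); [apply: smemN|rewrite /= scalerN].
Qed.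
End Fst.

Section Snd.
Variables A T U : nat -> smod W.
Hypotheses (sA : subcx D A) (sT : subcx D T) (sU : subcx D U).
Hypotheses (AT : forall i, sle (A i) (T i)) (TU : forall i v, T i v -> U i (c *: v)).

Let sshT i v : shiftg T i v -> shiftg (shiftg T) i (D v).
Proof. by case: i => [/= ->|i /sT//]; rewrite lmap0. Qed.
Let sshA i v : shiftg A i v -> shiftg (shiftg A) i (D v).
Proof. by case: i => [/= ->|i /sA//]; rewrite lmap0. Qed.
Let TU' i v : shiftg T i v -> shiftg U i (c *: v).
Proof. by case: i => [/= ->|i /TU//]; rewrite scaler0. Qed.

Let X i := sadd (simg D (T i)) (shiftg A i).
Let Y i := scap (shiftg T i) (spre D (shiftg (shiftg A) i)).

Let hlen_snd i :
  (fin (chbounds (coneD c D) (coneG U A) (coneG U T) i) (chcycles (coneD c D) (coneG U A) (coneG U T) i)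
    <-> fin (X i) (Y i)) /\
  hlen (coneD c D) (coneG U A) (coneG U T) i = len (X i) (Y i).
Proof.
have AT' j v : shiftg A j v -> shiftg T j v by apply: shiftg_le.
apply: (@isom_gen _ _ _ lsnd (chcycles (coneD c D) (coneG U A) (coneG U T) i)).
- move=> _ [_ [a [[t Tt ->] Aa ->]]]; split; first by apply: smemD; [apply: sT|apply: AT'].
  by rewrite /= lmapD DD add0r; apply: sshA.
- move=> v [Tv Dv]; apply: sadd_r; exists (0, v) => //.
  split=> //; apply/shiftg_coneG; split=> /=; last exact: smemN.
  by rewrite lmap0 add0r; apply: TU'.
- apply: smod_eq => -[u v]; last first.
    move=> [[[/= Uu Tv] /shiftg_coneG[/= Duv Dv]] /= [_ [a [[t Tt ->] Aa E1]]]].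
    exists (c *: - t, D t), (u + c *: t, a); split.
    + exists (0, - t); first by split=> //=; apply: smemN.
      by congr pair => /=; rewrite ?lmap0 ?add0r // lmapN opprK.
    + by split=> //=; apply: smemD => //; apply: TU.
    by congr pair => //=; rewrite scalerN addrCA addNr addr0.
  move=> H; split.
    apply: chbounds_le_chcycles H => //; first exact: coneDD.
    + by move=> j [u' v'] [/= ? ?]; split=> //; apply: AT'.
    + by apply: coneG_sub => // j t /AT /TU.
    exact: coneG_sub.
  case: H => _ [[a t] [[[u' v'] [/= Bu' Tv'] ->] [/= Aa Tt] [_ ->]]] /=.
  by exists (- D v'), t; split=> //; exists (- v'); [apply: smemN|rewrite lmapN].
apply: smod_eq => -[u v]; last by case.
move=> [[/= Bu Tv] /shiftg_coneG[/= Duv Dv]]; do 2!split=> //; first by apply/shiftg_coneG.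
exact: smemNE.
Qed.

(** The first entries range over the same [U] on both sides, so the subquotient is T/A moved up by
    one degree, with its differential changed in sign only. *)
Lemma hlen_cone_snd i :
  (hfin D A T -> fin (chbounds (coneD c D) (coneG U A) (coneG U T) i)
     (chcycles (coneD c D) (coneG U A) (coneG U T) i)) /\
  hlen (coneD c D) (coneG U A) (coneG U T) i = shiftn (hlen D A T) i.
Proof.
have [E1 E2] := hlen_snd i; rewrite E1 E2; case: i {E1 E2} => [|i] /=; last by split=> // /(_ i).
have -> : X 0 = Y 0.
  apply: smod_eq => v; last by case=> -> _; exact: smem0 (X 0).
  by case=> _ [_ [[t Tt ->] -> ->]]; rewrite (sT Tt) addr0; exact: smem0 (Y 0).
by have [? ->] := fin_refl (Y 0).
Qed.
End Snd.
End Cone.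

Lemma lmap_eq (R : comNzRingType) (V W : lmodType R) (f g : lmap V W) : f =1 g -> f = g.
Proof.
case: f => f fP; case: g => g gP /= E.
have {}E : f = g by apply: funext.
by case: _ / E in gP *; congr Lmap; apply: Prop_irrelevance.
Qed.

(** * Koszul complexes *)

Section KoszulTower.
Variable R : comNzRingType.
Implicit Types V : lmodType R.

(* The Koszul complex of x on V as an iterated mapping cone on V * V; KD reads
   missing entries of x as 0. *)
Fixpoint KT V (k : nat) : lmodType R :=
  if k is k'.+1 then (KT V k' * KT V k')%type : lmodType R else V.

Program Definition lzero V : lmap V V := @Lmap _ _ _ (fun _ => 0) _.
Next Obligation. by move=> V a u v; rewrite scaler0 addr0. Qed.

Fixpoint KD V k (x : seq R) : lmap (KT V k) (KT V k) :=
  if k is k'.+1 then coneD (head 0 x) (KD V k' (behead x)) else lzero V.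

Fixpoint KG V k (A : smod V) : nat -> smod (KT V k) :=
  if k is k'.+1 then coneG (KG k' A) (KG k' A)
  else fun i => if i is 0 then A else s0.

Program Definition lprod V V' (f : lmap V V') : lmap (V * V)%type (V' * V')%type :=
  @Lmap _ _ _ (fun w => (f w.1, f w.2)) _.
Next Obligation. by move=> V V' f a u v; congr pair; rewrite /= lmapP. Qed.

Fixpoint Kmap V V' (f : lmap V V') k : lmap (KT V k) (KT V' k) :=
  if k is k'.+1 then lprod (Kmap f k') else f.

Lemma KDD V k x w : KD V k x (KD V k x w) = 0.
Proof. by elim: k x w => [|k IH] x w //=; apply: coneDD. Qed.

Lemma KG_le V k (A B : smod V) i : A <=s B -> KG k A i <=s KG k B i.
Proof.
move=> AB; elim: k i => [|k IH] [|i] //= [u v] [/= Hu Hv]; split=> //=; try exact: IH.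
Qed.

Lemma KG_scal V k (A B : smod V) (c : R) : (forall v, A v -> B (c *: v)) ->
  forall i v, KG k A i v -> KG k B i (c *: v).
Proof.
move=> AB; elim: k => [|k IH] [|i] //=.
- by move=> v ->; rewrite scaler0.
- by move=> [u v] [/= Hu ->]; split=> /=; rewrite ?scaler0 //; apply: IH.
by move=> [u v] [/= Hu Hv]; split=> /=; apply: IH.
Qed.

Lemma KG_sub V k x (A : smod V) : subcx (KD V k x) (KG k A).
Proof.
elim: k x => [|k IH] x /=; first by move=> i v _; apply: (smem0 (shiftg _ i)).
by apply: coneG_sub => [||i v]; [exact: IH|exact: IH|apply: KG_scal => {}v; apply: smemZ].
Qed.

Lemma KG_big V k (A : smod V) i : (k < i)%N -> KG k A i = s0.
Proof.
elim: k i => [|k IH] [|i] //= ki; apply: smod_eq => // -[u v] [/=].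
by rewrite !IH //=; [move=> -> ->|lia].
Qed.

Lemma KD_map V V' (f : lmap V V') k x w : KD V' k x (Kmap f k w) = Kmap f k (KD V k x w).
Proof.
elim: k x w => [|k IH] x w /=; first by rewrite lmap0.
by case: w => u v /=; rewrite !IH lmapD lmapZ lmapN.
Qed.

Lemma Kmap_scal V (c : R) k : Kmap (@lscal R V c) k = lscal c.
Proof. by elim: k => //= k ->; apply: lmap_eq => -[]. Qed.

(** [KG k A i] is a finite direct sum of copies of [A]; hence it commutes with preimages, and in the
    next lemma with sums and images. *)
Lemma KG_cap V V' (f : lmap V V') k (A : smod V') (B : smod V) i :
  KG k (scap B (spre f A)) i = scap (KG k B i) (spre (Kmap f k) (KG k A i)).
Proof.
elim: k i => [|k IH] [|i] //=.
- by apply: smod_eq => v; [move=> ->; split=> //=; rewrite lmap0|case].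
- apply: smod_eq => -[u v]; rewrite /= IH.
    by move=> [[/= ? ?] ->]; do 2!split=> //=; rewrite lmap0.
  by move=> [[/= ? ->] [? _]].
apply: smod_eq => -[u v]; rewrite /= !IH.
  by move=> [[/= ? ?] [/= ? ?]].
by move=> [[/= ? ?] [? ?]].
Qed.

Lemma KG_add V V' (f : lmap V V') k (A : smod V') (B : smod V) i :
  KG k (sadd A (simg f B)) i = sadd (KG k A i) (simg (Kmap f k) (KG k B i)).
Proof.
elim: k i => [|k IH] [|i] //=.
- by apply: smod_eq => // _ [_ [_ [-> [_ -> ->] ->]]] /=; rewrite lmap0 addr0.
- apply: smod_eq => -[u v]; rewrite /coneG /= IH.
    case=> -[/= a [_ [Aa [b Bb ->] ->]]] ->.
    exists (a, 0), (Kmap f k b, 0); split=> //=; last by congr pair; rewrite /= addr0.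
    by exists (b, 0) => //=; rewrite lmap0.
  case=> -[a1 a2] [_ [[/= Aa ->] [[b1 b2] [/= Bb ->] ->] [-> ->]]] /=.
  split=> /=; last by rewrite lmap0 addr0.
  by exists a1, (Kmap f k b1); split=> //; exists b1.
apply: smod_eq => -[u v]; rewrite /coneG /= !IH.
  case=> -[/= a [_ [Aa [b Bb ->] ->]]] -[/= a' [_ [Aa' [b' Bb' ->] ->]]].
  by exists (a, a'), (Kmap f k b, Kmap f k b'); split=> //=; exists (b, b').
case=> -[a1 a2] [_ [[/= Aa Aa'] [[b1 b2] [/= Bb Bb'] ->] [-> ->]]] /=; split.
  by exists a1, (Kmap f k b1); split=> //; exists b1.
by exists a2, (Kmap f k b2); split=> //; exists b2.
Qed.

Definition khlen V k x (A B : smod V) i := hlen (KD V k x) (KG k A) (KG k B) i.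
Definition khfin V k x (A B : smod V) := hfin (KD V k x) (KG k A) (KG k B).

Lemma khlen_les V k x (A B C : smod V) : A <=s B -> B <=s C -> khfin k x A B -> khfin k x B C ->
  khfin k x A C /\ exists dl : nat -> nat, forall i,
   (khlen k x A C i + dl i + shiftn dl i = khlen k x A B i + khlen k x B C i)%N.
Proof.
move=> AB BC fAB fBC.
have [||f [dl E]] := @les_num _ _ (KD V k x) (@KDD V k x) _ _ _ _ _
   (@KG_sub V k x A) (@KG_sub V k x B) (@KG_sub V k x C) fAB fBC.
- by move=> i; apply: KG_le.
- by move=> i; apply: KG_le.
by split=> //; exists dl => i; case: (E i).
Qed.

(** The two equations say that [f] induces an isomorphism from B/A onto B'/A', and Koszul homology
    depends on the subquotient only. *)
Lemma khlen_isom V V' (f : lmap V V') k x (A B : smod V) (A' B' : smod V') :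
  A = scap B (spre f A') -> B' = sadd A' (simg f B) ->
  (khfin k x A B <-> khfin k x A' B') /\ (forall i, khlen k x A B i = khlen k x A' B' i).
Proof.
move=> EA EB.
have AB : A <=s B by rewrite EA.
have A'B' : A' <=s B' by rewrite EB.
have GA i : KG k A i = scap (KG k B i) (spre (Kmap f k) (KG k A' i)).
  by rewrite EA KG_cap.
have GB i : KG k B' i = sadd (KG k A' i) (simg (Kmap f k) (KG k B i)).
  by rewrite EB KG_add.
have sGA i : shiftg (KG k A) i = scap (shiftg (KG k B) i) (spre (Kmap f k) (shiftg (KG k A') i)).
  by case: i => //=; apply: smod_eq.
have BZ (U : lmodType R) (P Q : smod U) i : P <=s Q ->
    chbounds (KD U k x) (KG k P) (KG k Q) i <=s chcycles (KD U k x) (KG k P) (KG k Q) i.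
  move=> PQ; apply: chbounds_le_chcycles; [exact: KDD| |exact: KG_sub|exact: KG_sub].
  by move=> j; apply: KG_le.
have I i := @isom_gen _ _ _ (Kmap f k) (chcycles (KD V k x) (KG k A) (KG k B) i)
  (chbounds (KD V k x) (KG k A) (KG k B) i) (chcycles (KD V k x) (KG k A) (KG k B) i)
  (chbounds (KD V' k x) (KG k A') (KG k B') i) (chcycles (KD V' k x) (KG k A') (KG k B') i)
  (BZ _ _ _ i A'B').
have {}I i : (fin (chbounds (KD V k x) (KG k A) (KG k B) i) (chcycles (KD V k x) (KG k A) (KG k B) i)
   <-> fin (chbounds (KD V' k x) (KG k A') (KG k B') i) (chcycles (KD V' k x) (KG k A') (KG k B') i))
  /\ khlen k x A B i = khlen k x A' B' i.
  apply: I.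
  - move=> w [Gw Dw]; have := Gw; rewrite GB => -[a [_ [Aa [v Bv ->] E]]].
    rewrite E; apply: smemD; first by apply/sadd_l/sadd_r.
    apply: sadd_r; exists v => //; split=> //.
    have : shiftg (KG k A) i (KD V k x v) => //.
    rewrite sGA; split; first by apply: (@KG_sub V k x B).
    rewrite /= -KD_map; have -> : Kmap f k v = w - a by rewrite E addrC addKr.
    by rewrite lmapB; apply: smemB => //; apply: (@KG_sub V' k x A').
  - apply: smod_eq => w.
      move=> /[dup] Hw [_ [a [[v Bv ->] Aa ->]]]; split.
        by apply: BZ => //; exists (KD V k x v), a; split=> //; exists v.
      rewrite /= lmapD -KD_map; exists (KD V' k x (Kmap f k v)), (Kmap f k a).
      split=> //; last by move: Aa; rewrite GA; case.
      by exists (Kmap f k v) => //; rewrite GB; apply: sadd_r; exists v.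
    case=> -[Bw Dw] [_ [a [[v + ->] Aa E]]].
    rewrite GB => -[a' [_ [Aa' [v' Bv' ->] Ev]]].
    exists (KD V k x v'), (w - KD V k x v'); split; [by exists v'| |by rewrite addrC subrK].
    rewrite GA; split.
      by apply: smemB => //; apply: (@KG_sub V k x B i.+1).
    rewrite /= lmapB; move: E => /= ->; rewrite Ev lmapD -KD_map addrAC addrK.
    by apply: smemD => //; apply: (@KG_sub V' k x A' i.+1).
  apply: smod_eq => w; last by case.
  move=> [Bw Dw]; split=> //; split=> /=.
    by rewrite GB; apply: sadd_r; exists w.
  by rewrite KD_map; have : shiftg (KG k A) i (KD V k x w) := Dw; rewrite sGA; case.
split; last by move=> i; case: (I i).
by split=> H i; apply/(I i).1.
Qed.

(* The two-row sequence relating K(c :: x; M) to K(x; 0 :_M c) and K(x; M / c M). *)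
Lemma khlen_master V k c x (A B : smod V) : A <=s B ->
  let T := scap B (spre (lscal c) A) in let E := sadd A (simg (lscal c) B) in
  khfin k x A T -> khfin k x E B ->
  khfin k.+1 (c :: x) A B /\ exists dl : nat -> nat, forall i,
   (khlen k.+1 (c :: x) A B i + dl i + shiftn dl i = shiftn (khlen k x A T) i + khlen k x E B i)%N
   /\ (dl i <= shiftn (khlen k x A T) i)%N.
Proof.
move=> AB T E fT fE.
have AT : A <=s T by move=> v Av; split; [apply: AB|apply: smemZ].
have TB : T <=s B by move=> v [].
(* [P] keeps the first entry in [A] and lets the second range over [T]. Modulo the complex of [A] it
   is the shifted complex of T/A; the complex of [B] modulo [P] has the homology of B/E, because [c]
   is injective on B/T. *)
pose P := coneG (KG k A) (KG k T).
have KB i v : KG k B i v -> KG k B i (c *: v) by apply: KG_scal => {}v; apply: smemZ.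
have KTA i v : KG k T i v -> KG k A i (c *: v) by apply: KG_scal => {}v [].
have E1 i : KG k E i = sadd (KG k A i) (simg (lscal c) (KG k B i)).
  by rewrite KG_add Kmap_scal.
have E2 i : KG k T i = scap (KG k B i) (spre (lscal c) (KG k A i)).
  by rewrite KG_cap Kmap_scal.
have S1 i := @hlen_cone_snd _ _ c _ (@KDD V k x) (KG k A) (KG k T) (KG k A)
  (@KG_sub V k x A) (@KG_sub V k x T) (@KG_sub V k x A) (fun i => @KG_le _ k _ _ i AT) KTA i.
have S2 i := @hlen_cone_fst _ _ c _ (@KDD V k x) (KG k A) (KG k T) (KG k B) (KG k B) (KG k E)
  (@KG_sub V k x A) (@KG_sub V k x B) (@KG_sub V k x B) (fun i => @KG_le _ k _ _ i AB)
  KB E1 E2 i.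
have [|||||f [dl H]] := @les_num _ _ (KD V k.+1 (c :: x)) (@KDD V k.+1 (c :: x))
  (KG k.+1 A) P (KG k.+1 B) _ _ (@KG_sub V k.+1 (c :: x) A) _ (@KG_sub V k.+1 (c :: x) B).
- move=> i [u v] [/= Au Av]; split=> //=.
  by case: i Av {Au} => [|i] //=; apply: KG_le.
- move=> i [u v] [/= Au Av]; split=> /=; first exact: KG_le Au.
  by case: i Av {Au} => [|i] //=; apply: KG_le.
- by apply: coneG_sub => //; apply: KG_sub.
- by move=> i; case: (S1 i) => + _; apply.
- by move=> i; apply/(S2 i).1.
have e1 i : hlen (KD V k.+1 (c :: x)) (KG k.+1 A) P i = shiftn (khlen k x A T) i := (S1 i).2.
have e2 i : hlen (KD V k.+1 (c :: x)) P (KG k.+1 B) i = khlen k x E B i := (S2 i).2.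
by split=> //; exists dl => i; have := H i; rewrite e1 e2.
Qed.

(** This is the usual sequence of a cone, with K(x; B/A) as subcomplex and its shift as quotient. In
    contrast to [khlen_master], the complex K(x; B/A) itself must have finite homology. *)
Lemma khlen_cone V k c x (A B : smod V) : A <=s B -> khfin k x A B ->
  khfin k.+1 (c :: x) A B /\
  forall i, (khlen k.+1 (c :: x) A B i <= khlen k x A B i + shiftn (khlen k x A B) i)%N.
Proof.
move=> AB fAB; pose P := coneG (KG k B) (KG k A).
have KS (C : smod V) i v : KG k C i v -> KG k C i (c *: v).
  by apply: KG_scal => {}v; apply: smemZ.
have S1 i := @hlen_cone_snd _ _ c _ (@KDD V k x) (KG k A) (KG k B) (KG k B)
  (@KG_sub V k x A) (@KG_sub V k x B) (@KG_sub V k x B) (fun i => @KG_le _ k _ _ i AB) (KS B) i.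
have E1 i : KG k A i = sadd (KG k A i) (simg (lscal c) (KG k A i)).
  by apply: smod_eq => //; apply: sadd_le => // _ [v Av ->]; apply: KS.
have E2 i : KG k A i = scap (KG k A i) (spre (lscal c) (KG k A i)).
  by apply: smod_eq => // v Av; split=> //; apply: KS.
have KAB i v : KG k A i v -> KG k B i (c *: v).
  by apply: KG_scal => {}v Av; apply: smemZ; apply: AB.
have S2 i := @hlen_cone_fst _ _ c _ (@KDD V k x) (KG k A) (KG k A) (KG k B) (KG k A) (KG k A)
  (@KG_sub V k x A) (@KG_sub V k x B) (@KG_sub V k x A) (fun i => @KG_le _ k _ _ i AB) KAB E1 E2 i.
have [|||||f [dl H]] := @les_num _ _ (KD V k.+1 (c :: x)) (@KDD V k.+1 (c :: x))
  (KG k.+1 A) P (KG k.+1 B) _ _ (@KG_sub V k.+1 (c :: x) A) _ (@KG_sub V k.+1 (c :: x) B).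
- by move=> i [u v] [/= Au Av]; split=> //=; apply: KG_le Au.
- move=> i [u v] [/= Au Av]; split=> //=.
  by case: i Av {Au} => [|i] //=; apply: KG_le.
- by apply: coneG_sub => //; apply: KG_sub.
- by move=> i; apply/(S2 i).1.
- by move=> i; case: (S1 i) => + _; apply.
have e1 i : hlen (KD V k.+1 (c :: x)) (KG k.+1 A) P i = khlen k x A B i := (S2 i).2.
have e2 i : hlen (KD V k.+1 (c :: x)) P (KG k.+1 B) i = shiftn (khlen k x A B) i := (S1 i).2.
split=> // i; have [] := H i; rewrite e1 e2 -/(khlen k.+1 (c :: x) A B i); lia.
Qed.

Lemma hk0 V x (A B : smod V) : A <=s B ->
  (khfin 0 x A B <-> fin A B) /\ (forall i, khlen 0 x A B i = if i == 0%N then len A B else 0%N).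
Proof.
move=> AB.
have E1 i : chbounds (KD V 0 x) (KG 0 A) (KG 0 B) i = if i == 0%N then A else s0.
  case: i => [|i] /=; apply: smod_eq => //.
  - by move=> _ [_ [v [[u Bu ->] Av ->]]]; rewrite /= add0r.
  - by move=> v Av; apply: sadd_r.
  by move=> _ [_ [v [[u Bu ->] -> ->]]]; rewrite /= add0r.
have E2 i : chcycles (KD V 0 x) (KG 0 A) (KG 0 B) i = if i == 0%N then B else s0.
  by case: i => [|i] /=; apply: smod_eq => // v; case.
have F := fin_refl (@s0 R V).
split; last by move=> i; rewrite /khlen /hlen E1 E2; case: eqP => // _; case: F.
split=> [/(_ 0%N)|f]; first by rewrite E1 E2.
by move=> i; rewrite E1 E2; case: eqP => // _; case: F.
Qed.

Lemma khlen_big V k x (A B : smod V) i : (k < i)%N -> khlen k x A B i = 0%N.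
Proof.
move=> ki; rewrite /khlen /hlen.
have -> : chcycles (KD V k x) (KG k A) (KG k B) i = s0.
  by apply: smod_eq => // v []; rewrite KG_big.
have -> : chbounds (KD V k x) (KG k A) (KG k B) i = s0.
  apply: smod_eq => // _ [_ [v [[u + ->] + ->]]].
  rewrite !KG_big //; last by lia.
  by move=> -> ->; rewrite lmap0 add0r.
exact: (fin_refl _).2.
Qed.
End KoszulTower.

(** * Permutations of the sequence and null-homotopies *)

Section Perm.
Variables (R : comNzRingType) (V : lmodType R).
Implicit Types A B : smod V.

(** The map has to respect [KG k A] for every [A] at once, so that a single map descends to all
    subquotients B/A. *)
Definition kmor k (x y : seq R) (f : lmap (KT V k) (KT V k)) : Prop :=
  (forall w, f (KD V k x w) = KD V k y (f w)) /\
  (forall A i w, KG k A i w -> KG k A i (f w)).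

Definition kiso k (x y : seq R) : Prop := exists f g : lmap (KT V k) (KT V k),
  [/\ cancel f g, cancel g f, kmor x y f & kmor y x g].

Lemma kiso_khlen k x y A B : A <=s B -> kiso k x y ->
  (khfin k x A B <-> khfin k y A B) /\ forall i, khlen k x A B i = khlen k y A B i.
Proof.
move=> AB [f [g [fK gK [fD fG] [gD gG]]]].
have shG h : (forall A i w, KG k A i w -> KG k A i (h w)) ->
   forall A i (w : KT V k), shiftg (KG k A) i w -> h 0 = 0 -> shiftg (KG k A) i (h w).
  by move=> hG C [|i] w /=; [move=> -> ->|move=> /hG].
have I i : (fin (chbounds (KD V k x) (KG k A) (KG k B) i) (chcycles (KD V k x) (KG k A) (KG k B) i)
  <-> fin (chbounds (KD V k y) (KG k A) (KG k B) i) (chcycles (KD V k y) (KG k A) (KG k B) i)) /\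
  khlen k x A B i = khlen k y A B i.
  apply: (@isom_gen _ _ _ f (chcycles (KD V k x) (KG k A) (KG k B) i)).
  - apply: chbounds_le_chcycles; [exact: KDD| |exact: KG_sub|exact: KG_sub].
    by move=> j; apply: KG_le.
  - move=> w [Bw Dw]; apply: sadd_r; exists (g w) => //; split; first exact: gG.
    by rewrite /= -gD; apply: shG Dw _ => //; apply: lmap0.
  - apply: smod_eq => w.
      move=> [_ [a [[b Bb ->] Aa ->]]]; split.
        apply: chbounds_le_chcycles; [exact: KDD|by move=> j; apply: KG_le|exact: KG_sub|exact: KG_sub|].
        by exists (KD V k x b), a; split=> //; exists b.
      exists (KD V k y (f b)), (f a); split; first by exists (f b) => //; apply: fG.
        exact: fG.
      by rewrite /= lmapD fD.
    case=> _ [_ [a [[b Bb ->] Aa E]]]; exists (KD V k x (g b)), (g a).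
    split; first by exists (g b) => //; apply: gG.
      exact: gG.
    by rewrite -[w]fK [X in g X]E lmapD gD.
  apply: smod_eq => w; last by case.
  move=> [Bw Dw]; split=> //; split; first exact: fG.
  by rewrite /= -fD; apply: shG Dw _ => //; apply: lmap0.
by split; [split=> H i; apply/(I i).1|move=> i; case: (I i)].
Qed.

Lemma kiso_refl k x : kiso k x x.
Proof. by exists lid, lid; split. Qed.

Program Definition lcomp (U U' U'' : lmodType R) (f : lmap U U') (g : lmap U' U'') : lmap U U'' :=
  @Lmap _ _ _ (g \o f) _.
Next Obligation. by move=> U U' U'' f g a u v /=; rewrite !lmapP. Qed.

Lemma kiso_trans k y x z : kiso k x y -> kiso k y z -> kiso k x z.
Proof.
move=> [f [g [fK gK [fD fG] [gD gG]]]] [f' [g' [fK' gK' [fD' fG'] [gD' gG']]]].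
exists (lcomp f f'), (lcomp g' g); split.
- by move=> w; rewrite /= fK' fK.
- by move=> w; rewrite /= gK gK'.
- by split=> [w|A i w Aw] /=; [rewrite fD fD'|apply/fG'/fG].
by split=> [w|A i w Aw] /=; [rewrite gD' gD|apply/gG/gG'].
Qed.

Lemma kiso_cons k a x y : kiso k x y -> kiso k.+1 (a :: x) (a :: y).
Proof.
have H u v (f : lmap (KT V k) (KT V k)) : kmor u v f -> @kmor k.+1 (a :: u) (a :: v) (lprod f).
  move=> [fD fG]; split; first by move=> [w1 w2] /=; rewrite lmapD lmapZ fD lmapN fD.
  move=> A i [w1 w2] [/= A1 A2]; split=> /=; first exact: fG.
  by case: i A2 {A1} => [|i] /=; [move=> ->; rewrite lmap0|apply: fG].
move=> [f [g [fK gK Hf Hg]]]; exists (lprod f), (lprod g); split; try exact: H.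
  by move=> [u v] /=; rewrite !fK.
by move=> [u v] /=; rewrite !gK.
Qed.

(** Exchange of two exterior generators; the entry containing both changes sign, as e_a ∧ e_b = -
    e_b ∧ e_a. *)
Program Definition lswap (U : lmodType R) : lmap ((U * U) * (U * U))%type ((U * U) * (U * U))%type :=
  @Lmap _ _ _ (fun w => ((w.1.1, w.2.1), (w.1.2, - w.2.2))) _.
Next Obligation.
by move=> U a u v; congr pair; congr pair; rewrite /= opprD scalerN.
Qed.

Lemma kiso_swap k a b x : kiso k.+2 (a :: b :: x) (b :: a :: x).
Proof.
have K : cancel (lswap (KT V k)) (lswap (KT V k)).
  by move=> [[u v] [w z]]; congr pair; congr pair; rewrite /= ?opprK.
have M c d : @kmor k.+2 (c :: d :: x) (d :: c :: x) (lswap (KT V k)).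
  split.
    move=> [[u v] [w z]] /=; congr pair; congr pair => /=; rewrite ?opprK ?lmapN ?opprK //.
    - by rewrite addrAC.
    - by rewrite scalerN opprD.
    by rewrite scalerN opprD opprK.
  move=> A [|[|i]] [[u v] [w z]] [/= [Au Av] [Aw Az]] /=.
  - by rewrite Av Az oppr0.
  - by move: Aw Az => Aw ->; rewrite oppr0.
  by do !split=> //=; apply: smemN.
by exists (lswap (KT V k)), (lswap (KT V k)); split.
Qed.

Lemma kiso_move a x y : kiso (size (a :: x ++ y)) (a :: x ++ y) (x ++ a :: y).
Proof.
elim: x => [|b x IH]; first exact: kiso_refl.
by apply: kiso_trans (kiso_swap _ _ _ _) (kiso_cons _ IH).
Qed.

Lemma kiso_perm x y : perm_eq x y -> kiso (size x) x y.
Proof.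
elim: x y => [|a x IH] y; first by rewrite perm_sym => /perm_nilP ->; apply: kiso_refl.
move=> /[dup] /perm_mem /(_ a); rewrite mem_head => /esym /splitPr[y1 y2].
rewrite -[y1 ++ _]/(y1 ++ [:: a] ++ y2) perm_sym perm_catCA perm_cons perm_sym => xy.
apply: kiso_trans (kiso_cons a (IH _ xy)) _.
by rewrite /= (perm_size xy); apply: kiso_move.
Qed.

Definition klen x A B i := khlen (size x) x A B i.
Definition kfin x A B := khfin (size x) x A B.

Lemma klen_perm x y A B : A <=s B -> perm_eq x y ->
  (kfin x A B <-> kfin y A B) /\ forall i, klen x A B i = klen y A B i.
Proof.
move=> AB xy; rewrite /kfin /klen -(perm_size xy).
exact: kiso_khlen AB (kiso_perm xy).
Qed.

(* Multiplication by b is null-homotopic on K(x; V), uniformly on subquotients. *)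
Definition hnull k x (b : R) : Prop := exists s : lmap (KT V k) (KT V k),
  (forall A i w, KG k A i w -> KG k A i.+1 (s w)) /\
  forall w, KD V k x (s w) + s (KD V k x w) = b *: w.

Program Definition ladd (U U' : lmodType R) (a : R) (f g : lmap U U') : lmap U U' :=
  @Lmap _ _ _ (fun w => a *: f w + g w) _.
Next Obligation.
move=> U U' a f g b u v /=; rewrite !lmapP !scalerDr !scalerA [a * b]mulrC.
by rewrite addrACA.
Qed.

Program Definition lsgn (U : lmodType R) (s : lmap U U) : lmap (U * U)%type (U * U)%type :=
  @Lmap _ _ _ (fun w => (s w.1, - s w.2)) _.
Next Obligation.
by move=> U s c u v; congr pair; rewrite /= lmapP // opprD scalerN.
Qed.

Program Definition linr (U : lmodType R) : lmap (U * U)%type (U * U)%type :=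
  @Lmap _ _ _ (fun w => (0, w.1)) _.
Next Obligation. by move=> U c u v; congr pair; rewrite /= scaler0 addr0. Qed.

(** With [hnull0] and [hnull_mem] this shows that the elements acting null-homotopically form an
    ideal containing [x]. *)
Lemma hnull_lin k x a b c : hnull k x b -> hnull k x c -> hnull k x (a * b + c).
Proof.
move=> [s [sG sD]] [t [tG tD]]; exists (ladd a s t); split.
  by move=> A i w Aw; apply: smemP; [apply: sG|apply: tG].
by move=> w; rewrite /= lmapP addrACA -scalerDr sD tD scalerDl scalerA.
Qed.

Lemma hnull0 k x : hnull k x 0.
Proof.
exists (ladd (-1) lid lid); split.
  by move=> A i w _; rewrite /= scaleN1r addNr; apply: smem0.
by move=> w; rewrite /= !scaleN1r !addNr lmap0 addr0 scale0r.
Qed.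

Lemma hnull_cons k x a b : hnull k x b -> hnull k.+1 (a :: x) b.
Proof.
move=> [s [sG sD]].
exists (lsgn s : lmap (KT V k.+1) (KT V k.+1)); split.
  move=> A i [u v] [/= Au Av]; split=> /=; first exact: sG.
  apply: smemN; case: i Av {Au} => [/= ->|i /= /sG //]; rewrite lmap0; exact: smem0.
move=> [u v]; congr pair => /=.
  by rewrite lmapD lmapZ scalerN addrACA sD addNr addr0.
by rewrite !lmapN !opprK sD.
Qed.

(** The homotopy is the exterior product with the generator belonging to [a]. *)
Lemma hnull_head k x a : hnull k.+1 (a :: x) a.
Proof.
exists (linr (KT V k) : lmap (KT V k.+1) (KT V k.+1)); split.
  by move=> A i [u v] [/= Au Av]; split.
by move=> [u v]; congr pair => /=; rewrite ?lmap0 ?add0r ?addr0 // addrA addNr add0r.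
Qed.

Lemma hnull_mem x b : b \in x -> hnull (size x) x b.
Proof.
elim: x => //= a x IH; rewrite inE => /predU1P[->|/IH]; first exact: hnull_head.
exact: hnull_cons.
Qed.

Lemma hnull_kill k x b A B i v : hnull k x b ->
  chcycles (KD V k x) (KG k A) (KG k B) i v -> chbounds (KD V k x) (KG k A) (KG k B) i (b *: v).
Proof.
move=> [s [sG sD]] [Bv Dv]; rewrite -sD; exists (KD V k x (s v)), (s (KD V k x v)).
split=> //; first by exists (s v) => //; apply: sG.
by case: i Bv Dv => [|i] /= _; [move=> ->; rewrite lmap0; apply: smem0|apply: sG].
Qed.
End Perm.

(** Multiplication by [a ^+ s] embeds the elements of Y/X killed by [a ^+ s.+1], modulo those killed
    by [a ^+ s], into those killed by [a]; so each of the [t] steps costs at most one such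
    length. *)
Lemma kill_pow (R : comNzRingType) (V : lmodType R) (a : R) (X Y : smod V) t :
  X <=s Y -> fin X Y -> (forall v, Y v -> Y (a *: v)) ->
  (len X (scap Y (spre (lscal (a ^+ t)) X)) <= t * len X (scap Y (spre (lscal a) X)))%N.
Proof.
move=> XY fXY aY; pose K t := scap Y (spre (lscal (a ^+ t)) X).
have KY s : K s <=s Y by move=> v [].
have XK s : X <=s K s by move=> v Xv; split; [apply: XY|apply: smemZ].
have KK s : K s <=s K s.+1.
  by move=> v [Yv Xv]; split=> //; rewrite /= exprS -scalerA; apply: smemZ.
have pY s v : Y v -> Y (a ^+ s *: v).
  by move=> Yv; elim: s => [|s IH]; rewrite ?expr0 ?scale1r // exprS -scalerA; apply: aY.
rewrite -/(K t) -[scap Y (spre (lscal a) X)]/(K 1%N).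
have f1 : fin X (K 1%N) by have /(_ fXY)[] := (len_add (XK 1%N) (KY 1%N)).1.1.
elim: t => [|t IH].
  rewrite (_ : K 0%N = X) ?(fin_refl _).2 // ; apply: smod_eq => // v [_].
  by rewrite /= expr0 scale1r.
have ft : fin X (K t.+1) by have /(_ fXY)[] := (len_add (XK t.+1) (KY t.+1)).1.1.
rewrite (len_add (XK t) (KK t)).2 // mulSn addnC; apply: leq_add => //.
pose S := sadd X (simg (lscal (a ^+ t)) (K t.+1)).
have SK : S <=s K 1%N.
  apply: sadd_le => // _ [v [Yv Xv] ->]; split; first exact: pY.
  by move: Xv; rewrite /= expr1 scalerA -exprS.
have [] := @isom_gen _ _ _ (lscal (a ^+ t)) (K t.+1) (K t) (K t.+1) X S => //.
- exact: sadd_l.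
- apply: smod_eq => v; last by move=> [[Yv _] Xv].
  by move=> Kv; split; [apply: KK|case: Kv].
- apply: smod_eq => v; last by case.
  by move=> Kv; split=> //; apply: sadd_r; exists v.
move=> _ ->; rewrite (len_add (@sadd_l _ _ X _) SK).2 // leq_addr //.
Qed.

(** The second projection maps H_{i+1} of the cone onto the kernel of [a] on H_i(x), which is
    therefore no longer than H_{i+1}. As [a ^+ t] kills all of H_i(x), [kill_pow] supplies the
    factor [t]. *)
Lemma khlen_low (R : comNzRingType) (V : lmodType R) (A B : smod V) k x a t i : A <=s B ->
  khfin k x A B -> hnull V k x (a ^+ t) ->
  (khlen k x A B i <= t * khlen k.+1 (a :: x) A B i.+1)%N.
Proof.
move=> AB fAB hn; set X := chbounds (KD V k x) (KG k A) (KG k B) i.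
set Y := chcycles (KD V k x) (KG k A) (KG k B) i.
have XY : X <=s Y.
  apply: chbounds_le_chcycles; [exact: KDD|by move=> j; apply: KG_le|exact: KG_sub|exact: KG_sub].
have aY v : Y v -> Y (a *: v) by apply: smemZ.
have := kill_pow t XY (fAB i) aY; set K := scap Y (spre (lscal a) X).
have -> : scap Y (spre (lscal (a ^+ t)) X) = Y.
  by apply: smod_eq => // v Yv; split=> //; apply: hnull_kill hn _.
rewrite -/(khlen k x A B i) => /leq_trans; apply; rewrite leq_mul2l; apply/orP; right.
have XK : X <=s K by move=> v Xv; split; [apply: XY|apply: smemZ].
have [F _] := khlen_cone a AB fAB; have {}F := F i.+1.
set BB := chbounds (KD V k.+1 (a :: x)) (KG k.+1 A) (KG k.+1 B) i.+1 in F *.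
set ZZ := chcycles (KD V k.+1 (a :: x)) (KG k.+1 A) (KG k.+1 B) i.+1 in F *.
rewrite /khlen /hlen -/BB -/ZZ.
have BZ : BB <=s ZZ.
  apply: chbounds_le_chcycles; [exact: KDD|by move=> j; apply: KG_le|exact: KG_sub|exact: KG_sub].
pose S1 := scap ZZ (spre (lsnd _) X); pose S2 := scap ZZ (spre (lsnd _) K).
have B1 : BB <=s S1.
  move=> w /[dup] /BZ Zw Bw; split=> //.
  case: Bw => _ [[n1 n2] [[[u v] [/= Bu Bv] ->] [/= An1 An2] E]].
  rewrite E /=; exists (- KD V k x v), n2; split=> //.
  by exists (- v); [apply: smemN|rewrite lmapN].
have S12 : S1 <=s S2 by move=> w [Zw Xw]; split=> //; apply: XK.
have S2Z : S2 <=s ZZ by move=> w [].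
have [_ <-] : (fin S1 S2 <-> fin X K) /\ len S1 S2 = len X K.
  apply: (@isom_gen _ _ _ (lsnd _) ZZ) => // v [[Bv Dv]].
  (* If [a *: v] is the boundary [D u] up to [n], then the pair (-u, v) is a cycle of the cone
     lifting [v]. *)
  case=> _ [n [[u Bu ->] An E]]; apply: sadd_r; exists (- u, v) => //.
  split=> /=; first by split=> //=; apply: smemN.
  split=> /=; last exact: smemN.
  by rewrite lmapN; move: E => /= ->; rewrite addKr.
have [F3 _] : fin BB S2 /\ fin S2 ZZ by apply/(len_add (sle_trans B1 S12) S2Z).1.
rewrite (len_add (sle_trans B1 S12) S2Z).2 // (len_add B1 S12).2 //; lia.
Qed.

(** * Prime filtrations *)

Section Noeth.
Variables (R : comNzRingType).

Definition noeth (V : lmodType R) (A B : smod V) : Prop := forall f : nat -> smod V,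
  (forall n, [/\ A <=s f n, f n <=s B & f n <=s f n.+1]) ->
  exists n, forall k, (n <= k)%N -> f k <=s f n.

(** Noetherian induction from the top downwards: a failure at [A] would, by choice, continue to a
    strictly ascending chain of failures. *)
Lemma noeth_ind (V : lmodType R) (A B : smod V) (Q : smod V -> Prop) : noeth A B -> A <=s B ->
  (forall X, A <=s X -> X <=s B ->
     (forall Y, X <=s Y -> ~ Y <=s X -> Y <=s B -> Q Y) -> Q X) -> Q A.
Proof.
move=> nAB AB H; apply: contrapT => nQ.
pose S := {X : smod V | [/\ A <=s X, X <=s B & ~ Q X]}.
have /choice[g gP] (x : S) : exists y : S, sval x <=s sval y /\ ~ sval y <=s sval x.
  case: x => X [AX XB nQX] /=; apply: contrapT => nex; apply: nQX; apply: H => // Y XY nYX YB.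
  apply: contrapT => nQY; apply: nex.
  have SY : [/\ A <=s Y, Y <=s B & ~ Q Y] by split=> //; exact: sle_trans AX XY.
  by exists (exist _ Y SY).
have SA : [/\ A <=s A, A <=s B & ~ Q A] by split.
pose f n := sval (iter n g (exist _ A SA)).
have [|n Hn] := nAB f.
  move=> n; rewrite /f iterS; have [gle _] := gP (iter n g (exist _ A SA)).
  by split=> //; case: (iter n g _) => X [].
have := Hn n.+1 (leqnSn _); rewrite /f iterS.
by case: (gP (iter n g (exist _ A SA))).
Qed.

Lemma noeth_mono (V : lmodType R) (A B : smod V) f : 
  (forall n, [/\ A <=s f n, f n <=s B & f n <=s f n.+1]) ->
  forall n k, (n <= k)%N -> f n <=s f k.
Proof.
move=> H n k /subnK <-; elim: (k - n)%N => [|j IH] //.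
by rewrite addSn; apply: sle_trans IH _; case: (H (j + n)%N).
Qed.

Lemma noeth_sub (V : lmodType R) (A B A' B' : smod V) :
  A <=s A' -> B' <=s B -> noeth A B -> noeth A' B'.
Proof.
move=> AA BB n f H; apply: n => k; case: (H k) => H1 H2 H3; split=> //.
  exact: sle_trans AA H1.
exact: sle_trans H2 BB.
Qed.

Lemma noeth_isom (V W : lmodType R) (f : lmap V W) (G : smod V) (X Y : smod W) :
  Y <=s sadd X (simg f G) ->
  noeth (scap G (spre f X)) (scap G (spre f Y)) -> noeth X Y.
Proof.
move=> HY nVW g H.
have [|n Hn] := nVW (fun k => scap G (spre f (g k))).
  move=> k; have [H1 H2 H3] := H k.
  by split=> v [Gv Xv]; split=> //; [apply: H1|apply: H2|apply: H3].
exists n => k nk w gw.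
have [Xn Yk _] := H k.
have [x [_ [Xx [v Gv ->] E]]] := HY _ (Yk _ gw).
have [Xn' _ _] := H n.
rewrite E; apply: smemD; first exact: Xn'.
have [] // : scap G (spre f (g n)) v.
apply: Hn nk _ _; split=> //=; have -> : f v = w - x by rewrite E addrC addKr.
by apply: smemB => //; apply: Xn.
Qed.

(** Among comparable submodules, one is determined by its intersection with [B] and its sum with
    [B], and both of these stabilize along the chain. *)
Lemma noeth_cat (V : lmodType R) (A B C : smod V) : A <=s B -> B <=s C ->
  noeth A B -> noeth B C -> noeth A C.
Proof.
move=> AB BC nAB nBC f H.
have [|n1 H1] := nAB (fun n => scap (f n) B).
  move=> n; have [a1 a2 a3] := H n; split=> v.
  - by move=> Av; split; [apply: a1|apply: AB].
  - by case.
  by case=> fv Bv; split=> //; apply: a3.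
have [|n2 H2] := nBC (fun n => sadd (f n) B).
  move=> n; have [a1 a2 a3] := H n; split=> //.
  - exact: sadd_le.
  by apply: sadd_le => // v fv; apply/sadd_l/a3.
exists (maxn n1 n2) => k nk v fv.
have M := noeth_mono H.
have [w [b [fw Bb E]]] : sadd (f n2) B v.
  by apply: (H2 k); [lia|apply: sadd_l].
have fw' : f (maxn n1 n2) w by apply: M fw; lia.
rewrite E; apply: smemD => //.
have [] // : scap (f n1) B b; last by move=> fb _; apply: M fb; lia.
apply: (H1 k); [lia|split=> //].
have -> : b = v - w by rewrite E addrC addKr.
by apply: smemB => //; apply: M fw'; lia.
Qed.

Lemma noeth_refl (V : lmodType R) (A : smod V) : noeth A A.
Proof. by move=> f H; exists 0%N => k _; have [_ ? _] := H k; have [? _ _] := H 0%N; apply: sle_trans; eauto. Qed.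

Program Definition lact (V : lmodType R) (u : V) : lmap R^o V := @Lmap _ _ _ (fun a : R => a *: u) _.
Next Obligation. by move=> V u a b c; rewrite /= scalerDl scalerA. Qed.

Definition cyc (V : lmodType R) (u : V) : smod V := simg (lact u) sT.
(** Annihilator of the class of [u] in V/A. *)
Definition colon (V : lmodType R) (A : smod V) (u : V) : smod R^o := spre (lact u) A.
Definition sprime (q : smod R^o) : Prop :=
  ~ q (1 : R) /\ forall a b : R, q (a * b) -> q a \/ q b.

Lemma cycP (V : lmodType R) (u : V) : cyc u u.
Proof. by exists 1 => //=; rewrite scale1r. Qed.

Lemma cyc_le (V : lmodType R) (A : smod V) u : A u -> cyc u <=s A.
Proof. by move=> Au _ [a _ ->]; apply: smemZ. Qed.

(** Annihilator of the subquotient B/A. *)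
Program Definition ann2 (V : lmodType R) (A B : smod V) : smod R^o :=
  @Smod _ _ (fun a : R => forall v, B v -> A (a *: v)) _ _.
Next Obligation. by move=> V A B v _; rewrite scale0r; apply: smem0. Qed.
Next Obligation.
move=> V A B c a b Ha Hb v Bv; rewrite scalerDl -scalerA.
by apply: smemD; [apply: smemZ; apply: Ha|apply: Hb].
Qed.

Hypothesis nR : noeth (s0 : smod R^o) sT.

Lemma noeth_cyc (V : lmodType R) (A : smod V) u : noeth A (sadd A (cyc u)).
Proof.
apply: (@noeth_isom _ _ (lact u) sT); first exact: sle_refl.
exact: noeth_sub nR.
Qed.

(** A maximal one among the annihilators of elements of [B] outside [A] is prime: if [a * b] kills
    [u] modulo [A] and neither factor does, the annihilator of [b *: u] is strictly larger.
    Noetherian induction reaches such a maximal one. *)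
Lemma assoc_prime (V : lmodType R) (A B : smod V) : A <=s B -> ~ B <=s A ->
  exists u, B u /\ sprime (colon A u).
Proof.
move=> AB nBA.
have [u0 [Bu0 nAu0]] : exists u, B u /\ ~ A u.
  by apply: contrapT => nex; apply: nBA => v Bv; apply: contrapT => nAv; apply: nex; exists v.
pose Q J := (exists u, [/\ B u, ~ A u & J = colon A u]) -> exists u, B u /\ sprime (colon A u).
apply: (@noeth_ind _ (colon A u0) sT Q) => //; first exact: noeth_sub nR.
  move=> X _ _ IH [u [Bu nAu E]].
  case: (pselect (sprime (colon A u))) => [pu|npu]; first by exists u.
  have [a [b [ab na nb]]] : exists a b, [/\ colon A u (a * b), ~ colon A u a & ~ colon A u b].
    apply: contrapT => nex; apply: npu; split; first by rewrite /= scale1r.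
    move=> a b ab; apply: contrapT => /not_orP[na nb]; apply: nex.
    by exists a, b.
  apply: (IH (colon A (b *: u))) => //.
  - by rewrite E => c /= Ac; rewrite scalerA mulrC -scalerA; apply: smemZ.
  - by rewrite E => H; apply: na; apply: H; rewrite /= scalerA.
  by exists (b *: u); split=> //; apply: smemZ.
by exists u0.
Qed.

(* Filtrations with successive quotients R / q, q prime, listed from the bottom. *)
Inductive pfil (V : lmodType R) : smod V -> smod V -> seq (smod R^o) -> Prop :=
| pf0 A : pfil A A [::]
| pfS A B u s : sprime (colon A u) -> pfil (sadd A (cyc u)) B s ->
    pfil A B (colon A u :: s).

Lemma pfil_le (V : lmodType R) (A B : smod V) s : pfil A B s -> A <=s B.
Proof. by elim=> // {}A {}B u {}s _ _; apply: sle_trans. Qed.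

Lemma prime_fil (V : lmodType R) (A B : smod V) : noeth A B -> A <=s B -> exists s, pfil A B s.
Proof.
move=> nAB AB; apply: (@noeth_ind _ A B (fun X => exists s, pfil X B s)) => // X AX XB IH.
case: (pselect (B <=s X)) => [BX|nBX].
  by exists [::]; rewrite (smod_eq XB BX); constructor.
have [u [Bu pu]] := assoc_prime XB nBX.
have [|||s Hs] := IH (sadd X (cyc u)) => //.
- move=> H; case: pu => n1 _; apply: n1; rewrite /= scale1r; apply: H.
  by apply: sadd_r; exact: cycP.
- by apply: sadd_le => //; apply: cyc_le.
by exists (colon X u :: s); constructor.
Qed.

Lemma pfil_cat (V : lmodType R) (A B C : smod V) s t : pfil A B s -> pfil B C t -> pfil A C (s ++ t).
Proof. by elim=> //= {}A {}B u {}s pu _ IH /IH; constructor. Qed.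

Lemma ann2_colon (V : lmodType R) (A B : smod V) u : B u -> ann2 A B <=s colon A u.
Proof. by move=> Bu a Ha; apply: Ha. Qed.

(** If no factor were contained in [P], each would offer an element outside [P]; the product of
    these kills B/A, yet lies outside the prime [P]. *)
Lemma pfil_ann (V : lmodType R) (A B : smod V) s P : pfil A B s -> sprime P ->
  ann2 A B <=s P -> exists2 q, q <=s P & List.In q s.
Proof.
move=> H pP HP; apply: contrapT => nex.
suff [c nPc Hc] : exists2 c, ~ P c & forall v, B v -> A (c *: v) by apply: nPc; apply: HP.
elim: H {HP} nex => [{}A nex|{}A {}B u {}s pu H IH nex].
  by exists 1; [case: pP|move=> v; rewrite scale1r].
have [|c nPc Hc] := IH; first by case=> q qP qs; apply: nex; exists q => //; right.
have [d qd nPd] : exists2 d, colon A u d & ~ P d.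
  apply: contrapT => nd; apply: nex; exists (colon A u); last by left.
  by move=> d qd; apply: contrapT => nPd; apply: nd; exists d.
exists (d * c); first by move=> /(proj2 pP)[].
move=> v /Hc [w [_ [Aw [a _ ->] E]]]; rewrite -scalerA E scalerDr.
apply: smemD; first exact: smemZ.
by rewrite /= scalerA mulrC -scalerA; apply: smemZ.
Qed.

End Noeth.
Arguments lact {R V}.

(** The connecting terms telescope. The only one left, in the top degree, vanishes because
    [f N = 0]. *)
Lemma alt_sum (h dl f : nat -> nat) N :
  (forall i, h i + dl i + shiftn dl i = f i)%N -> (forall i, (N <= i)%N -> f i = 0%N) ->
  \sum_(i < N) (-1) ^+ i * (h i)%:Z = \sum_(i < N) (-1) ^+ i * (f i)%:Z :> int.
Proof.
move=> H f0.
have E n : \sum_(i < n.+1) (-1) ^+ i * (f i)%:Z =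
   \sum_(i < n.+1) (-1) ^+ i * (h i)%:Z + (-1) ^+ n * (dl n)%:Z :> int.
  elim: n => [|n IH].
    by rewrite !big_ord_recr !big_ord0 /= -H /= addn0 !expr0 !mul1r PoszD; lia.
  rewrite big_ord_recr IH [in RHS]big_ord_recr /= -H /= exprS !PoszD; ring.
case: N f0 => [|n] f0; first by rewrite !big_ord0.
have d0 : dl n = 0%N by have := H n.+1; rewrite f0 //=; lia.
by rewrite E d0 mulr0 addr0.
Qed.

(** * Euler characteristics *)

Section Chi.
Variables (R : comNzRingType).
Implicit Types (V : lmodType R).

Definition chi V x (A B : smod V) : int := \sum_(i < (size x).+1) (-1) ^+ i * (klen x A B i)%:Z.

Lemma chiE V x (A B : smod V) N : (size x < N)%N ->
  chi x A B = \sum_(i < N) (-1) ^+ i * (klen x A B i)%:Z.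
Proof.
move=> sN; pose F i : int := (-1) ^+ i * (klen x A B i)%:Z.
rewrite /chi -[LHS](big_mkord xpredT F) -[RHS](big_mkord xpredT F).
rewrite [RHS](big_cat_nat (n := (size x).+1)) //= [X in _ + X]big_nat_cond [X in _ + X]big1 ?addr0 //.
by move=> i; rewrite andbT => /andP[si _]; rewrite /F /klen khlen_big // mulr0.
Qed.

Lemma chi_add V x (A B C : smod V) : A <=s B -> B <=s C -> kfin x A B -> kfin x B C ->
  kfin x A C /\ chi x A C = chi x A B + chi x B C.
Proof.
move=> AB BC fAB fBC; have [fAC [dl H]] := khlen_les AB BC fAB fBC; split=> //.
rewrite /chi (@alt_sum (klen x A C) dl (fun i => klen x A B i + klen x B C i)%N) //.
  by rewrite -big_split; apply: eq_bigr => i _; rewrite PoszD mulrDr.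
by move=> i si; rewrite /klen !khlen_big.
Qed.

Lemma chi_refl V x (A : smod V) : kfin x A A -> chi x A A = 0.
Proof.
move=> f; have [_ /eqP] := chi_add (sle_refl (A:=A)) (sle_refl (A:=A)) f f.
by rewrite -subr_eq subrr eq_sym => /eqP.
Qed.

Lemma chi_isom V V' (f : lmap V V') x (A B : smod V) (A' B' : smod V') :
  A = scap B (spre f A') -> B' = sadd A' (simg f B) -> 
  (kfin x A B <-> kfin x A' B') /\ chi x A B = chi x A' B'.
Proof.
move=> EA EB; have [F E] := khlen_isom (size x) x EA EB; split=> //.
by apply: eq_bigr => i _; rewrite /klen E.
Qed.

Lemma klen_rec V c x (A B : smod V) : A <=s B ->
  let T := scap B (spre (lscal c) A) in let E := sadd A (simg (lscal c) B) in
  kfin x A T -> kfin x E B ->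
  [/\ kfin (c :: x) A B, chi (c :: x) A B = chi x E B - chi x A T &
      klen (c :: x) A B 0 = klen x E B 0].
Proof.
move=> AB T E fT fE; have [f [dl H]] := khlen_master AB fT fE; split=> //; last first.
  (* The second half of [H 0%N] bounds [dl 0] by [shiftn _ 0 = 0], so no connecting term disturbs
     h_0. *)
  by have [] := H 0%N; rewrite -/(klen (c :: x) A B 0) -/(klen x E B 0) /=; lia.
rewrite (@chiE _ _ _ _ (size x).+2) //= (@alt_sum _ dl (fun i => shiftn (klen x A T) i + klen x E B i)%N).
- rewrite (@chiE _ x E B (size x).+2) // big_ord_recl [X in _ = X - _]big_ord_recl /=.
  rewrite -addrA; congr (_ + _).
  rewrite /chi -sumrN -big_split; apply: eq_bigr => i _ /=.
  by rewrite /bump /= PoszD exprS; ring.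
- by move=> i; case: (H i).
by case=> [|i] //= si; rewrite /klen !khlen_big //; lia.
Qed.

Lemma chi_nil V (A B : smod V) : A <=s B ->
  [/\ kfin [::] A B <-> fin A B, chi [::] A B = (len A B)%:Z & klen [::] A B 0 = len A B].
Proof.
move=> AB; have [F E] := hk0 [::] AB; split=> //; last by rewrite /klen E.
by rewrite /chi big_ord_recr big_ord0 /= /klen E expr0 mul1r add0r.
Qed.
End Chi.

Section Ideals.
Variables (R : comNzRingType).
Implicit Types (J q : smod R^o) (x : seq R).

Definition idgen x J : smod R^o := foldr (fun c I => sadd I (cyc (c : R^o))) J x.

Lemma idgen_J x J : J <=s idgen x J.
Proof. by elim: x => //= c x IH; apply: sle_trans IH _. Qed.

Lemma idgen_mem x J a : a \in x -> idgen x J a.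
Proof.
elim: x => // c x IH; rewrite inE => /predU1P[->|/IH H].
  exact: (@sadd_r _ _ (idgen x J) (cyc (c : R^o)) _ (cycP _)).
exact: (@sadd_l _ _ (idgen x J) (cyc (c : R^o)) _ H).
Qed.

Lemma idgen_le x J q : idgen x J <=s q <-> J <=s q /\ forall a, a \in x -> q a.
Proof.
split=> [H|[Jq]]; first by split=> [|a ax]; [exact: sle_trans (@idgen_J x J) H|apply/H/idgen_mem].
elim: x => //= c x IH H; apply: sadd_le; first by apply: IH => a ax; apply: H; rewrite inE ax orbT.
by apply: cyc_le; apply: H; rewrite mem_head.
Qed.

(* q is the bottom of a chain of primes of length k. *)
Fixpoint pchain k q : Prop := sprime q /\
  if k is k'.+1 then exists q', [/\ q <=s q', ~ q' <=s q & pchain k' q'] else True.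

Lemma pchain_prime k q : pchain k q -> sprime q. Proof. by case: k => [|k] []. Qed.

Lemma sprime_exp q a t : sprime q -> q (a ^+ t : R) -> q a.
Proof.
move=> pq; elim: t => [|t IH]; first by rewrite expr0 => /(proj1 pq).
by rewrite exprS => /(proj2 pq)[|/IH].
Qed.

Lemma smemMl J (a b : R) : J b -> J (a * b).
Proof. exact: smemZ. Qed.
Lemma smemMr J (a b : R) : J a -> J (a * b).
Proof. by rewrite mulrC; apply: smemZ. Qed.

Lemma pfil_mem (V : lmodType R) (A B : smod V) s q : pfil A B s -> List.In q s ->
  sprime q /\ ann2 A B <=s q.
Proof.
elim=> //= {}A {}B u {}s pu H IH [<-|/IH[pq le_q]]; split=> //.
  by apply: ann2_colon; apply: (pfil_le H); apply: sadd_r; exact: cycP.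
move=> a Ha; apply: le_q => v Bv; exact/sadd_l/Ha.
Qed.

Lemma ann2_le (V : lmodType R) (A B A' B' : smod V) : A <=s A' -> B' <=s B -> ann2 A B <=s ann2 A' B'.
Proof. by move=> AA BB a Ha v /BB /Ha /AA. Qed.

Lemma ann2_sT J : ann2 J sT <=s J.
Proof. by move=> a /(_ 1 I); rewrite /GRing.scale /= mulr1. Qed.

Variable m : smod R^o.
Hypotheses (nR : noeth (s0 : smod R^o) sT) (pm : sprime m).
Hypothesis lm : forall I : smod R^o, ~ I (1 : R) -> I <=s m.

(* The only prime containing J and x is m. *)
Definition mprimary x J := forall q, sprime q -> idgen x J <=s q -> m <=s q.

Lemma mprimary_sub x y J K : idgen x J <=s idgen y K -> mprimary x J -> mprimary y K.
Proof. by move=> H f q pq Hq; apply: f => //; apply: sle_trans Hq. Qed.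

Lemma mprimary_perm x y J : perm_eq x y -> mprimary x J -> mprimary y J.
Proof.
move=> xy; apply: mprimary_sub; apply/idgen_le; split; first exact: idgen_J.
by move=> a; rewrite (perm_mem xy); apply: idgen_mem.
Qed.

Lemma fin_max q : m <=s q -> fin q sT.
Proof.
move=> mq; apply: (@fin_bound _ _ _ _ 1%N) => // -[|[|k]] //= [X [[Y [/schain_le qY YX nXY]] _ nTX]].
exfalso; apply: nXY; case: (pselect (X (1 : R))) => [X1|/lm Xm].
  by exfalso; apply: nTX => a _; rewrite -[a]mulr1; apply: smemMl.
by move=> a /Xm /mq /qY.
Qed.

Lemma pfil_fin (V : lmodType R) (A B : smod V) s : pfil A B s ->
  (forall q, List.In q s -> m <=s q) -> fin A B.
Proof.
elim=> [{}A _|{}A {}B u {}s pu H IH Hs]; first exact: (fin_refl _).1.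
apply/(len_add (@sadd_l _ _ A (cyc u)) (pfil_le H)).1; split; last first.
  by apply: IH => q qs; apply: Hs; right.
have [] := @isom _ _ _ (lact u) sT A (sadd A (cyc u)) => // -[H1 _] _; apply: H1.
have -> : scap sT (spre (lact u) A) = colon A u by apply: smod_eq => // v [].
have -> : scap sT (spre (lact u) (sadd A (cyc u))) = sT.
  by apply: smod_eq => // a _; split=> //; apply: sadd_r; exists a.
by apply: fin_max; apply: Hs; left.
Qed.

(** Conditions that make all Koszul homology of [x] on B/A of finite length and that pass to both
    smaller problems of the cone recursion. *)
Definition admissible (V : lmodType R) x (A B : smod V) := [/\ A <=s B, noeth A B & mprimary x (ann2 A B)].
(** [tors c A B] modulo [A] is the kernel of [c] on B/A, and [B] modulo [addmul c A B] is its
    cokernel. *)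
Definition tors (V : lmodType R) c (A B : smod V) := scap B (spre (lscal c) A).
Definition addmul (V : lmodType R) c (A B : smod V) := sadd A (simg (lscal c) B).

Section Mod.
Variable V : lmodType R.
Implicit Types A B C : smod V.

Lemma le_T c A B : A <=s B -> A <=s tors c A B /\ tors c A B <=s B.
Proof.
move=> AB; split=> [v Av|v []] //; split; first exact: AB.
by apply: smemZ.
Qed.
Lemma le_E c A B : A <=s B -> A <=s addmul c A B /\ addmul c A B <=s B.
Proof.
by move=> AB; split; [exact: sadd_l|apply: sadd_le => // _ [v Bv ->]; apply: smemZ].
Qed.

(** On the kernel of [c], and in the next lemma on its cokernel, [c] belongs to the annihilator, so
    striking it off the sequence loses nothing. *)
Lemma idgen_annT c x A B : A <=s B -> idgen (c :: x) (ann2 A B) <=s idgen x (ann2 A (tors c A B)).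
Proof.
move=> AB; have [_ TB] := le_T c AB; apply/idgen_le; split.
  by apply: sle_trans (@idgen_J x _); apply: ann2_le.
move=> a; rewrite inE => /predU1P[->|]; last exact: idgen_mem.
by apply: idgen_J => v [].
Qed.
Lemma idgen_annE c x A B : A <=s B -> idgen (c :: x) (ann2 A B) <=s idgen x (ann2 (addmul c A B) B).
Proof.
move=> AB; have [AE _] := le_E c AB; apply/idgen_le; split.
  by apply: sle_trans (@idgen_J x _); apply: ann2_le.
move=> a; rewrite inE => /predU1P[->|]; last exact: idgen_mem.
by apply: idgen_J => v Bv; apply: sadd_r; exists v.
Qed.

Lemma admissible_T c x A B : admissible (c :: x) A B -> admissible x A (tors c A B).
Proof.
move=> [AB nAB f]; have [AT TB] := le_T c AB; split=> //; first exact: noeth_sub nAB.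
exact: mprimary_sub (@idgen_annT c x A B AB) f.
Qed.
Lemma admissible_E c x A B : admissible (c :: x) A B -> admissible x (addmul c A B) B.
Proof.
move=> [AB nAB f]; have [AE EB] := le_E c AB; split=> //; first exact: noeth_sub nAB.
exact: mprimary_sub (@idgen_annE c x A B AB) f.
Qed.

Lemma admissible_sub x A B A' B' : admissible x A B -> A <=s A' -> A' <=s B' -> B' <=s B -> admissible x A' B'.
Proof.
move=> [AB nAB f] AA AB' BB; split=> //; first exact: noeth_sub nAB.
apply: mprimary_sub f; apply/idgen_le; split; last by move=> a; apply: idgen_mem.
by apply: sle_trans (@idgen_J x _); apply: ann2_le.
Qed.

Lemma kfin_admissible x A B : admissible x A B -> kfin x A B.
Proof.
elim: x A B => [|c x IH] A B okAB; have [AB nAB f] := okAB.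
  have [F _ _] := chi_nil AB; apply/F.
  have [s Hs] := prime_fil nR nAB AB; apply: (pfil_fin Hs) => q qs.
  by have [pq le_q] := pfil_mem Hs qs; apply: f.
by case: (klen_rec AB (IH _ _ (admissible_T okAB)) (IH _ _ (admissible_E okAB))).
Qed.

Lemma chi_rec c x A B : admissible (c :: x) A B ->
  chi (c :: x) A B = chi x (addmul c A B) B - chi x A (tors c A B).
Proof.
move=> okAB; have [AB _ _] := okAB.
by have [] := klen_rec AB (kfin_admissible (admissible_T okAB)) (kfin_admissible (admissible_E okAB)).
Qed.

Lemma chi_addo x A B C : admissible x A C -> A <=s B -> B <=s C -> chi x A C = chi x A B + chi x B C.
Proof.
move=> okAC AB BC; have fAB := kfin_admissible (admissible_sub okAC (sle_refl (A:=A)) AB BC).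
have fBC := kfin_admissible (admissible_sub okAC AB BC (sle_refl (A:=C))).
by have [] := chi_add AB BC fAB fBC.
Qed.

Lemma chi_reflo x A : chi x A A = 0.
Proof.
apply: chi_refl; apply: kfin_admissible; split=> //; first exact: noeth_refl.
move=> q [q1 _] H; exfalso; apply: q1; apply: H; apply: idgen_J => v.
by rewrite scale1r.
Qed.

(** The factor is R/q with q prime, on which [c] acts either as zero or injectively. *)
Lemma prime_step c A u : sprime (colon A u) ->
  (colon A u c -> tors c A (sadd A (cyc u)) = sadd A (cyc u) /\ addmul c A (sadd A (cyc u)) = A) /\
  (~ colon A u c -> tors c A (sadd A (cyc u)) = A).
Proof.
move=> pu; split=> qc.
  have cB : forall v, sadd A (cyc u) v -> A (c *: v).
    move=> _ [w [_ [Aw [a _ ->] ->]]]; rewrite scalerDr; apply: smemD; first exact: smemZ.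
    by rewrite /= scalerA mulrC -scalerA; apply: smemZ.
  split; first by apply: smod_eq => v; [case|move=> Bv; split=> //; apply: cB].
  apply: smod_eq; last exact: sadd_l.
  by apply: sadd_le => // _ [v Bv ->]; apply: cB.
apply: smod_eq => v; last by move=> Av; split; [exact: sadd_l|exact: smemZ].
move=> [[w [_ [Aw [a _ ->] ->]]]] /=; rewrite scalerDr addrC => H1.
apply: smemD => //; have : colon A u (c * a).
  by rewrite /= -scalerA -(addrK (c *: w) (c *: _)); apply: smemB => //; apply: smemZ.
by move=> /(proj2 pu)[].
Qed.

(** By additivity only the factors R/q matter. If [c] is in q, the kernel and the cokernel are both
    R/q and their chi cancel; otherwise the kernel vanishes and the cokernel is covered by the
    induction on the sequence. *)
Lemma chi_ge0 x A B : admissible x A B -> 0 <= chi x A B.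
Proof.
elim: x A B => [|c x IH] A B okAB; have [AB nAB f] := okAB.
  by have [_ -> _] := chi_nil AB.
have [s Hs] := prime_fil nR nAB AB.
elim: Hs {AB nAB f} okAB => [{}A _|{}A {}B u {}s pu H IHs okAB]; first by rewrite chi_reflo.
have [AB _ _] := okAB; have le1 := @sadd_l _ _ A (cyc u); have le2 := pfil_le H.
rewrite (chi_addo okAB le1 le2); apply: addr_ge0; last first.
  exact: IHs (admissible_sub okAB le1 le2 (sle_refl (A:=B))).
have ok1 := admissible_sub okAB (sle_refl (A:=A)) le1 le2; rewrite (chi_rec ok1).
have [kill reg] := prime_step c pu; case: (pselect (colon A u c)) => qc.
  by have [-> ->] := kill qc; rewrite subrr.
rewrite (reg qc) chi_reflo subr0; apply: IH; exact: admissible_E ok1.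
Qed.

(** Same dichotomy as for [chi_ge0]. For [c] outside q, a chain of primes over q + (c) becomes
    longer by one when q is put below it, so the dimension drops together with the length of the
    sequence. *)
Lemma chi_dim x A B : admissible x A B ->
  (forall q, ann2 A B <=s q -> ~ pchain (size x) q) -> chi x A B = 0.
Proof.
elim: x A B => [|c x IH] A B okAB Hq; have [AB nAB f] := okAB.
  have [_ -> _] := chi_nil AB.
  suff -> : A = B by rewrite (fin_refl _).2.
  apply: smod_eq => // v Bv.
  (* If 1 does not kill B/A, the annihilator lies in [m], which by itself is a chain of length 0. *)
  case: (pselect (ann2 A B (1 : R))) => [/(_ v Bv)|n1]; first by rewrite scale1r.
  by case: (Hq m (lm n1)).
have [s Hs] := prime_fil nR nAB AB.
elim: Hs {AB nAB f} okAB Hq => [{}A _ _|{}A {}B u {}s pu H IHs okAB Hq]; first by rewrite chi_reflo.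
have [AB _ _] := okAB; have le1 := @sadd_l _ _ A (cyc u); have le2 := pfil_le H.
rewrite (chi_addo okAB le1 le2) IHs ?addr0; last first.
- by move=> q le_q; apply: Hq; apply: sle_trans le_q; apply: ann2_le.
- exact: (admissible_sub okAB le1 le2 (sle_refl (A:=B))).
have ok1 := admissible_sub okAB (sle_refl (A:=A)) le1 le2; rewrite (chi_rec ok1).
have [kill reg] := prime_step c pu; case: (pselect (colon A u c)) => qc.
  by have [-> ->] := kill qc; rewrite subrr.
rewrite (reg qc) chi_reflo subr0; apply: IH; first exact: admissible_E ok1.
move=> q le_q pq; apply: (Hq (colon A u)).
  by apply: ann2_colon; apply: le2; apply: sadd_r; exact: cycP.
split=> //; exists q; split=> //.
  move=> a qa; apply: le_q => v [w [_ [Aw [b _ ->] ->]]]; apply: sadd_l.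
  rewrite scalerDr; apply: smemD; first exact: smemZ.
  by rewrite /= scalerA mulrC -scalerA; apply: smemZ.
move=> Hqc; apply: qc; apply: Hqc; apply: le_q => v Bv.
by apply: sadd_r; exists v.
Qed.

Lemma chi_pfil x A B s : pfil A B s -> admissible x A B ->
  chi x A B = \sum_(q <- s) chi x q sT.
Proof.
elim=> [{}A _|{}A {}B u {}s pu H IH okAB]; first by rewrite big_nil chi_reflo.
have [AB _ _] := okAB; have le1 := @sadd_l _ _ A (cyc u); have le2 := pfil_le H.
rewrite (chi_addo okAB le1 le2) big_cons IH; last first.
  exact: (admissible_sub okAB le1 le2 (sle_refl (A:=B))).
congr (_ + _); have [||_ ->] := @chi_isom _ _ _ (lact u) x (colon A u) sT A (sadd A (cyc u)) => //.
by apply: smod_eq => // v [].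
Qed.
End Mod.
End Ideals.

(** * Exchange inequalities for the partial Euler characteristic *)

Section Exchange.
Variables (R : comNzRingType) (m : smod R^o).
Hypotheses (nR : noeth (s0 : smod R^o) sT) (pm : sprime m).
Hypothesis lm : forall I : smod R^o, ~ I (1 : R) -> I <=s m.
Local Notation admissible := (admissible m).
Local Notation mprimary := (mprimary m).

Definition pchi1 (V : lmodType R) x (A B : smod V) : int := (klen x A B 0)%:Z - chi x A B.

Section Mod.
Variable V : lmodType R.
Implicit Types A B C : smod V.

Lemma kl0_rec c x A B : admissible (c :: x) A B -> klen (c :: x) A B 0 = klen x (addmul c A B) B 0.
Proof.
move=> okAB; have [AB _ _] := okAB.
by have [] := klen_rec AB (kfin_admissible nR lm (admissible_T okAB)) (kfin_admissible nR lm (admissible_E okAB)).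
Qed.

(* Auslander-Buchsbaum recursion. *)
Lemma pchi1_rec c x A B : admissible (c :: x) A B ->
  pchi1 (c :: x) A B = pchi1 x (addmul c A B) B + chi x A (tors c A B).
Proof. by move=> okAB; rewrite /pchi1 kl0_rec // (chi_rec nR lm okAB); ring. Qed.

Lemma pchi1_nil A B : A <=s B -> pchi1 [::] A B = 0.
Proof. by move=> AB; have [_ E1 E2] := chi_nil AB; rewrite /pchi1 E1 E2 subrr. Qed.

Lemma pchi1_ge0 x A B : admissible x A B -> 0 <= pchi1 x A B.
Proof.
elim: x A B => [|c x IH] A B okAB; first by rewrite pchi1_nil //; case: okAB.
rewrite pchi1_rec //; apply: addr_ge0; first exact: IH (admissible_E okAB).
exact (chi_ge0 nR lm (admissible_T okAB)).
Qed.

Lemma pchi1_one a A B : admissible [:: a] A B -> pchi1 [:: a] A B = (len A (tors a A B))%:Z.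
Proof.
move=> okAB; have [AB _ _] := okAB; have [le1 le2] := le_T a AB.
rewrite pchi1_rec // pchi1_nil ?add0r; last by case: (le_E a AB).
by have [_ -> _] := chi_nil le1.
Qed.

Lemma chi_one a A B : admissible [:: a] A B ->
  chi [:: a] A B = (len (addmul a A B) B)%:Z - (len A (tors a A B))%:Z.
Proof.
move=> okAB; have [AB _ _] := okAB; have [le1 _] := le_T a AB; have [_ le2] := le_E a AB.
rewrite (chi_rec nR lm okAB).
by have [_ -> _] := chi_nil le1; have [_ -> _] := chi_nil le2.
Qed.

Lemma mprimary_rcons_dvd (x : seq R) (b c : R) (J : smod R^o) : mprimary (rcons x (b * c)) J -> mprimary (rcons x b) J.
Proof.
apply: mprimary_sub; apply/idgen_le; split; first exact: idgen_J.
move=> a; rewrite mem_rcons inE => /predU1P[->|ax].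
  by apply: smemMr; apply: idgen_mem; rewrite mem_rcons mem_head.
by apply: idgen_mem; rewrite mem_rcons inE ax orbT.
Qed.

Lemma admissible_dvd x b c A B : admissible (rcons x (b * c)) A B -> admissible (rcons x b) A B /\ admissible (rcons x c) A B.
Proof.
move=> [AB nAB f]; split; split=> //; first exact: mprimary_rcons_dvd f.
by apply: (@mprimary_rcons_dvd _ c b); rewrite mulrC.
Qed.

(** Write M = B/A. Multiplication by [b] maps 0:bc modulo 0:b isomorphically onto the intersection
    of bM and 0:c, and multiplication by [c] gives M/(bM + 0:c) = cM/bcM. The second isomorphism
    theorem connects the two. *)
Lemma chi_mul1 b c A B : admissible [:: b * c] A B ->
  (len A (tors (b * c) A B) = len A (tors b A B) + len A (scap (addmul b A B) (tors c A B)))%N /\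
  (len (addmul (b * c) A B) B + len A (tors c A B) =
    len (addmul c A B) B + len (addmul b A B) B + len A (scap (addmul b A B) (tors c A B)))%N /\
  fin A (tors c A B).
Proof.
move=> okbc; have [okb okc] := @admissible_dvd [::] _ _ _ _ okbc.
have [AB _ _] := okbc.
have fT a : admissible [:: a] A B -> fin A (tors a A B).
  move=> oka; have [le _] := le_T a AB; have [F _ _] := chi_nil le.
  exact/F/(kfin_admissible nR lm (admissible_T oka)).
have fE a : admissible [:: a] A B -> fin (addmul a A B) B.
  move=> oka; have [_ le] := le_E a AB; have [F _ _] := chi_nil le.
  exact/F/(kfin_admissible nR lm (admissible_E oka)).
have [ATb TbB] := le_T b AB; have [ATc TcB] := le_T c AB.
have [ATbc TbcB] := le_T (b * c) AB.
have [AEb EbB] := le_E b AB; have [AEc EcB] := le_E c AB.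
have [AEbc EbcB] := le_E (b * c) AB.
have Tbbc : tors b A B <=s tors (b * c) A B.
  by move=> v [Bv Av]; split=> //; rewrite /= mulrC -scalerA; apply: smemZ.
have Ebcc : addmul (b * c) A B <=s addmul c A B.
  apply: sadd_le => // _ [v Bv ->]; apply: sadd_r; exists (b *: v); first exact: smemZ.
  by rewrite /= scalerA mulrC.
have AI : A <=s scap (addmul b A B) (tors c A B) by move=> v Av; split; [apply: AEb|apply: ATc].
have EbT : addmul b A B <=s sadd (addmul b A B) (tors c A B) by apply: sadd_l.
have ETB : sadd (addmul b A B) (tors c A B) <=s B by apply: sadd_le.
split; last split; last exact: fT.
- rewrite (len_add ATb Tbbc).2 //; last exact: fT.
  congr (_ + _)%N.
  have [] := @isom_gen _ _ _ (lscal b) (tors (b * c) A B) (tors b A B) (tors (b * c) A B)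
    A (scap (addmul b A B) (tors c A B)) AI => //.
  + move=> v [[w [_ [Aw [u Bu ->] ->]]] [_ /= Hc]]; exists w, (b *: u); split=> //.
    exists u => //; split=> //=; rewrite mulrC -scalerA.
    move: Hc; rewrite scalerDr addrC => Hc.
    by rewrite -(addrK (c *: w) (c *: _)); apply: smemB => //; apply: smemZ.
  + apply: smod_eq => v; first by move=> [Bv Av]; split=> //; apply: Tbbc.
    by move=> [[Bv _] Av].
  apply: smod_eq => v; last by case.
  move=> /[dup] Tv [Bv Av]; split=> //; split; last first.
    by split; [apply: smemZ|move: Av; rewrite /= scalerA mulrC].
  by apply: sadd_r; exists v.
have L1 : len (addmul (b * c) A B) (addmul c A B) = len (sadd (addmul b A B) (tors c A B)) B.
  have [] := @isom_gen _ _ _ (lscal c) B (sadd (addmul b A B) (tors c A B)) B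
    (addmul (b * c) A B) (addmul c A B) Ebcc => //.
  + apply: sadd_le; last by move=> _ [v Bv ->]; apply: sadd_r; exists v.
    by move=> v Av; apply/sadd_l/AEbc.
  + apply: smod_eq => v.
      move=> [_ [t [[w [_ [Aw [u Bu ->] ->]]] [Bt Ht] ->]]]; split.
        apply: smemD; last exact: Bt.
        apply: smemD; [exact: AB|exact: smemZ].
      rewrite -[spre _ _ _]/(addmul (b * c) A B (c *: (w + b *: u + t))) !scalerDr.
      apply: smemD; last exact: AEbc.
      apply: smemD; first by apply: AEbc; apply: smemZ.
      by apply: sadd_r; exists u; rewrite //= scalerA mulrC.
    move=> [Bv [w [_ [Aw [u Bu ->] E]]]].
    rewrite -(subrK (b *: u) v) addrC; exists (b *: u), (v - b *: u); split=> //.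
      by apply: sadd_r; exists u.
    split; first by apply: smemB => //; apply: smemZ.
    by rewrite /= scalerBr; move: E => /= ->; rewrite scalerA mulrC addrK.
  apply: smod_eq => v; last by case.
  by move=> Bv; split=> //; apply: sadd_r; exists v.
have [F2 L2] := second_iso (tors c A B) (addmul b A B).
have SC : sadd (addmul b A B) (tors c A B) = sadd (tors c A B) (addmul b A B).
  by apply: smod_eq; apply: sadd_le.
have IC : scap (addmul b A B) (tors c A B) = scap (tors c A B) (addmul b A B).
  by apply: smod_eq => v [].
have := (len_add Ebcc EcB).2 (fE _ okbc); have := (len_add EbT ETB).2 (fE _ okb).
have := (len_add AI (@scap_r _ _ (addmul b A B) (tors c A B))).2 (fT _ okc).
rewrite L1 {2}IC L2 {2}SC; rewrite SC; lia.
Qed.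

(** The product stands last because the recursion strikes off heads: in the end one element remains,
    and there the lengths are compared directly. *)
Lemma chi_mul x b c A B : admissible (rcons x (b * c)) A B ->
  chi (rcons x (b * c)) A B = chi (rcons x b) A B + chi (rcons x c) A B.
Proof.
elim: x A B => [|d x IH] A B okAB; have [okb okc] := admissible_dvd okAB.
  rewrite /= in okAB okb okc *; rewrite !chi_one //.
  by have [E1 [E2 _]] := chi_mul1 okAB; lia.
rewrite /= in okAB okb okc *.
rewrite !(chi_rec nR lm) // IH ?IH; [ring|exact: admissible_T|exact: admissible_E].
Qed.

(** For one element, [pchi1] is the length of the kernel, and by [chi_mul1] the kernel of [b * c]
    has the length of that of [b] plus a part of that of [c]. The recursion adds chi on the kernel
    of [d], which is additive in the last element and nonnegative, so both inequalities persist. *)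
Lemma pchi1_mul x b c A B : admissible (rcons x (b * c)) A B ->
  pchi1 (rcons x b) A B <= pchi1 (rcons x (b * c)) A B <=
    pchi1 (rcons x b) A B + pchi1 (rcons x c) A B.
Proof.
elim: x A B => [|d x IH] A B okAB; have [okb okc] := admissible_dvd okAB.
  rewrite /= in okAB okb okc *; rewrite !pchi1_one //.
  have [E1 [E2 f]] := chi_mul1 okAB.
  have [AB _ _] := okAB; have [ATc TcB] := le_T c AB; have [AEb EbB] := le_E b AB.
  have AI : A <=s scap (addmul b A B) (tors c A B) by move=> v Av; split; [apply: AEb|apply: ATc].
  by have := (len_add AI (@scap_r _ _ (addmul b A B) (tors c A B))).2 f; lia.
rewrite /= in okAB okb okc *; rewrite !pchi1_rec //.
have := IH _ _ (admissible_E okAB); rewrite (chi_mul (admissible_T okAB)).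
have := chi_ge0 nR lm (admissible_T okc) => h0 /andP[h1 h2]; apply/andP; split; lra.
Qed.

Lemma pchi1_pow x a t A B : admissible (rcons x a) A B ->
  pchi1 (rcons x (a ^+ t.+1)) A B <= t.+1%:Z * pchi1 (rcons x a) A B.
Proof.
move=> oka.
have okp s : admissible (rcons x (a ^+ s.+1)) A B.
  have [AB nAB f] := oka; split=> // q pq /idgen_le[Jq Hq]; apply: f => //.
  apply/idgen_le; split=> // b; rewrite mem_rcons inE => /predU1P[->|bx].
    apply: (sprime_exp pq (t := s.+1)); apply: Hq; by rewrite mem_rcons mem_head.
  by apply: Hq; rewrite mem_rcons inE bx orbT.
elim: t => [|t IH]; first by rewrite expr1 mul1r.
have := pchi1_mul (b := a) (c := a ^+ t.+1) (x := x) (A := A) (B := B).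
rewrite -exprS => /(_ (okp _))/andP[_ /le_trans]; apply.
by rewrite [t.+2%:Z]intS mulrDl mul1r; apply: lerD.
Qed.

(** When all of [x] has been struck off, its elements kill the subquotient that is left; there [a]
    and [b] act alike and have the same kernel and cokernel. *)
Lemma pchi1_cong (x : seq R) (a b : R) A B : admissible (rcons x a) A B -> admissible (rcons x b) A B ->
  idgen x (ann2 A B) (a - b) ->
  pchi1 (rcons x a) A B = pchi1 (rcons x b) A B /\ chi (rcons x a) A B = chi (rcons x b) A B.
Proof.
elim: x A B => [|d x IH] A B oka okb H; have [AB _ _] := oka.
  rewrite /= in oka okb H *.
  have H' v : B v -> A (a *: v - b *: v) by move=> Bv; rewrite -scalerBl; apply: H.
  have ET : tors a A B = tors b A B.
    apply: smod_eq => v [Bv Av]; split=> //=.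
      by rewrite -[_ *: _](subKr (a *: v)); apply: smemB => //; apply: H'.
    by rewrite -[_ *: _](subrK (b *: v)); apply: smemD => //; apply: H'.
  have E' : addmul a A B = addmul b A B.
    apply: smod_eq; apply: sadd_le => //; try exact: sadd_l.
      move=> _ [v Bv ->]; rewrite -[lscal a v](subrK (b *: v)); apply: smemD; first exact/sadd_l/H'.
      by apply: sadd_r; exists v.
    move=> _ [v Bv ->]; rewrite -[lscal b v](subKr (a *: v)); apply: smemB; last exact/sadd_l/H'.
    by apply: sadd_r; exists v.
  by rewrite !pchi1_one // !chi_one // ET E'.
rewrite /= in oka okb *; rewrite !pchi1_rec // !(chi_rec nR lm) //.
have [-> ->] := IH _ _ (admissible_E oka) (admissible_E okb) (@idgen_annE _ _ d x A B AB _ H).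
by have [_ ->] := IH _ _ (admissible_T oka) (admissible_T okb) (@idgen_annT _ _ d x A B AB _ H).
Qed.
End Mod.

Lemma ok0 (V : lmodType R) x : noeth (s0 : smod V) sT -> mprimary x s0 -> admissible x (s0 : smod V) sT.
Proof.
move=> nV f; split=> //; apply: mprimary_sub f; apply/idgen_le; split=> // a.
exact: idgen_mem.
Qed.

(** The exponent is the number of factors in a prime filtration of R modulo the ideal: all of them
    contain [a], so multiplication by [a] descends one step each time. *)
Lemma rad_pow (x : seq R) (J : smod R^o) (a : R) : mprimary x J -> m a -> exists t, idgen x J (a ^+ t : R).
Proof.
move=> f ma.
have [s Hs] : exists s, pfil (idgen x J) sT s.
  by apply: prime_fil => //; apply: noeth_sub nR.
have {f} f q : List.In q s -> q a.
  move=> qs; have [pq le_q] := pfil_mem Hs qs; apply: (f q) => //.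
  by apply: sle_trans le_q => b Hb v _; rewrite /GRing.scale /= mulrC; apply: smemMl.
suff [t Ht] : exists t, forall v : R^o, sT v -> idgen x J (a ^+ t *: v).
  by exists t; have := Ht 1 I; rewrite /GRing.scale /= mulr1.
elim: Hs f => [{x J}A _|A B u {}s pu H IH Hq].
  by exists 0%N => v; rewrite expr0 scale1r.
have [|t Ht] := IH; first by move=> q qs; apply: Hq; right.
exists t.+1 => v /Ht [w [_ [Aw [b _ ->] E]]].
rewrite exprS -scalerA E scalerDr; apply: smemD; first exact: smemZ.
by rewrite /= scalerA mulrC -scalerA; apply: smemZ; exact: (Hq (colon A u) (or_introl erefl)).
Qed.

(** The constant is chosen before the module: it has to serve all members of a sequence of
    modules. *)
Definition pchi1_bdd (x y : seq R) := exists C : nat, forall V : lmodType R, noeth (s0 : smod V) sT ->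
  pchi1 y (s0 : smod V) sT <= C%:Z * pchi1 x (s0 : smod V) sT.

Lemma bdd_trans y x z : pchi1_bdd x y -> pchi1_bdd y z -> pchi1_bdd x z.
Proof.
move=> [C HC] [D HD]; exists (D * C)%N => V nV.
by apply: le_trans (HD V nV) _; rewrite PoszM -mulrA; apply: ler_wpM2l => //; apply: HC.
Qed.

Lemma bdd_perm x y : perm_eq x y -> pchi1_bdd x y.
Proof.
move=> xy; exists 1%N => V nV; rewrite mul1r /pchi1 /chi (perm_size xy).
have [_ E] := klen_perm (@sle_T _ _ (s0 : smod V)) xy.
rewrite E; under [X in _ <= _ - X]eq_bigr do rewrite E.
exact: lexx.
Qed.

Lemma bdd_last (x : seq R) (a b : R) : m a -> mprimary (rcons x a) s0 -> mprimary (rcons x b) s0 ->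
  pchi1_bdd (rcons x a) (rcons x b).
Proof.
move=> ma fa fb; have [t Ht] := rad_pow fb ma.
(* The exponent is raised by one to make it positive, as [pchi1_pow] requires. *)
have {}Ht : idgen (rcons x b) s0 (a ^+ t.+1 : R) by rewrite exprS; exact: smemMl.
have [c Hc] : exists c : R, idgen x s0 (a ^+ t.+1 - b * c).
  have : sadd (idgen x s0) (cyc (b : R^o)) (a ^+ t.+1 : R).
    move: Ht; move: (a ^+ _); apply/idgen_le; split=> // e.
    rewrite mem_rcons inE => /predU1P[->|ex]; first by apply: sadd_r; exact: cycP.
    by apply: sadd_l; apply: idgen_mem.
  by move=> [w [_ [Hw [c _ ->] ->]]]; exists c; rewrite /GRing.scale /= mulrC addrK.
exists t.+1 => V nV.
have oka := ok0 nV fa.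
(* A prime containing [x] and [b * c] contains [a ^+ t.+1], hence [a], and [fa] applies. *)
have fbc : mprimary (rcons x (b * c)) s0.
  move=> q pq /idgen_le[_ Hq]; apply: fa => //; apply/idgen_le; split=> // e.
  rewrite mem_rcons inE => /predU1P[->|ex]; last by apply: Hq; rewrite mem_rcons inE ex orbT.
  apply: (sprime_exp pq (t := t.+1)); rewrite -(subrK (b * c) (a ^+ _)); apply: smemD.
    by apply: (proj2 (idgen_le x s0 q) _ _ Hc); split=> // f fx; apply: Hq; rewrite mem_rcons inE fx orbT.
  by apply: Hq; rewrite mem_rcons mem_head.
have fat : mprimary (rcons x (a ^+ t.+1)) s0.
  move=> q pq /idgen_le[_ Hq]; apply: fa => //; apply/idgen_le; split=> // e.
  rewrite mem_rcons inE => /predU1P[->|ex]; last by apply: Hq; rewrite mem_rcons inE ex orbT.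
  by apply: (sprime_exp pq (t := t.+1)); apply: Hq; rewrite mem_rcons mem_head.
have okbc := ok0 nV fbc; have okat := ok0 nV fat.
apply: le_trans (pchi1_pow t oka).
have [|-> _] := pchi1_cong okat okbc.
  by apply: (proj2 (idgen_le x s0 _) _ _ Hc); split=> // e; exact: idgen_mem.
by case/andP: (pchi1_mul okbc).
Qed.

Lemma bdd_exch (w x : seq R) (a b : R) : m a -> mprimary (w ++ a :: x) s0 -> mprimary (w ++ b :: x) s0 ->
  pchi1_bdd (w ++ a :: x) (w ++ b :: x).
Proof.
have P c : perm_eq (w ++ c :: x) (rcons (w ++ x) c).
  by rewrite perm_sym perm_rcons perm_sym -cat1s perm_catCA.
move=> ma fa fb; apply: bdd_trans (bdd_perm (P a)) _.
apply: (@bdd_trans (rcons (w ++ x) b)); last by apply: bdd_perm; rewrite perm_sym.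
by apply: bdd_last => //; [apply: mprimary_perm fa|apply: mprimary_perm fb].
Qed.
End Exchange.

(** * Systems of parameters *)

Section Systems.
Variables (R : comNzRingType) (m : smod R^o).
Hypotheses (nR : noeth (s0 : smod R^o) sT) (pm : sprime m).
Hypothesis lm : forall I : smod R^o, ~ I (1 : R) -> I <=s m.
Local Notation admissible := (admissible m).
Local Notation mprimary := (mprimary m).
Implicit Types (q J : smod R^o).

Lemma unit_out (u : R) q : ~ m u -> sprime q -> ~ q u.
Proof.
move=> nmu [q1 _] qu; apply: nmu.
have := @lm (cyc (u : R^o)); move=> H; apply: H (cycP _).
by move=> /(cyc_le qu).
Qed.

(* Multiplication by z identifies R/q with (q+z)/q, so chi(a; R/(q+z)) = 0; a
   prime containing q+z but not a would contribute a positive term. *)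
Lemma krull_pid q (a z : R) : sprime q -> m a -> mprimary [:: a] q -> ~ q z -> mprimary [:: z] q.
Proof.
move=> pq ma fa nqz.
set J := idgen [:: z] q.
have qJ : q <=s J by apply: idgen_J.
have okq : admissible [:: a] q sT.
  split=> //; first exact: noeth_sub nR.
  apply: mprimary_sub fa; apply/idgen_le; split; last by move=> b; apply: idgen_mem.
  by apply: sle_trans (@idgen_J _ _ _) => b qb v _; exact: smemMr.
have e1 : chi [:: a] q J = chi [:: a] q sT.
  have [||_ ->] // := @chi_isom _ _ _ (lact (z : R^o)) [:: a] q sT q J.
  apply: smod_eq => b; first by move=> qb; split=> //; exact: smemMr.
  by case=> _ /(proj2 pq)[].
have e2 : chi [:: a] J sT = 0.
  by have := chi_addo nR lm okq qJ (@sle_T _ _ J); rewrite e1; lra.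
move=> P pP JP; case: (pselect (P a)) => Pa.
  apply: fa => //; apply/idgen_le; split; first exact: sle_trans qJ JP.
  by move=> b; rewrite inE => /eqP->.
have okJ := admissible_sub okq qJ (@sle_T _ _ J) (@sle_refl _ _ _).
have := chi_addo nR lm okJ JP (@sle_T _ _ P); rewrite e2.
have := chi_ge0 nR lm (admissible_sub okJ (@sle_refl _ _ _) JP (@sle_T _ _ P)).
have okP := admissible_sub okJ JP (@sle_T _ _ P) (@sle_refl _ _ _).
rewrite (chi_one nR lm okP).
have -> : tors a P sT = P.
  apply: smod_eq => b; first by case=> _ /(proj2 pP)[].
  by move=> Pb; split=> //; exact: smemZ.
rewrite (fin_refl P).2 subr0.
(* [P] and [a] lie in [m], so R/(P + aR) is nonzero and chi(a; R/P) would be positive, which [e2]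
   excludes. *)
suff : (0 < len (addmul a P sT) sT)%N by lia.
have fE : fin (addmul a P sT) sT.
  have [_ le] := le_E a (@sle_T _ _ P); have [F _ _] := chi_nil le.
  exact/F/(kfin_admissible nR lm (admissible_E okP)).
apply: schain_len => //=; exists (addmul a P sT); split=> //.
move=> /(_ 1 I) [b [_ [Pb [c _ ->] E]]].
have mP : P <=s m by apply: lm; case: pP.
case: pm => + _; apply; rewrite [1]E; apply: smemD; first exact: mP.
exact: smemMr.
Qed.

(* Each prime of the list contains a + b ^ j for at most one j. *)
Lemma avoid_pow (a b : R) (s : seq (smod R^o)) : m b ->
  (forall q, List.In q s -> sprime q /\ (m <=s q \/ ~ (q a /\ q b))) ->
  exists N, forall j, (N <= j)%N -> forall q, List.In q s -> m <=s q \/ ~ q (a + b ^+ j).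
Proof.
move=> mb; elim: s => [|q s IH] H; first by exists 0%N => j _ q [].
have [|N HN] := IH; first by move=> q' qs; apply: H; right.
have [pq [mq|nq]] : sprime q /\ (m <=s q \/ ~ (q a /\ q b)) by apply: H; left.
  by exists N => j Nj q' [<-|]; [left|apply: HN].
(* The difference of the two elements is [b ^+ i] times [1 - b ^+ (j - i)], and the latter is a unit
   since [b] lies in [m]. So [q] contains [b], and then [a]. *)
have uniq_bad i j : (i < j)%N -> q (a + b ^+ i) -> q (a + b ^+ j) -> False.
  move=> ij qi qj; apply: nq.
  have : q (b ^+ i * (1 - b ^+ (j - i))).
    rewrite mulrBr mulr1 -exprD subnKC ?(ltnW ij) //.
    have -> : b ^+ i - b ^+ j = (a + b ^+ i) - (a + b ^+ j) by ring.
    exact: smemB.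
  case/(proj2 pq) => [/(sprime_exp pq) qb|/unit_out []//].
    split=> //; rewrite -(addrK (b ^+ j) a); apply: smemB => //.
    have j0 : (0 < j)%N by apply: leq_ltn_trans ij.
    by rewrite -(prednK j0) exprS; exact: smemMr.
  have ji : (0 < j - i)%N by rewrite subn_gt0.
  move=> H1; case: pm => + _; apply; rewrite -(subrK (b ^+ (j - i)) 1); apply: smemD => //.
  by rewrite -(prednK ji) exprS; exact: smemMr.
case: (pselect (exists i, q (a + b ^+ i))) => [[i qi]|nex].
  exists (maxn N i.+1) => j Hj q' [<-|]; last by apply: HN; lia.
  by right=> qj; apply: (uniq_bad i j) => //; lia.
exists N => j Nj q' [<-|]; last exact: HN.
by right=> qj; apply: nex; exists j.
Qed.

Lemma avoid (a b : R) (s : seq (smod R^o)) : m a -> m b ->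
  (forall q, List.In q s -> sprime q /\ (m <=s q \/ ~ (q a /\ q b))) ->
  exists2 z : R, m z & forall q, List.In q s -> m <=s q \/ ~ q z.
Proof.
move=> ma mb /(avoid_pow mb)[N HN]; exists (a + b ^+ N.+1); last exact: HN.
by apply: smemD => //; rewrite exprS; exact: smemMr.
Qed.

Lemma prime_avoid (s : seq (smod R^o)) : (forall q, List.In q s -> sprime q) ->
  exists2 z : R, m z & forall q, List.In q s -> m <=s q \/ ~ q z.
Proof.
elim: s => [|q s IH] H; first by exists 0; [apply: smem0|move=> q []].
have [|z mz Hz] := IH; first by move=> q' qs; apply: H; right.
case: (pselect (m <=s q)) => mq.
  by exists z => // q' [<-|]; [left|apply: Hz].
have [y my nqy] : exists2 y : R, m y & ~ q y.
  apply: contrapT => nex; apply: mq => y my; apply: contrapT => nqy.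
  by apply: nex; exists y.
apply: (@avoid z y) => // q' [<-|qs]; first by split; [apply: H; left|right=> -[]].
split; first by apply: H; right.
by case: (Hz _ qs); [left|right=> -[]].
Qed.

(** A prime filtration of R/J provides a finite list of primes over [J] that includes all the
    minimal ones. *)
Lemma ideal_fil J : exists2 s, (forall q, List.In q s -> sprime q /\ J <=s q) &
  forall P, sprime P -> J <=s P -> exists2 q, q <=s P & List.In q s.
Proof.
have [s Hs] : exists s, pfil J sT s by apply: prime_fil => //; exact: noeth_sub nR.
exists s.
  move=> q qs; have [pq le_q] := pfil_mem Hs qs; split=> //.
  by apply: sle_trans le_q => b Jb v _; exact: smemMr.
move=> P pP JP; apply: pfil_ann Hs pP _.
by apply: sle_trans JP; apply: ann2_sT.
Qed.

(** [z] is chosen outside all the primes other than [m] listed for (x) and for (y). Modulo such a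
    prime from the list of [x], the single element [a] leaves only [m], so by [krull_pid] the same
    is true of [z]; likewise with [b] and [y]. Avoidance is possible because [a] lies in no listed
    prime over (x) other than [m], and [b] in none over (y). *)
Lemma exch_exists (a b : R) (x y : seq R) : m a -> m b ->
  mprimary (a :: x) s0 -> mprimary (b :: y) s0 ->
  exists z : R, [/\ m z, mprimary (z :: x) s0 & mprimary (z :: y) s0].
Proof.
move=> ma mb fa fb.
have [s Hs Hs'] := ideal_fil (idgen x s0); have [t Ht Ht'] := ideal_fil (idgen y s0).
have K c w q : mprimary (c :: w) s0 -> idgen w s0 <=s q -> mprimary [:: c] q.
  move=> f Hq P pP HP; apply: f => //; apply/idgen_le; split=> // e; rewrite inE => /predU1P[->|ew].
    by apply: HP; apply: idgen_mem; rewrite mem_head.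
  by apply: HP; apply: idgen_J; apply: Hq; exact: idgen_mem.
have L c w q : sprime q -> mprimary (c :: w) s0 -> idgen w s0 <=s q -> q c -> m <=s q.
  move=> pq f Hq qc; apply: (K c w q f Hq) => //; apply/idgen_le; split=> // e.
  by rewrite inE => /eqP->.
have [z mz Hz] : exists2 z : R, m z & forall q, List.In q (s ++ t) -> m <=s q \/ ~ q z.
  apply: (@avoid a b) => // q; rewrite List.in_app_iff => -[/Hs|/Ht] [pq Hq]; split=> //.
    case: (pselect (q a)) => qa; last by right=> -[].
    by left; apply: L pq fa Hq qa.
  case: (pselect (q b)) => qb; last by right=> -[].
  by left; apply: L pq fb Hq qb.
have M (c : R) (w : seq R) u : m c -> mprimary (c :: w) s0 -> (forall q, List.In q u -> sprime q /\ idgen w s0 <=s q) ->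
    (forall P, sprime P -> idgen w s0 <=s P -> exists2 q, q <=s P & List.In q u) ->
    (forall q, List.In q u -> m <=s q \/ ~ q z) -> mprimary (z :: w) s0.
  move=> mc f H1 H2 H3 P pP HP.
  have [q qP qu] : exists2 q, q <=s P & List.In q u.
    by apply: H2 => //; apply: sle_trans HP; exact: sadd_l.
  have [pq Hq] := H1 _ qu; case: (H3 _ qu) => [mq|nqz]; first exact: sle_trans mq qP.
  apply: (krull_pid pq mc (K _ _ _ f Hq) nqz) => //; apply/idgen_le; split=> // e.
  by rewrite inE => /eqP->; apply: HP; apply: idgen_mem; rewrite mem_head.
exists z; split=> //.
  by apply: (M a x s) => // q qs; apply: Hz; rewrite List.in_app_iff; left.
by apply: (M b y t) => // q qs; apply: Hz; rewrite List.in_app_iff; right.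
Qed.

(** [w] collects the elements already common to both systems. Each round replaces the heads [a] and
    [b] by one [z] and moves it to [w]. *)
Lemma bdd_sop (x y w : seq R) : size x = size y -> (forall a, a \in x -> m a) ->
  (forall a, a \in y -> m a) -> mprimary (w ++ x) s0 -> mprimary (w ++ y) s0 -> pchi1_bdd (w ++ x) (w ++ y).
Proof.
elim: x y w => [|a x IH] [|b y] w //=.
  by move=> _ _ _ _ _; exists 1%N => V _; rewrite mul1r.
move=> [sxy] mx my fx fy.
have P c u : perm_eq (w ++ c :: u) (c :: w ++ u) by rewrite perm_sym -cat1s perm_catCA.
have P' c u : perm_eq (c :: w ++ u) (w ++ c :: u) by rewrite perm_sym.
have ma : m a by apply: mx; rewrite mem_head.
have mb : m b by apply: my; rewrite mem_head.
have [z [mz f1 f2]] := exch_exists ma mb (mprimary_perm (P _ _) fx) (mprimary_perm (P _ _) fy).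
have {}f1 := mprimary_perm (P' _ _) f1; have {}f2 := mprimary_perm (P' _ _) f2.
apply: bdd_trans (bdd_exch nR lm ma fx f1) _.
apply: bdd_trans (bdd_exch nR lm mz f2 fy).
rewrite -!cat_rcons; apply: IH; rewrite ?cat_rcons //.
  by move=> c cx; apply: mx; rewrite inE cx orbT.
by move=> c cy; apply: my; rewrite inE cy orbT.
Qed.

(** An element [z] of [m] outside the listed primes other than [m] lowers the dimension: the bottom
    of a chain over (J, z) lies strictly above a listed prime, which can be put below it. *)
Lemma sop_exists k J : (forall q, J <=s q -> ~ pchain k.+1 q) ->
  exists x : seq R, [/\ size x = k, forall a, a \in x -> m a & mprimary x J].
Proof.
elim: k J => [|k IH] J HJ.
  exists [::]; split=> // q pq Jq; apply: contrapT => nmq; apply: (HJ q Jq).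
  by split=> //; exists m; split=> //; apply: lm; case: pq.
have [s Hs Hs'] := ideal_fil J.
have [z mz Hz] : exists2 z : R, m z & forall q, List.In q s -> m <=s q \/ ~ q z.
  by apply: prime_avoid => q /Hs[].
have [|x [sx mx fx]] := IH (idgen [:: z] J).
  move=> q Hq pq; have pq' := pchain_prime pq.
  have [p pq'' ps] := Hs' _ pq' (sle_trans (@idgen_J _ [:: z] J) Hq).
  have [pp Jp] := Hs _ ps; case: (Hz _ ps) => [mp|npz].
    case: pq => _ [q' [qq' nq'q /pchain_prime[q1 _]]]; apply: nq'q.
    by apply: sle_trans (lm q1) _; apply: sle_trans mp pq''.
  apply: (HJ p Jp); split=> //; exists q; split=> // H; apply: npz; apply: H.
  by apply: Hq; apply: idgen_mem; rewrite mem_head.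
exists (z :: x); split; rewrite /= ?sx //.
  by move=> a; rewrite inE => /predU1P[->|/mx].
apply: mprimary_sub fx; apply/idgen_le; split; last first.
  by move=> a ax; apply: idgen_mem; rewrite inE ax orbT.
apply/idgen_le; split; first exact: idgen_J.
by move=> a; rewrite inE => /eqP->; apply: idgen_mem; rewrite mem_head.
Qed.

Lemma klen_low (V : lmodType R) (A B : smod V) (y x : seq R) t i : A <=s B -> kfin y A B ->
  (forall a, a \in x -> idgen y s0 (a ^+ t : R)) ->
  kfin (x ++ y) A B /\ (klen y A B i <= t ^ size x * klen (x ++ y) A B (i + size x))%N.
Proof.
move=> AB fy; elim: x => [|a x IH] Hx; first by rewrite /= expn0 mul1n addn0.
have [|f Hi] := IH; first by move=> b bx; apply: Hx; rewrite inE bx orbT.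
have [f' _] := khlen_cone a AB f; split=> //.
apply: leq_trans Hi _; rewrite expnSr -mulnA leq_mul2l; apply/orP; right.
rewrite addnS; apply: (khlen_low (i + size x) AB f).
(* The ideal of elements acting null-homotopically contains [y], hence the ideal generated by [y],
   where [a ^+ t] lies. *)
pose N := @Smod R R^o (fun b => hnull V (size (x ++ y)) (x ++ y) b) (hnull0 V _ _)
  (fun a b c Hb Hc => hnull_lin a Hb Hc).
have /idgen_le H : (s0 : smod R^o) <=s N /\ forall b, b \in y -> N b.
  by split=> // b yb; apply: hnull_mem; rewrite mem_cat yb orbT.
by apply: H; apply: Hx; rewrite mem_head.
Qed.

(** Each added element at most doubles the bound and reaches down by one degree; above degree
    [size y], h_0 of [x] is therefore never reached. *)
Lemma klen_high (V : lmodType R) (A B : smod V) (y x : seq R) : A <=s B -> kfin x A B ->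
  kfin (y ++ x) A B /\ forall k, (size y < k)%N ->
  (klen (y ++ x) A B k <= 2 ^ size y * \sum_(1 <= j < (size x).+1) klen x A B j)%N.
Proof.
move=> AB fx; elim: y => [|a y [f IH]].
  split=> // k k0; rewrite expn0 mul1n /=.
  case: (leqP k (size x)) => kx; last by rewrite /klen khlen_big.
  by rewrite (bigD1_seq k) ?iota_uniq ?mem_index_iota ?k0 //= leq_addr.
have [f' H] := khlen_cone a AB f; split=> // -[|k] //= sk.
apply: leq_trans (H k.+1) _; rewrite expnS mul2n -addnn mulnDl leq_add //; apply: IH; lia.
Qed.

Lemma klen_sop (x y : seq R) : size x = size y -> (forall a, a \in x -> m a) ->
  mprimary x s0 -> mprimary y s0 ->
  exists C : nat, forall V : lmodType R, noeth (s0 : smod V) sT -> forall i, (1 <= i)%N ->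
  (klen y (s0 : smod V) sT i <= C * \sum_(1 <= j < (size x).+1) klen x (s0 : smod V) sT j)%N.
Proof.
move=> sxy mx fx fy.
have [t Ht] : exists t, forall a, a \in x -> idgen y s0 (a ^+ t : R).
  elim: {fx sxy} x mx => [|a x IH] mx; first by exists 0%N.
  have [|t Ht] := IH; first by move=> b bx; apply: mx; rewrite inE bx orbT.
  have [s Hs] := rad_pow nR fy (mx a (mem_head _ _)).
  exists (t + s)%N => b; rewrite inE exprD => /predU1P[->|/Ht H]; first exact: smemMl.
  exact: smemMr.
(* Putting the elements of [x] in front of [y] costs a factor [t] and one degree each; building
   [y ++ x] from [x] costs a factor 2 each. As i >= 1, the degree [i + size x] exceeds [size y]. *)
exists (t ^ size x * 2 ^ size y)%N => V nV i i1.
have AB : (s0 : smod V) <=s sT by [].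
have [_ H1] := klen_low i AB (kfin_admissible nR lm (ok0 nV fy)) Ht.
have [_ H2] := klen_high y AB (kfin_admissible nR lm (ok0 nV fx)).
have [_ E] := klen_perm AB (introT permPl (perm_catC x y)).
apply: leq_trans H1 _; rewrite E -mulnA leq_mul2l; apply/orP; right.
by apply: H2; rewrite -sxy; lia.
Qed.
End Systems.

(** * Ideals and primes *)

Section Bridge.
Variable R : comNzRingType.

Program Definition smod_of (I : idealr R) : smod R^o := @Smod R R^o (fun a : R => a \in I) _ _.
Next Obligation. by move=> I; exact: idealr0. Qed.
Next Obligation. by move=> I a u v Iu Iv; apply: rpredD => //; exact: idealMr. Qed.

(** An [idealr] is proper by definition, whence the hypothesis. *)
Lemma idealr_of (I : smod R^o) : ~ I (1 : R) -> exists J : idealr R, smod_of J = I.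
Proof.
move=> I1; pose P := [pred a : R | `[< I a >]].
have PI : idealr_closed P.
  split; first by apply/asboolP; exact: smem0.
    by apply/asboolP.
  by move=> a u v /asboolP Iu /asboolP Iv; apply/asboolP; exact: smemP.
pose J : idealr R := HB.pack (P : R -> bool) (isIdealr.Build R P PI).
by exists J; apply: smod_eq => a /asboolP.
Qed.

Lemma prime_idealr_of (q : smod R^o) : sprime q -> exists p : prime_idealr R, smod_of p = q.
Proof.
move=> [I1 pq]; pose P := [pred a : R | `[< q a >]].
have PI : idealr_closed P.
  split; first by apply/asboolP; exact: smem0.
    by apply/asboolP.
  by move=> a u v /asboolP Iu /asboolP Iv; apply/asboolP; exact: smemP.
have PP : prime_idealr_closed P.
  by move=> a b /asboolP /pq [qa|qb]; apply/orP; [left|right]; apply/asboolP.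
pose J : prime_idealr R := HB.pack (P : R -> bool) (isIdealr.Build R P PI)
   (isPrimeIdealrClosed.Build R P PP).
by exists J; apply: smod_eq => a /asboolP.
Qed.

Lemma sprime_of (p : prime_idealr R) : sprime (smod_of p).
Proof.
split; first by rewrite /= idealr1.
by move=> a b; rewrite /= prime_idealrM => /orP.
Qed.

Lemma noetherian_noeth : noetherian R -> noeth (s0 : smod R^o) sT.
Proof.
move=> nR f Hf; have M := noeth_mono Hf.
have [U UE] : exists U : smod R^o, forall a, U a <-> exists n, f n a.
  have U0 : exists n, f n 0 by exists 0%N; exact: smem0.
  have UP a (u v : R^o) : (exists n, f n u) -> (exists n, f n v) -> exists n, f n (a *: u + v).
    move=> [i fi] [j fj]; exists (maxn i j).
    by apply: smemP; [apply: M fi; exact: leq_maxl|apply: M fj; exact: leq_maxr].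
  by exists (@Smod R R^o (fun a => exists n, f n a) U0 UP).
(* The union of the chain may be the unit ideal, to which [noetherian] does not apply; then 1
   already lies in some term. *)
case: (pselect (U (1 : R))) => [/UE[n fn1]|/idealr_of [J EJ]].
  by exists n => k _ a _; rewrite -[a]mulr1; exact: smemZ.
have [k [g Hg]] := nR J.
have gU i : exists n, f n (g i).
  apply/UE; rewrite -EJ /= Hg; apply/asboolP; exists (fun j => (j == i)%:R).
  rewrite (bigD1 i) //= eqxx mul1r big1 ?addr0 // => j /negPf ->; exact: mul0r.
have [N HN] := choice gU.
exists (\max_i N i)%N => n _ a fna.
have : U a by apply/UE; exists n.
rewrite -EJ /= Hg => /asboolP[c ->]; apply: smem_sum => i _.
apply: (@smemZ _ _ (f _) (c i) (g i)); apply: M (HN i); exact: leq_bigmax.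
Qed.

Section Local.
Variable m : idealr R.
Hypothesis lR : local_ring m.

(** [local_ring] speaks of maximal ideals only. Noetherian induction climbs from [I] to a proper
    ideal with no larger proper one; it is maximal, hence equal to [m]. *)
Lemma local_max (I : smod R^o) : ~ I (1 : R) -> I <=s smod_of m.
Proof.
case: lR => /noetherian_noeth nR maxm locm I1.
pose Q (X : smod R^o) := ~ X (1 : R) -> X <=s smod_of m.
apply: (@noeth_ind _ _ I sT Q) I1 => //; first exact: noeth_sub nR.
move=> X IX _ IH X1.
case: (pselect (exists2 Y, X <=s Y & ~ Y (1 : R) /\ ~ Y <=s X)) => [[Y XY [Y1 nYX]]|nex].
  exact: sle_trans XY (IH Y XY nYX (@sle_T _ _ Y) Y1).
have [J EJ] := idealr_of X1.
suff /locm E : maximal_ideal J by rewrite -EJ => a /=; rewrite E.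
move=> K JK a; apply/idP/idP; last exact: JK.
move=> Ka; apply: contrapT => nJa; apply: nex; exists (smod_of K).
  by rewrite -EJ => b /JK.
split; first by rewrite /= idealr1.
by rewrite -EJ => /(_ a Ka).
Qed.

Lemma local_prime : sprime (smod_of m).
Proof.
split; first by rewrite /= idealr1.
move=> a b mab; apply: contrapT => /not_orP[na nb].
have max1 c : ~ smod_of m c -> sadd (smod_of m) (cyc (c : R^o)) (1 : R).
  move=> nc; apply: contrapT => /local_max H; apply: nc; apply: H.
  by apply: sadd_r; exact: cycP.
have [u [_ [mu [c _ ->] E1]]] := max1 a na.
apply: nb; have -> : b = u * b + c * (a * b).
  by rewrite mulrA -mulrDl -[RHS]/((u + c * a) * b) -[u + _]/(u + c *: (a : R^o)) -E1 mul1r.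
by apply: (@smemD _ _ (smod_of m)); [exact: smemMr|exact: smemMl].
Qed.
End Local.

Definition psm (p : prime_idealr R) : smod R^o := smod_of p.

Lemma psubE (p q : prime_idealr R) : psub p q <-> psm p <=s psm q /\ ~ psm q <=s psm p.
Proof.
split=> [[pq [v qv npv]]|[pq nqp]].
  by split=> [a /pq //|/(_ v qv)]; rewrite /= (negPf npv).
split=> [a pa|]; first exact: pq.
apply: contrapT => nex; apply: nqp => a qa; rewrite /=; apply: contrapT => npa.
by apply: nex; exists a => //; apply/negP.
Qed.

Lemma psub_trans (p q r : prime_idealr R) : psub p q -> psub q r -> psub p r.
Proof.
move=> /psubE[pq nqp] /psubE[qr nrq]; apply/psubE; split; first exact: sle_trans pq qr.
by move=> rp; apply: nrq; exact: sle_trans rp pq.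
Qed.

Lemma chain_mono (p : nat -> prime_idealr R) k : (forall i, (i < k)%N -> psub (p i) (p i.+1)) ->
  forall i j, (i < j)%N -> (j <= k)%N -> psub (p i) (p j).
Proof.
move=> H i j; elim: j => // j IH; rewrite ltnS leq_eqVlt => /orP[/eqP->|ij] jk; first exact: H.
by apply: psub_trans (IH ij (ltnW jk)) _; apply: H.
Qed.

Lemma pchain_of k (p : nat -> prime_idealr R) : (forall i, (i < k)%N -> psub (p i) (p i.+1)) ->
  pchain k (psm (p 0%N)).
Proof.
elim: k p => [|k IH] p H; first by split=> //; exact: sprime_of.
split; first exact: sprime_of.
exists (psm (p 1%N)); have /psubE[pq nqp] := H 0%N isT.
by split=> //; apply: (IH (fun i => p i.+1)) => i ik; exact: H.
Qed.

Lemma of_pchain k q : pchain k q -> exists p : nat -> prime_idealr R, psm (p 0%N) = q /\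
  forall i, (i < k)%N -> psub (p i) (p i.+1).
Proof.
elim: k q => [|k IH] q [pq]; have [p0 E0] := prime_idealr_of pq.
  by exists (fun _ => p0).
move=> [q' [qq' nqq' /IH[p [E H]]]].
exists (fun i => if i is j.+1 then p j else p0); split=> // -[|i] ik; last exact: H.
by apply/psubE; rewrite /psm E0 -/(psm (p 0%N)) E.
Qed.

Lemma prime_chainP (I : {pred R}) (J : smod R^o) k : (forall a, J a <-> a \in I) ->
  prime_chain I k <-> exists2 q, J <=s q & pchain k q.
Proof.
move=> IJ; split.
  move=> [p [Ip Hp]]; exists (psm (p ord0)).
    by move=> a /IJ; exact: Ip.
  have -> : ord0 = inord 0 :> 'I_k.+1 by apply: val_inj; rewrite /= inordK.
  apply: (@pchain_of k (fun i => p (inord i))) => i ik; apply: Hp.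
  by rewrite !inordK //; lia.
move=> [q Jq /of_pchain[p [E H]]]; exists (fun i => p i); have M := chain_mono H.
split=> [i a aI|i j ij]; last by apply: M => //; rewrite -ltnS.
have qa : psm (p 0%N) a by rewrite E; apply: Jq; apply/IJ.
case: (posnP i) => [->//|i0]; have /psubE[+ _] := M 0%N i i0 (ltn_ord i : (i <= k)%N).
exact.
Qed.

Section Fingen.
Variable V : lmodType R.

Definition lspan n (g : 'I_n -> V) : smod V := \big[@sadd R V/s0]_(i < n) cyc (g i).

Lemma lspanP n (g : 'I_n -> V) v :
  lspan g v <-> exists c : 'I_n -> R, v = \sum_(i < n) c i *: g i.
Proof.
elim: n g v => [|n IH] g v.
  rewrite /lspan big_ord0; split=> [->|[c ->]]; last by rewrite big_ord0.
  by exists (fun _ => 0); rewrite big_ord0.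
rewrite /lspan big_ord_recl; split.
  move=> [_ [w [[a _ ->] /(IH (fun i => g (lift ord0 i)))[c ->] ->]]].
  exists (fun i => if unlift ord0 i is Some j then c j else a).
  rewrite big_ord_recl unlift_none; congr (_ + _); apply: eq_bigr => i _.
  by rewrite liftK.
move=> [c ->]; rewrite big_ord_recl; exists (c ord0 *: g ord0), (\sum_(i < n) c (lift ord0 i) *: g (lift ord0 i)).
split=> //; first by exists (c ord0).
by apply/(IH (fun i => g (lift ord0 i))); exists (fun i => c (lift ord0 i)).
Qed.

Lemma fingenP : fingen V <-> exists n (g : 'I_n -> V), lspan g = sT.
Proof.
split=> [[n [g H]]|[n [g H]]]; exists n, g.
  by apply: smod_eq => // v _; apply/lspanP.
by move=> v; apply/lspanP; rewrite H.
Qed.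

Lemma noeth_lspan n (g : 'I_n -> V) : noeth (s0 : smod R^o) sT -> noeth s0 (lspan g).
Proof.
move=> nR; elim: n g => [|n IH] g; first by rewrite /lspan big_ord0; exact: noeth_refl.
rewrite /lspan big_ord_recl.
have -> : forall A B : smod V, sadd A B = sadd B A.
  by move=> A B; apply: smod_eq; apply: sadd_le.
apply: noeth_cat (IH (fun i => g (lift ord0 i))) _ => //.
exact: noeth_cyc.
Qed.

Lemma fingen_noeth : noetherian R -> fingen V -> noeth (s0 : smod V) sT.
Proof.
by move=> /noetherian_noeth nR /fingenP[n [g <-]]; exact: noeth_lspan.
Qed.
End Fingen.
End Bridge.

Local Open Scope quotient_scope.

(** * Lengths and homology of quotient types in terms of [smod] *)

Section Mlength.
Variables (R : comNzRingType) (V : lmodType R).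

Program Definition smod_sub (N : submodClosed V) : smod V := @Smod R V (fun v => v \in N) _ _.
Next Obligation. by move=> N; exact: rpred0. Qed.
Next Obligation. by move=> N a u v Nu Nv; apply: rpredD => //; apply: rpredZ. Qed.

Lemma sub_smod (A : smod V) : exists N : submodClosed V, smod_sub N = A.
Proof.
pose P := [pred v : V | `[< A v >]].
have PA : submod_closed P.
  split; first by apply/asboolP; exact: smem0.
  by move=> a u v /asboolP Au /asboolP Av; apply/asboolP; exact: smemP.
pose N : submodClosed V := HB.pack (P : V -> bool) (GRing.isSubmodClosed.Build R V P PA).
by exists N; apply: smod_eq => v /asboolP.
Qed.

Lemma psub_smod (M N : submodClosed V) :
  psub M N <-> smod_sub M <=s smod_sub N /\ ~ smod_sub N <=s smod_sub M.
Proof.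
split=> [[pq [v qv npv]]|[pq nqp]].
  by split=> [a /pq //|/(_ v qv)]; rewrite /= (negPf npv).
split=> [a pa|]; first exact: pq.
apply: contrapT => nex; apply: nqp => a qa; rewrite /=; apply: contrapT => npa.
by apply: nex; exists a => //; apply/negP.
Qed.

Lemma schainP k (A B : smod V) : A <=s B -> schain k A B <->
  exists X : nat -> smod V, [/\ A <=s X 0%N, X k = B &
    forall i, (i < k)%N -> X i <=s X i.+1 /\ ~ X i.+1 <=s X i].
Proof.
elim: k B => [|k IH] B AB /=.
  by split=> // _; exists (fun _ => B).
split.
  move=> [X [AX XB nBX]]; have /(IH _ (schain_le AX))[Y [AY YX HY]] := AX.
  exists (fun i => if (i <= k)%N then Y i else B); rewrite ltnn; split=> // i.
  rewrite ltnS => ik; rewrite ik; case: ltnP => ki; first exact: HY.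
  by have -> : i = k by [apply/eqP; rewrite eqn_leq ik ki]; rewrite YX.
move=> [X [AX XB HX]]; have [k1 k2] := HX k (leqnn _); rewrite XB in k1 k2.
have AXk : A <=s X k.
  elim: {IH k1 k2 XB} k HX => // k IHk HX; apply: sle_trans (IHk _) _.
    by move=> i ik; apply: HX; exact: ltnW.
  by case: (HX k (leqnSn _)).
exists (X k); split=> //; apply/(IH _ AXk); exists X; split=> // i ik.
by apply: HX; exact: ltnW.
Qed.

Lemma mlengthE : mlength V = len (s0 : smod V) sT.
Proof.
rewrite /mlength /len; congr xget; apply/seteqP.
have E k : submod_chain V k <-> schain k (s0 : smod V) sT.
  split.
    move=> [N HN]; apply: (@schain_up _ _ _ _ (smod_sub (N ord_max))) => //.
    apply/schainP => //; exists (fun i => smod_sub (N (inord i))); split=> //.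
      by congr (smod_sub (N _)); apply: val_inj; rewrite /= inordK.
    by move=> i ik; apply/psub_smod; apply: HN; rewrite !inordK //; lia.
  move=> /(schainP k (@sle_T _ _ _))[X [_ _ HX]].
  have /choice[N HN] i : exists N : submodClosed V, smod_sub N = X i := sub_smod (X i).
  exists (fun i => N i) => i j ij; apply/psub_smod; rewrite !HN.
  have M a b : (a < b)%N -> (b <= k)%N -> X a <=s X b /\ ~ X b <=s X a.
    elim: b => // b IH; rewrite ltnS leq_eqVlt => /orP[/eqP->|ab] bk; first exact: HX.
    have [h1 h2] := IH ab (ltnW bk); have [h3 h4] := HX b bk.
    split; first exact: sle_trans h1 h3.
    by move=> h5; apply: h2; exact: sle_trans h3 h5.
  by apply: M => //; rewrite -ltnS.
by split=> k [/E H1 H2]; split=> // j /E /H2.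
Qed.
End Mlength.

Definition lmap_of (R : comNzRingType) (V W : lmodType R) (f : {linear V -> W}) : lmap V W :=
  @Lmap R V W f (linearP f).

Section QuotLmap.
Variables (R : comNzRingType) (V : lmodType R) (N : submodClosed V).

Lemma quot_lmap_linear a u v :
  quotmod_pi N (a *: u + v) = a *: quotmod_pi N u + quotmod_pi N v.
Proof. by rewrite raddfD; congr (_ + _); exact/esym/quotmod_piZ. Qed.
Definition quot_lmap : lmap V (quotmod N) := @Lmap R V (quotmod N) _ quot_lmap_linear.

Lemma quot_lmap_ker v : quot_lmap v = 0 <-> v \in N.
Proof.
split=> [/eqP|Nv]; last apply/eqP; rewrite -[0](raddf0 (quotmod_pi N)).
all: rewrite -[_ == _]/(\pi_(Quotient.quot (zpred N)) v == \pi_(Quotient.quot (zpred N)) 0).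
all: by rewrite -Quotient.idealrBE subr0.
Qed.

Lemma quot_lmap_surj q : exists v, q = quot_lmap v.
Proof. by exists (repr q); rewrite /= quotmod_reprK. Qed.
End QuotLmap.

Lemma len_homology (R : comNzRingType) (A B C : lmodType R) (f : {linear A -> B})
    (g : {linear B -> C}) :
  len (s0 : smod (homology f g)) sT =
  len (scap (simg (lmap_of f) sT) (spre (lmap_of g) s0)) (spre (lmap_of g) s0).
Proof.
pose K : lmodType R := kermod g.
pose N : submodClosed K := @imp R A B C f g.
pose pi : lmap K (homology f g) := quot_lmap N.
pose vl : lmap K B := @Lmap R K B val (fun a u v => erefl).
pose I : smod K := smod_sub (@imp R A B C f g : submodClosed _).
have [_ <-] : (fin I sT <-> fin (s0 : smod (homology f g)) sT) /\
    len I sT = len (s0 : smod (homology f g)) sT.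
  apply: (@isom_gen _ _ _ pi sT) => //.
  - by move=> q _; apply: sadd_r; have [v ->] := quot_lmap_surj q; exists v.
  - apply: smod_eq => z; last by case=> _ /(quot_lmap_ker N z).
    by move=> Iz; split=> //; apply/(quot_lmap_ker N z).
  by apply: smod_eq.
set Y := spre _ _; set X := scap _ _.
suff [_ ->] : (fin I sT <-> fin X Y) /\ len I sT = len X Y by [].
apply: (@isom_gen _ _ _ vl sT) => //.
- by move=> v [].
- move=> v gv; apply: sadd_r.
  have kv : v \in kerp g by rewrite inE; apply/eqP.
  by exists (exist _ v kv).
- apply: smod_eq => z.
    move=> /asboolP[a fa]; split=> //; split; first by exists a.
    by apply/eqP; have := valP z; rewrite inE.
  by case=> _ [[a _ E] _]; apply/asboolP; exists a.
by apply: smod_eq => // z _; split=> //=; apply/eqP; have := valP z; rewrite inE.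
Qed.

(** * Coordinates on the Koszul complex *)

Section Coords.
Variables (R : comNzRingType) (V : lmodType R).

(** Coefficient on the exterior monomial of all n with [b n]. Bits from [k] on are ignored, which
    keeps the index type independent of [k]. *)
Fixpoint kcoef k : KT V k -> (nat -> bool) -> V :=
  if k is k'.+1 then fun w b => kcoef (if b 0%N then w.2 else w.1) (fun n => b n.+1)
  else fun w _ => w.

Definition bcount k (b : nat -> bool) : nat := \sum_(t < k) b t.

Lemma cntS k b : bcount k.+1 b = (b 0%N + bcount k (fun n => b n.+1))%N.
Proof. by rewrite /bcount big_ord_recl. Qed.

Lemma kcP k (w w' : KT V k) a b : kcoef (a *: w + w') b = a *: kcoef w b + kcoef w' b.
Proof.
elim: k w w' b => [|k IH] // w w' b /=.
by rewrite -IH; congr kcoef; case: (b 0%N).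
Qed.

Lemma kcoef_0 k b : kcoef (0 : KT V k) b = 0.
Proof. by have := kcP (0 : KT V k) 0 (-1) b; rewrite scaler0 addr0 scaleN1r addNr. Qed.
Lemma kcD k (w w' : KT V k) b : kcoef (w + w') b = kcoef w b + kcoef w' b.
Proof. by have := kcP w w' 1 b; rewrite !scale1r. Qed.
Lemma kcZ k (w : KT V k) a b : kcoef (a *: w) b = a *: kcoef w b.
Proof. by have := kcP w 0 a b; rewrite kcoef_0 !addr0. Qed.
Lemma kcN k (w : KT V k) b : kcoef (- w) b = - kcoef w b.
Proof. by rewrite -scaleN1r kcZ scaleN1r. Qed.

Lemma kcoef_ext k (w w' : KT V k) : (forall b, kcoef w b = kcoef w' b) -> w = w'.
Proof.
elim: k w w' => [|k IH] w w' H; first exact: (H xpred0).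
case: w w' H => w1 w2 [w1' w2'] H; congr pair; apply: IH => b.
  exact: (H (fun n => if n is n'.+1 then b n' else false)).
exact: (H (fun n => if n is n'.+1 then b n' else true)).
Qed.

Lemma kcoef_G k A i (w : KT V k) : KG k A i w <->
  forall b, if bcount k b == i then A (kcoef w b) else kcoef w b = 0.
Proof.
elim: k i w => [|k IH] i w.
  rewrite /bcount; split=> [|/(_ xpred0)].
    by case: i => [|i] H b; rewrite big_ord0.
  by rewrite big_ord0; case: i.
case: w => w1 w2; split.
  move=> [/= /IH H1 H2] b; rewrite cntS; case: (b 0%N) => /=; last exact: H1.
  case: i {H1} H2 => [|i] /=; last by move=> /IH H2; rewrite add1n eqSS; exact: H2.
  by move=> ->; rewrite kcoef_0.
move=> H; split=> /=.
  apply/IH => b; have := H (fun n => if n is n'.+1 then b n' else false).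
  by rewrite cntS.
case: i H => [|i] H /=.
  apply: kcoef_ext => b; have := H (fun n => if n is n'.+1 then b n' else true).
  by rewrite cntS /= kcoef_0.
apply/IH => b; have := H (fun n => if n is n'.+1 then b n' else true).
by rewrite cntS /= add1n eqSS.
Qed.

(** The minus sign in [coneD] is picked up once for each bit set before [j]; this produces the sign
    of the explicit formula. *)
Lemma kcoef_D k x (w : KT V k) b : kcoef (KD V k x w) b =
  \sum_(j < k | ~~ b j) ((-1) ^+ bcount j b * x`_j) *: kcoef w (fun n => (n == j :> nat) || b n).
Proof.
elim: k x w b => [|k IH] x w b; first by rewrite big_ord0.
rewrite big_mkcond big_ord_recl /=.
have E (u : KT V k) : \sum_(i < k) (if ~~ b (bump 0 i) then ((-1) ^+ bcount (bump 0 i) b * x`_(bump 0 i)) *: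
   kcoef u (fun n => (n.+1 == bump 0 i) || b n.+1) else 0) = (-1) ^+ b 0%N *: kcoef (KD V k (behead x) u) (fun n => b n.+1).
  rewrite IH [in RHS]big_mkcond scaler_sumr; apply: eq_bigr => j _ /=.
  rewrite /bump /= add1n; case: ifP => _; last by rewrite scaler0.
  by rewrite scalerA mulrA -exprD -cntS nth_behead.
have Ek (b' : nat -> bool) : (fun n => (n.+1 == 0%N :> nat) || b' n.+1) = (fun n => b' n.+1) by [].
case: (boolP (b 0%N)) => b0 /=; rewrite ?add0r.
  have := E w.2; rewrite b0 expr1 scaleN1r -kcN => <-.
  by apply: eq_bigr => j _; rewrite ?b0 ?orbT.
have := E w.1; rewrite (negPf b0) expr0 scale1r kcD kcZ addrC => <-.
by rewrite /bcount big_ord0 expr0 mul1r nth0.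
Qed.

Fixpoint kbuild k : ((nat -> bool) -> V) -> KT V k :=
  if k is k'.+1 then fun phi =>
    (kbuild k' (fun b => phi (fun n => if n is n'.+1 then b n' else false)),
     kbuild k' (fun b => phi (fun n => if n is n'.+1 then b n' else true)))
  else fun phi => phi xpred0.

Lemma kcoef_kbuild k phi b : kcoef (kbuild k phi) b = phi (fun n => (n < k)%N && b n).
Proof.
elim: k phi b => [|k IH] phi b //=.
by case: (boolP (b 0%N)) => b0; rewrite IH; congr phi; apply: funext => -[|n];
  rewrite //= ?b0 // (negPf b0).
Qed.

Lemma KG0 k i : KG k (s0 : smod V) i = s0.
Proof.
apply: smod_eq => // w /kcoef_G H; apply: kcoef_ext => b; rewrite kcoef_0.
by have := H b; case: eqP.
Qed.
End Coords.

Section Compare.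
Variables (R : comNzRingType) (d : nat) (x : 'I_d -> R) (M : lmodType R).

Definition xs : seq R := [seq x i | i <- enum 'I_d].

Lemma size_xs : size xs = d.
Proof. by rewrite size_map size_enum_ord. Qed.
Lemma nth_xs (j : 'I_d) : xs`_j = x j.
Proof. by rewrite (nth_map j) ?size_enum_ord // nth_ord_enum. Qed.

Definition bset (S : {set 'I_d}) (n : nat) : bool := oapp (fun i : 'I_d => i \in S) false (insub n).

Lemma bsetE S (j : 'I_d) : bset S j = (j \in S).
Proof. by rewrite /bset valK. Qed.
Lemma bset_big S n : (d <= n)%N -> bset S n = false.
Proof. by move=> dn; rewrite /bset insubN // -leqNgt. Qed.
Lemma bsetU S (j : 'I_d) : bset (j |: S) = (fun n => (n == j :> nat) || bset S n).
Proof.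
apply: funext => n; case: (ltnP n d) => nd; last first.
  rewrite !bset_big // orbF; apply/esym/eqP => E.
  by have := ltn_ord j; rewrite -E ltnNge nd.
by rewrite -[n]/(val (Ordinal nd)) !bsetE !inE.
Qed.
Lemma bcount_bset S (j : 'I_d.+1) : bcount j (bset S) = #|[set t in S | (t < j)%N]|.
Proof.
rewrite /bcount -sum1_card (big_ord_widen d (fun t => nat_of_bool (bset S t))) //.
  rewrite [LHS]big_mkcond [RHS]big_mkcond; apply: eq_bigr => i _; rewrite bsetE inE.
  by case: (i \in S) (i < j)%N => [] [].
by rewrite -ltnS.
Qed.
Lemma bcount_card S : bcount d (bset S) = #|S|.
Proof.
rewrite -[in LHS](_ : @ord_max d = d :> nat) // bcount_bset; congr #|pred_of_set _|.
by apply/setP => t; rewrite inE ltn_ord andbT.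
Qed.
Lemma bset_of (b : nat -> bool) : (fun n => (n < d)%N && b n) = bset [set j : 'I_d | b j].
Proof.
apply: funext => n; case: (ltnP n d) => nd; last by rewrite bset_big.
by rewrite -[n]/(val (Ordinal nd)) bsetE inE.
Qed.
Lemma kcoef_bset (w : KT M d) b : kcoef w b = kcoef w (bset [set j : 'I_d | b j]).
Proof.
suff H k (u : KT M k) : forall b b', (forall n, (n < k)%N -> b n = b' n) -> kcoef u b = kcoef u b'.
  by apply: H => n nd; rewrite -bset_of nd.
elim: k u => [|k IH] u b1 b2 E //=; rewrite E //.
by apply: IH => n nk; apply: E.
Qed.

(** Only coordinates of degree [i] are read, so this is an isomorphism on [KG d sT i] alone; hence
    the membership hypotheses in the lemmas about it. *)
Program Definition kmp i : lmap (KT M d) (koszul d M i) :=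
  @Lmap R (KT M d) (koszul d M i) (fun w => [ffun S : isubset d i => kcoef w (bset (val S))]) _.
Next Obligation. by move=> i a u v; apply/ffunP => S; rewrite !ffunE kcP. Qed.

Lemma kcoord_kmp i w S : KG d (sT : smod M) i w -> kcoord (kmp i w) S = kcoef w (bset S).
Proof.
move=> /kcoef_G /(_ (bset S)); rewrite bcount_card /kcoord; case: insubP => [T iT <-|/negPf ->] /=.
  by rewrite ffunE.
by move->.
Qed.

Lemma kmp_D i w : KG d (sT : smod M) i w ->
  kmp i.-1 (KD M d xs w) = kdiff x (kmp i w).
Proof.
move=> Gw; apply/ffunP => T; rewrite !ffunE kcoef_D.
apply: eq_big => j; first by rewrite bsetE.
by move=> jT; rewrite kcoord_kmp // bsetU nth_xs (bcount_bset _ (widen_ord (leqnSn d) j)).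
Qed.

Lemma kmp_inj i w : KG d (sT : smod M) i w -> kmp i w = 0 -> w = 0.
Proof.
move=> Gw E; apply: kcoef_ext => b; rewrite kcoef_bset kcoef_0.
rewrite -(kcoord_kmp _ Gw) E /kcoord; by case: insub => //= S; rewrite ffunE.
Qed.

Lemma kmp_surj i y : exists2 w, KG d (sT : smod M) i w & kmp i w = y.
Proof.
exists (kbuild d (fun b => kcoord y [set j : 'I_d | b j])).
  apply/kcoef_G => b; case: eqP => // nb; rewrite kcoef_kbuild.
  have -> : [set j : 'I_d | (j < d)%N && b j] = [set j : 'I_d | b j].
    by apply/setP => j; rewrite !inE ltn_ord.
  rewrite /kcoord insubN //; apply/eqP => E; apply: nb.
  have <- : bcount d (bset [set j : 'I_d | b j]) = bcount d b.
    by apply: eq_bigr => j _; rewrite bsetE inE.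
  by rewrite bcount_card.
apply/ffunP => S; rewrite ffunE kcoef_kbuild.
have -> : [set j : 'I_d | (j < d)%N && bset (val S) j] = val S.
  by apply/setP => j; rewrite inE ltn_ord bsetE.
by rewrite /kcoord valK.
Qed.

Lemma lengthH_klen i : lengthH x M i = klen xs (s0 : smod M) sT i.
Proof.
rewrite /lengthH mlengthE len_homology /klen /khlen size_xs.
set Y := spre _ _; set X := scap _ _.
have DD (w : KT M d) : KD M d xs (KD M d xs w) = 0 by exact: KDD.
(* For i = 0 the index [i.-1] is again 0, but there the degree shift already forces [w = 0]. *)
have sh_inj w : shiftg (KG d (sT : smod M)) i w -> kmp i.-1 w = 0 -> w = 0.
  by case: i {X Y} => [|i] //=; exact: kmp_inj.
have kerE w : KG d (sT : smod M) i w -> kdiff x (kmp i w) = 0 <-> KD M d xs w = 0.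
  move=> Gw; rewrite -kmp_D //; split=> [|->]; last exact: lmap0.
  apply: sh_inj; exact: (@KG_sub _ M d xs sT i w Gw).
have [] // : (fin (chbounds (KD M d xs) (KG d s0) (KG d sT) i) (chcycles (KD M d xs) (KG d s0) (KG d sT) i)
  <-> fin X Y) /\ hlen (KD M d xs) (KG d s0) (KG d (sT : smod M)) i = len X Y.
apply: (@isom_gen _ _ _ (kmp i) (KG d sT i)).
- by move=> v [].
- by move=> y _; apply: sadd_r; have [w Gw <-] := kmp_surj y; exists w.
- apply: smod_eq => w.
    move=> [_ [n [[u Gu ->] + ->]]]; rewrite KG0 => ->; rewrite addr0.
    have G1 := @KG_sub _ M d xs sT i.+1 u Gu.
    split=> //; split; last by apply/(kerE _ G1); exact: DD.
    by exists (kmp i.+1 u) => //; rewrite -[i]/(i.+1.-1) kmp_D.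
  move=> [Gw [[y _ Ey] _]]; have [u Gu Eu] := kmp_surj y.
  have G1 := @KG_sub _ M d xs sT i.+1 u Gu.
  exists (KD M d xs u), 0; split; [by exists u|exact: smem0|].
  rewrite addr0; apply/eqP; rewrite -subr_eq0; apply/eqP; apply: (@kmp_inj i).
    exact: smemB.
  by rewrite lmapB Ey -Eu; apply/eqP; rewrite subr_eq0; apply/eqP/esym; exact: (kmp_D Gu).
apply: smod_eq => w.
  move=> [Gw Dw]; split=> //; apply/(kerE w Gw).
  by case: i Dw {X Y sh_inj kerE Gw} => [|i] //=; rewrite KG0.
move=> [Gw /(kerE w Gw) Dw]; split=> //=; rewrite Dw; exact: smem0.
Qed.

Lemma chi1_pchi1 : Defs.chi1 x M = pchi1 xs (s0 : smod M) sT.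
Proof.
rewrite /Defs.chi1 /pchi1 /chi size_xs big_ord_recl expr0 mul1r opprD addNKr.
rewrite big_add1 big_mkord -sumrN; apply: eq_bigr => i _.
by rewrite lengthH_klen lift0 exprS /=; ring.
Qed.
End Compare.

Lemma islen_simple (R : comNzRingType) (V : lmodType R) (A B : smod V) :
  A <=s B -> ~ B <=s A ->
  (forall X, A <=s X -> X <=s B -> X <=s A \/ B <=s X) -> islen A B 1.
Proof.
move=> AB nBA H; split; first by exists A; split.
move=> [|[|k]] //= [X [[Y [/schain_le AY YX nXY]] XB nBX]]; exfalso.
case: (H X _ XB) => //; first exact: sle_trans AY YX.
by move=> XA; apply: nXY; exact: sle_trans XA AY.
Qed.

(** * Localization at a minimal prime *)

Section Localize.
Variables (R : comNzRingType) (p : prime_idealr R).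
Hypothesis pmin : minimal_prime p.

Lemma min_prime_eq (q : smod R^o) : sprime q -> q <=s psm p -> q = psm p.
Proof.
move=> pq qp; have [q' E] := prime_idealr_of pq; rewrite -E in qp *.
have H := pmin (q := q') (fun a => qp a).
by apply: smod_eq => // a; rewrite /= -H.
Qed.

Section Mod.
Variable M : lmodType R.
Local Notation LM := (loc p M : lmodType (locR p)).

Lemma frac_scale (a : R) (s : denom p) (v : M) (t : denom p) :
  (frac (a : R^o) s : locR p) *: (frac v t : LM) = frac (a *: v) (denomM s t).
Proof. exact: loc_scaleE. Qed.

Lemma frac_mul (e : denom p) (v : M) t : frac (dval e *: v) (denomM e t) = frac v t :> LM.
Proof.
apply/fracE; exists (denom1 p); rewrite !denomE !scalerA.
by congr (_ *: _); ring.
Qed.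

Program Definition locS (A : smod M) : smod LM :=
  @Smod (locR p) LM (fun x => exists v s, A v /\ x = frac v s) _ _.
Next Obligation. by move=> A; exists 0, (denom1 p); split=> //; exact: smem0. Qed.
Next Obligation.
move=> A a x y [v [s [Av ->]]] [w [t [Aw ->]]]; have [c [e ->]] := fracP a.
rewrite frac_scale fracD; do 2!eexists; split; last by [].
by apply: smemD; do ?apply: smemZ.
Qed.

Lemma locS_le A B : A <=s B -> locS A <=s locS B.
Proof. by move=> AB _ [v [s [Av ->]]]; exists v, s; split=> //; exact: AB. Qed.

Lemma locS_frac (A : smod M) v s : locS A (frac v s) -> exists e : denom p, A (dval e *: v).
Proof.
move=> [w [t [Aw /fracE[e E]]]]; exists (denomM e t).
by rewrite denomE -scalerA E; do 2!apply: smemZ.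
Qed.

(** The factor is R/q. If q differs from the minimal prime [p], it contains an element outside [p],
    and the localization is zero; if q = p, the localization is the residue field of R_p. *)
Lemma locS_step (A : smod M) u : sprime (colon A u) ->
  fin (locS A) (locS (sadd A (cyc u))) /\
  len (locS A) (locS (sadd A (cyc u))) = `[< colon A u = psm p >].
Proof.
move=> pu; case: (asboolP (colon A u = psm p)) => [E|nE]; last first.
  have [e eA ep] : exists2 e, colon A u e & ~ psm p e.
    apply: contrapT => nex; apply: nE; apply: min_prime_eq => // e eA.
    by apply: contrapT => nep; apply: nex; exists e.
  have ep' : e \notin p by apply/negP.
  have -> : locS (sadd A (cyc u)) = locS A; last exact: fin_refl.
  apply: smod_eq; last exact: locS_le.
  move=> _ [_ [t [[w [_ [Aw [c _ ->] ->]]] ->]]].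
  rewrite -(frac_mul (exist _ e ep')); do 2!eexists; split; last by [].
  rewrite /dval /= scalerDr; apply: smemD; first exact: smemZ.
  by rewrite scalerA mulrC -scalerA; apply: smemZ.
suff H : islen (locS A) (locS (sadd A (cyc u))) 1 by split; [exists 1%N|exact: lenE].
have nu (c : R) (e : denom p) : A (dval e *: (c *: u)) -> psm p c.
  move=> H; have : colon A u (dval e * c) by rewrite /= -scalerA.
  by rewrite E /= prime_idealrM (negPf (valP e)).
apply: islen_simple; first exact: locS_le.
  move=> H; have /H /locS_frac [e] : locS (sadd A (cyc u)) (frac u (denom1 p)).
    by exists u, (denom1 p); split=> //; apply: sadd_r; exact: cycP.
  by rewrite -[u]scale1r => /nu; rewrite /= idealr1.
move=> X AX XB; case: (pselect (X <=s locS A)) => nXA; [by left|right].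
have [x Xx nAx] : exists2 x, X x & ~ locS A x.
  apply: contrapT => nex; apply: nXA => x Xx; apply: contrapT => nAx.
  by apply: nex; exists x.
have [_ [t [[w [_ [Aw [c0 _ ->] ->]]] Ex]]] := XB _ Xx; pose c : R := c0.
have nc : c \notin p.
  apply/negP => pc; apply: nAx; rewrite Ex; do 2!eexists; split; last by [].
  by apply: smemD => //; have : colon A u c by rewrite E.
(* The numerator of [x] is [w + c *: u] with [c] outside [p]; removing the part in [A] and dividing
   by [c] gives every fraction of [u]. *)
have Xu : forall e, X (frac u e : LM).
  move=> e.
  have Xcu : X (frac (dval t *: (c *: u)) (denomM t t) : LM).
    have -> : frac (dval t *: (c *: u)) (denomM t t) = x - frac w t :> LM.
      rewrite Ex -[- frac w t]/(loc_opp _) loc_oppE fracD -scalerDr.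
      by congr (frac (_ *: _) _); rewrite addrAC subrr add0r.
    apply: smemB => //; apply: AX; by exists w, t.
  have -> : frac u e = (frac (dval t * dval t : R^o) (denomM (denomM (exist _ c nc) t) e) : locR p) *:
      (frac (dval t *: (c *: u)) (denomM t t) : LM).
    rewrite frac_scale; apply/fracE; exists (denom1 p).
    by rewrite !denomE !scalerA; congr (_ *: _); rewrite /dval /=; ring.
  exact: smemZ.
move=> _ [_ [e [[w' [_ [Aw' [a _ ->] ->]]] ->]]].
pose a' : R := a; have -> : frac (w' + lact u a) e =
   frac w' e + (frac (a' : R^o) (denom1 p) : locR p) *: (frac u e : LM) :> LM.
  rewrite frac_scale fracD; apply/fracE; exists (denom1 p).
  by rewrite !denomE !mul1r !scale1r -scalerDr scalerA.
apply: smemD; last exact: smemZ.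
by apply: AX; exists w', e.
Qed.

Definition ncount (q : smod R^o) s : nat := \sum_(q' <- s) `[< q' = q >].

Lemma locS_pfil (A B : smod M) s : pfil A B s ->
  fin (locS A) (locS B) /\ len (locS A) (locS B) = ncount (psm p) s.
Proof.
elim=> [{}A|{}A {}B u {}s pu H [f E]].
  by rewrite /ncount big_nil; exact: fin_refl.
have [f1 E1] := locS_step pu.
have [F L] := len_add (locS_le (@sadd_l _ _ A (cyc u))) (locS_le (pfil_le H)).
by split; [apply/F|rewrite L ?E1 ?E /ncount ?big_cons //; apply/F].
Qed.

Lemma mlength_loc s : pfil (s0 : smod M) sT s -> mlength LM = ncount (psm p) s.
Proof.
move=> /locS_pfil[_ <-]; rewrite mlengthE; congr len.
  apply: smod_eq => // _ [_ [t [-> ->]]]; apply/fracE.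
  by exists (denom1 p); rewrite !scaler0.
by apply: smod_eq => // x _; have [v [t ->]] := fracP x; exists v, t.
Qed.
End Mod.

Lemma mlength_locR : mlength ((locR p)^o : lmodType (locR p)) =
  mlength (loc p (R^o : lmodType R) : lmodType (locR p)).
Proof.
rewrite !mlengthE; pose V := loc p (R^o : lmodType R) : lmodType (locR p).
pose W := (locR p)^o : lmodType (locR p).
pose f : lmap V W := @Lmap (locR p) V W id (fun a u v => erefl).
have [||||_ ->] // := @isom_gen _ _ _ f sT s0 sT s0 sT.
- by move=> w _; apply: sadd_r; exists w.
- by apply: smod_eq => // v [].
by apply: smod_eq.
Qed.
End Localize.

(** * Minimal generators *)

Section IdealQuot.
Variables (R : comNzRingType) (m : idealr R).
Local Notation S := {ideal_quot m}.

Lemma piS_eq (a b : R) : (\pi_(S) a = \pi_(S) b) <-> a - b \in m.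
Proof.
split=> [E|ab]; first by rewrite Quotient.idealrBE E.
by apply/eqP; rewrite -Quotient.idealrBE.
Qed.

Lemma repr_piS (a : R) : repr (\pi_(S) a) - a \in m.
Proof. by apply/piS_eq; rewrite reprK. Qed.

Section Killed.
Variables (M : lmodType R) (N : submodClosed M).
Hypothesis mN : forall a (v : M), a \in m -> a *: v \in N.

(* The quotient M / N with its structure of module over R / m. *)
Definition killed := let _ := mN in quotmod N.
HB.instance Definition _ := GRing.Zmodule.on killed.

Lemma killed_eq (a b : R) (q : quotmod N) : a - b \in m -> a *: q = b *: q.
Proof.
move=> ab; apply/eqP; rewrite -subr_eq0 -scalerBl; apply/eqP.
have [v ->] := quot_lmap_surj q; rewrite -lmapZ; apply/quot_lmap_ker; exact: mN.
Qed.

Definition killed_scale (s : S) (q : killed) : killed := (repr s : R) *: (q : quotmod N).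

Lemma killed_piE (a : R) (q : killed) : killed_scale (\pi_(S) a) q = a *: (q : quotmod N).
Proof. exact/killed_eq/repr_piS. Qed.

Fact killed_scaleA a b q : killed_scale a (killed_scale b q) = killed_scale (a * b) q.
Proof.
rewrite -[a]reprK -[b]reprK !killed_piE [X in killed_scale X](_ : _ = \pi_(S) (repr a * repr b)).
  by rewrite killed_piE scalerA.
by rewrite rmorphM.
Qed.
Fact killed_scale1 : left_id 1 killed_scale.
Proof.
by move=> q; rewrite -[1](rmorph1 (\pi_(S))) killed_piE scale1r.
Qed.
Fact killed_scaleDr : right_distributive killed_scale +%R.
Proof. by move=> a u v; exact: scalerDr. Qed.
Fact killed_scaleDl q : {morph killed_scale^~ q : a b / a + b}.
Proof.
move=> a b; rewrite -[a]reprK -[b]reprK -rmorphD !killed_piE.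
exact: scalerDl.
Qed.
HB.instance Definition _ := GRing.Zmodule_isLmodule.Build S killed
  killed_scaleA killed_scale1 killed_scaleDr killed_scaleDl.

Definition killed_pi (v : M) : killed := quotmod_pi N v.
Local Notation phi := (fglift killed_pi).

Lemma fglift_lin (a : S) (u v : {freeg M / S}) : phi (a *: u + v) = a *: phi u + phi v.
Proof.
have phiB := lift_is_additive killed_pi.
pose phiA : {additive {freeg M / S} -> killed} := HB.pack (fglift killed_pi)
  (GRing.isZmodMorphism.Build _ _ (fglift killed_pi) phiB).
rewrite -[phi]/(phiA : _ -> _) raddfD; congr (_ + _).
rewrite -[a *: u]/(fgscale a u) /fgscale raddf_sum -[in RHS](freeg_sumE u) raddf_sum.
rewrite scaler_sumr; apply: eq_bigr => x _.
by rewrite /= !liftU scalerA.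
Qed.

Definition phi_ker : {pred {freeg M / S}} := [pred z | phi z == 0].
Lemma phi_ker_submod : submod_closed phi_ker.
Proof.
have phi0 : phi 0 = 0.
  by have := fglift_lin (-1) 0 0; rewrite !scaleN1r oppr0 addr0 addNr.
split=> [|a u v]; first by rewrite inE phi0.
by rewrite !inE fglift_lin => /eqP-> /eqP->; rewrite scaler0 addr0.
Qed.
HB.instance Definition _ := GRing.isSubmodClosed.Build S _ phi_ker phi_ker_submod.

(** Hence the free module maps to M/N through the tensor product; for N = mM this bounds the kernel
    of v |-> 1 ⊗ v from above. *)
Lemma span_phi z : z \in span (@tensor_rel R m M) -> phi z = 0.
Proof.
move=> /asboolP /(_ (phi_ker : submodClosed _)) H; apply/eqP; apply: H => {}z.
have phiB u v : phi (u - v) = phi u - phi v by exact: (lift_is_additive killed_pi).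
case=> [[u [v ->]]|[a [v ->]]]; rewrite inE; apply/eqP.
  rewrite !phiB !liftU !scale1r -addrA -opprD; apply/eqP; rewrite subr_eq0; apply/eqP.
  exact: (lmapD (quot_lmap N)).
rewrite phiB -[X in _ - phi X]addr0 fglift_lin.
have -> : phi 0 = 0 by have := phiB 0 0; rewrite !subrr.
rewrite !liftU !scale1r addr0; apply/eqP; rewrite subr_eq0; apply/eqP.
rewrite -[RHS]/(killed_scale _ _) killed_piE; exact: (lmapZ (quot_lmap N)).
Qed.
End Killed.
End IdealQuot.

Section Nu.
Variables (R : comNzRingType) (m : idealr R) (M : lmodType R).
Hypothesis lR : local_ring m.
Local Notation S := {ideal_quot m}.
Local Notation bc := (base_change m M).

(** The submodule mM, taken as an intersection so that no finite sums have to be handled. *)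
Program Definition mM : smod M := @Smod R M
  (fun v => forall A : smod M, (forall a u, a \in m -> A (a *: u)) -> A v) _ _.
Next Obligation. by move=> A _; exact: smem0. Qed.
Next Obligation. by move=> a u v Hu Hv A HA; apply: smemP; [exact: Hu|exact: Hv]. Qed.

Lemma mM_mem a u : a \in m -> mM (a *: u).
Proof. by move=> ma A; apply. Qed.

Definition tq : lmap {freeg M / S} bc := quot_lmap (span (@tensor_rel R m M)).
Definition tens (v : M) : bc := tq << v >>.

Lemma tq_rel z : tensor_rel z -> tq z = 0.
Proof. by move=> Hz; apply/quot_lmap_ker; apply/asboolP => N HN; apply: HN. Qed.

Lemma tensD u v : tens (u + v) = tens u + tens v.
Proof.
have := tq_rel (or_introl (ex_intro _ u (ex_intro _ v erefl))).
rewrite !lmapB => /eqP; rewrite -addrA -opprD subr_eq0 => /eqP; exact.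
Qed.

Lemma tensZ a v : tens (a *: v) = (\pi_(S) a : S) *: tens v.
Proof.
have := tq_rel (or_intror (ex_intro _ a (ex_intro _ v erefl))).
by rewrite lmapB lmapZ => /eqP; rewrite subr_eq0 => /eqP.
Qed.

Lemma tens0 : tens 0 = 0.
Proof. by have := tensD 0 0; rewrite addr0 => /eqP; rewrite -subr_eq subrr eq_sym => /eqP. Qed.

Lemma tens_sum n (F : 'I_n -> M) : tens (\sum_i F i) = \sum_i tens (F i).
Proof. exact: (big_morph tens tensD tens0). Qed.

Lemma tens_ker v : tens v = 0 <-> mM v.
Proof.
split; last first.
  move=> /(_ (@Smod R M (fun v => tens v = 0) tens0
    (fun a u v Hu Hv => etrans (tensD _ _) (etrans (f_equal2 +%R (etrans (tensZ a u)
      (etrans (f_equal _ Hu) (scaler0 _ _))) Hv) (addr0 0))))); apply => a u ma /=.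
  by rewrite tensZ (_ : \pi_(S) a = 0) ?scale0r // -(rmorph0 (\pi_(S))); apply/piS_eq; rewrite subr0.
have [N NE] := sub_smod mM.
have mN a u : a \in m -> a *: u \in N.
  by move=> ma; have : mM (a *: u) := mM_mem u ma; rewrite -NE.
move=> /(quot_lmap_ker (span (@tensor_rel R m M)) <<v>>) /(span_phi mN).
rewrite liftU scale1r => /(quot_lmap_ker N v); by rewrite -NE.
Qed.

Lemma tens_surj (q : bc) : exists v, q = tens v.
Proof.
have [z ->] := quot_lmap_surj q; rewrite -[quot_lmap _]/tq -(freeg_sumE z).
elim: (dom (z : {freeg M / S})) => [|v s [w IH]]; first by exists 0; rewrite big_nil tens0 lmap0.
exists (repr (coeff v z) *: v + w); rewrite big_cons lmapD IH tensD tensZ reprK; congr (_ + _).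
rewrite /tens -lmapZ; congr (tq _).
by apply/eqP/freeg_eqP => x; rewrite coeffZ !coeffU mul1r.
Qed.

Lemma local_unit (c : R) : c \notin m -> exists e, e * c = 1.
Proof.
move=> nc; apply: contrapT => nex; move/negP: nc; apply.
apply: (@local_max _ _ lR (cyc (c : R^o))); last exact: cycP.
by move=> [e _ E]; apply: nex; exists e.
Qed.

Lemma nakayama k (N : smod M) (g : 'I_k -> M) : sadd N (lspan g) = sT ->
  sT <=s sadd N mM -> N = sT.
Proof.
elim: k g => [|k IH] g Eg HN.
  rewrite -Eg /lspan big_ord0; apply: smod_eq; first exact: sadd_l.
  by apply: sadd_le.
pose W := lspan (fun i => g (lift ord0 i)); suff Hg : sadd N W = sT by exact: IH _ Hg HN.
pose g0 := g ord0.
have E : sadd N (sadd (cyc g0) W) = sT by rewrite -Eg /lspan big_ord_recl.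
suff Hg0 : sadd N W g0.
  apply: smod_eq => // v _; have : sadd N (sadd (cyc g0) W) v by rewrite E.
  have le2 : sadd N (sadd (cyc g0) W) <=s sadd N W.
    apply: sadd_le => //; apply: sadd_le; last exact: sadd_r.
    exact: cyc_le.
  exact: le2.
pose mg : smod M := simg (lact g0) (smod_of m).
have [n [w [Nn mw Ew]]] := HN g0 I.
have : sadd (sadd N W) mg w.
  apply: mw => a u ma; have : sadd N (sadd (cyc g0) W) u by rewrite E.
  move=> [n' [_ [Nn' [_ [w' [[c _ ->] Ww' ->]] ->]]]].
  rewrite !scalerDr addrCA addrC; exists (a *: n' + a *: w'), (a *: (c *: g0)).
  split=> //; first by exists (a *: n'), (a *: w'); split=> //; exact: smemZ.
  by exists (a * c : R); rewrite /= ?scalerA //; exact: (@smemMr _ (smod_of m)).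
move=> [s [_ [Ns [b mb ->] E2]]].
have H1 : sadd N W ((1 - b : R) *: g0).
  have -> : (1 - b : R) *: g0 = n + s.
    by rewrite scalerBl scale1r {1}Ew E2 addrA addrK.
  by apply: smemD => //; exact: sadd_l.
have [|e Ee] := @local_unit (1 - b).
  apply/negP => m1b; have : smod_of m (1 : R).
    by rewrite -[1](subrK (b : R)); apply: (@smemD _ _ (smod_of m)).
  by rewrite /= idealr1.
by rewrite -[g0]scale1r -Ee -scalerA; exact: smemZ.
Qed.

Section Basis.
Variable n : nat.
Hypothesis axn : Vector.axiom n bc.

Lemma axiom_gen : fingen M -> exists g : 'I_n -> M, lspan g = sT.
Proof.
case: axn => f fl [fi fK iK] /fingenP[k [g0 Eg0]].
have /choice[u uE] (i : 'I_n) : exists u : M, fi (delta_mx 0 i) = tens u := tens_surj _.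
exists u; apply: (@nakayama k _ g0).
  by apply: smod_eq => // v _; apply: sadd_r; rewrite Eg0.
move=> v _; pose c i : R := repr (f (tens v) 0 i).
have F0 : f 0 = 0 by have := fl (-1) 0 0; rewrite !scaleN1r oppr0 addr0 addNr.
have FD p q : f (p + q) = f p + f q by have := fl 1 p q; rewrite !scale1r.
have FZ a p : f (a *: p) = a *: f p by have := fl a p 0; rewrite F0 !addr0.
have Fsum (F : 'I_n -> bc) : f (\sum_i F i) = \sum_i f (F i).
  exact: (big_morph f FD F0).
exists (\sum_i c i *: u i), (v - \sum_i c i *: u i); split.
- by apply/lspanP; exists c.
- apply/tens_ker; apply: (can_inj fK); rewrite F0.
  have -> : v - \sum_i c i *: u i = v + (-1 : R) *: (\sum_i c i *: u i) by rewrite scaleN1r.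
  rewrite tensD tensZ FD FZ tens_sum Fsum.
  rewrite (eq_bigr (fun i => f (tens v) 0 i *: delta_mx 0 i)); last first.
    by move=> i _; rewrite tensZ FZ -uE iK /c reprK.
  rewrite -row_sum_delta rmorphN1 scaleN1r subrr //.
by rewrite addrC subrK.
Qed.

(** The coordinate flag of K ⊗ M, pulled back to M; it bounds the dimension by the length of
    M/mM. *)
Lemma axiom_schain : schain n mM sT.
Proof.
case: axn => f fl [fi fK iK].
have F0 : f 0 = 0 by have := fl (-1) 0 0; rewrite !scaleN1r oppr0 addr0 addNr.
have X0 j : forall i : 'I_n, (j <= i)%N -> f (tens 0) 0 i = 0.
  by move=> i _; rewrite tens0 F0 mxE.
have XP j a u v : (forall i : 'I_n, (j <= i)%N -> f (tens u) 0 i = 0) ->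
   (forall i : 'I_n, (j <= i)%N -> f (tens v) 0 i = 0) ->
   (forall i : 'I_n, (j <= i)%N -> f (tens (a *: u + v)) 0 i = 0).
  by move=> Hu Hv i ji; rewrite tensD tensZ fl !mxE Hu // Hv // mulr0 addr0.
pose X j : smod M := @Smod R M (fun v => forall i : 'I_n, (j <= i)%N -> f (tens v) 0 i = 0)
  (@X0 j) (@XP j).
apply/schainP => //; exists X; split.
- by move=> v /tens_ker Hv i _; rewrite Hv F0 mxE.
- by apply: smod_eq => // v _ i; rewrite leqNgt ltn_ord.
move=> j jn; split; first by move=> v Hv i ji; apply: Hv; exact: ltnW.
have [u Eu] := tens_surj (fi (delta_mx 0 (Ordinal jn))).
move=> /(_ u) H; have : f (tens u) 0 (Ordinal jn) = 0.
  apply: H => // i ji; rewrite -Eu iK mxE eqxx /=.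
  by case: eqP ji => // ->; rewrite ltnn.
by rewrite -Eu iK mxE !eqxx /= => /eqP; rewrite oner_eq0.
Qed.
End Basis.

Lemma axiom_exists : fingen M -> exists n, inhabited (Vector.axiom n bc).
Proof.
move=> /fingenP fgM.
have ex : exists n, `[< exists g : 'I_n -> M, lspan g = sT >].
  by case: fgM => n [g Eg]; exists n; apply/asboolP; exists g.
case: (ex_minnP ex) => n /asboolP[g Eg] nmin; exists n.
pose psi (c : 'rV[S]_n) : bc := \sum_i c 0 i *: tens (g i).
have psiP a u v : psi (a *: u + v) = a *: psi u + psi v.
  rewrite /psi scaler_sumr -big_split; apply: eq_bigr => i _ /=.
  by rewrite !mxE scalerDl scalerA.
have psi_tens (c : 'rV[S]_n) : psi c = tens (\sum_i (repr (c 0 i) : R) *: g i).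
  by rewrite tens_sum; apply: eq_bigr => i _; rewrite tensZ reprK.
have psi0 c : psi c = 0 -> c = 0.
  rewrite psi_tens => /tens_ker Hc; apply/rowP => j; rewrite mxE.
  rewrite -[c 0 j]reprK -(rmorph0 (\pi_(S))); apply/piS_eq; rewrite subr0.
  apply: contrapT => /negP nc; have [e Ee] := local_unit nc.
  case: n g Eg nmin psi psiP psi_tens c j Hc nc Ee => [|n] g Eg nmin psi psiP psi_tens c j Hc nc Ee.
    by case: j nc Ee.
  suff : `[< exists g : 'I_n -> M, lspan g = sT >] by move=> /nmin; rewrite ltnn.
  apply/asboolP; exists (fun i => g (lift j i)).
  apply: (@nakayama n.+1 _ g); first by apply: smod_eq => // v _; apply: sadd_r; rewrite Eg.
  set W := lspan _.
  have gW i : W (g (lift j i)).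
    apply/lspanP; exists (fun i' => (i' == i)%:R).
    rewrite (bigD1 i) //= eqxx scale1r big1 ?addr0 // => i' /negPf ->; exact: scale0r.
  have gj : sadd W mM (g j).
    rewrite -[g j]scale1r -Ee -scalerA; apply: smemZ.
    have -> : (repr (c 0 j) : R) *: g j = \sum_i (repr (c 0 i) : R) *: g i
       - \sum_(i | i != j) (repr (c 0 i) : R) *: g i.
      by rewrite (bigD1 j) //= addrK.
    apply: smemB; first exact: sadd_r.
    apply: sadd_l; apply: smem_sum => i ij; apply: smemZ.
    have ji : j != i by rewrite eq_sym.
    by have [i' -> _] := unlift_some ji; exact: gW.
  rewrite -Eg => v /lspanP[b ->]; apply: smem_sum => i _; apply: smemZ.
  case: (eqVneq i j) => [->//|ij]; apply: sadd_l.
  have ji : j != i by rewrite eq_sym.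
  by have [i' -> _] := unlift_some ji; exact: gW.
have psiB u v : psi (u - v) = psi u - psi v.
  have -> : u - v = -1 *: v + u by rewrite scaleN1r addrC.
  by rewrite psiP scaleN1r addrC.
have psi_inj : injective psi.
  by move=> u v E; apply/eqP; rewrite -subr_eq0; apply/eqP/psi0; rewrite psiB E subrr.
have /choice[f fE] (q : bc) : exists c : 'rV[S]_n, psi c = q.
  have [v ->] := tens_surj q; have : lspan g v by rewrite Eg.
  move=> /lspanP[c ->]; exists (\row_i \pi_(S) (c i)).
  by rewrite tens_sum; apply: eq_bigr => i _; rewrite mxE tensZ.
constructor; exists f.
  by move=> a u v; apply: psi_inj; rewrite psiP !fE.
by exists psi => [q|c]; [exact: fE|apply: psi_inj; rewrite fE].
Qed.

Lemma nu_gen : fingen M -> exists g : 'I_(nu m M) -> M, lspan g = sT.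
Proof.
move=> fgM; have [n Hn] := axiom_exists fgM.
have [ax] : inhabited (Vector.axiom (nu m M) bc).
  by apply: (xgetPex 0%N (P := [set n | inhabited (Vector.axiom n bc)]%classic)); exists n.
exact: axiom_gen ax fgM.
Qed.

Lemma nu_schain : fingen M -> schain (nu m M) mM sT.
Proof.
move=> fgM; have [n Hn] := axiom_exists fgM.
have [ax] : inhabited (Vector.axiom (nu m M) bc).
  by apply: (xgetPex 0%N (P := [set n | inhabited (Vector.axiom n bc)]%classic)); exists n.
exact: axiom_schain ax.
Qed.
End Nu.

(** * Asymptotics *)

Section LittleO.
Implicit Types a b c : nat -> rat.

Lemma little_oP a b : little_o a b <->
  forall e : rat, 0 < e -> exists N, forall n, (N <= n)%N -> `|a n| <= e * `|b n|.
Proof.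
rewrite /little_o eqoP; split=> H e e0.
  by have [N _ HN] := H e e0; exists N => n Nn; apply: HN.
by have [N HN] := H e e0; exists N => // n Nn; apply: HN.
Qed.

Lemma little_o_leL a b c (C : rat) : (forall n, `|a n| <= C * `|b n|) ->
  little_o b c -> little_o a c.
Proof.
move=> H /little_oP Hb; apply/little_oP => e e0.
have C1 : 0 < `|C| + 1 by rewrite ltr_wpDl.
have [|N HN] := Hb (e / (`|C| + 1)); first exact: divr_gt0.
exists N => n Nn; apply: le_trans (H n) _.
have HCb : C * `|b n| <= (`|C| + 1) * `|b n|.
  by apply: ler_wpM2r => //; apply: le_trans (ler_norm _) _; rewrite lerDl.
apply: le_trans HCb _; rewrite mulrC -ler_pdivlMr // mulrAC; exact: HN.
Qed.

Lemma little_o_leR a b c (C : rat) : 0 < C ->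
  (exists N, forall n, (N <= n)%N -> `|b n| <= C * `|c n|) -> little_o a b -> little_o a c.
Proof.
move=> C0 [N1 H1] /little_oP Ha; apply/little_oP => e e0.
have [|N HN] := Ha (e / C); first exact: divr_gt0.
exists (maxn N1 N) => n Nn; apply: le_trans (HN n _) _; first lia.
rewrite -mulrA; apply: ler_wpM2l; first exact: ltW.
by rewrite mulrC ler_pdivrMr // mulrC; apply: H1; lia.
Qed.

Lemma little_oD a b c : little_o a c -> little_o b c -> little_o (fun n => a n + b n) c.
Proof.
move=> /little_oP Ha /little_oP Hb; apply/little_oP => e e0.
have [|N1 H1] := Ha (e / 2); first by rewrite divr_gt0.
have [|N2 H2] := Hb (e / 2); first by rewrite divr_gt0.
exists (maxn N1 N2) => n Nn; apply: le_trans (ler_normD _ _) _.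
have h1 : `|a n| <= e / 2 * `|c n| by apply: H1; lia.
have h2 : `|b n| <= e / 2 * `|c n| by apply: H2; lia.
lra.
Qed.

Lemma little_o_sum (I : Type) (s : seq I) (F : I -> nat -> rat) c : 
  (forall i, little_o (F i) c) -> little_o (fun n => \sum_(i <- s) F i n) c.
Proof.
move=> H; elim: s => [|i s IH].
  apply/little_oP => e e0; exists 0%N => n _; rewrite big_nil normr0.
  by rewrite mulr_ge0 // ltW.
apply: (little_o_leL (C := 1) _ (little_oD (H i) IH)) => n.
by rewrite mul1r big_cons.
Qed.

(** Eventually [a n] is at most half of [b n]; moving that half to the left doubles [C]. *)
Lemma little_o_absorb a b c (C : rat) : 0 < C -> (forall n, 0 <= b n) ->
  (forall n, b n <= C * `|c n| + a n) -> little_o a b ->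
  exists N, forall n, (N <= n)%N -> `|b n| <= 2 * C * `|c n|.
Proof.
move=> C0 b0 H /little_oP Ha; have [|N HN] := Ha (1 / 2); first by [].
exists N => n /HN; rewrite (ger0_norm (b0 n)) => h.
have := le_trans (H n) (lerD (lexx _) (le_trans (ler_norm _) h)); lra.
Qed.
End LittleO.

(** * Rank, Euler characteristic and number of generators *)

Section PfilTransport.
Variables (R : comNzRingType) (M : lmodType R).

(** As [J] contains the annihilator of [g] modulo [A], multiplication by [g] identifies K/J with (A
    + Kg)/(A + Jg), and the same primes occur. *)
Lemma pfil_transport (A : smod M) g (J K : smod R^o) t : pfil J K t -> colon A g <=s J ->
  pfil (sadd A (simg (lact g) J)) (sadd A (simg (lact g) K)) t.
Proof.
elim=> [{}J _|{}J {}K c {}t pc H IH HJ]; first exact: pf0.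
have E1 : colon J c = colon (sadd A (simg (lact g) J)) ((c : R) *: g).
  apply: smod_eq => a.
    by move=> Ja; apply: sadd_r; exists (a *: c); rewrite //= scalerA.
  move=> [w [_ [Aw [j Jj ->] E]]]; apply: (@smemBr _ _ J _ j) => //.
  apply: HJ; have -> : colon A g (a *: c - j) = A ((a * c : R) *: g - (j : R) *: g).
    by rewrite /= scalerBl.
  by move: E => /= E; rewrite -scalerA E addrK.
have E2 : sadd (sadd A (simg (lact g) J)) (cyc ((c : R) *: g)) =
          sadd A (simg (lact g) (sadd J (cyc (c : R^o)))).
  apply: smod_eq.
    apply: sadd_le.
      by apply: sadd_le => // _ [j Jj ->]; apply: sadd_r; exists j => //; exact: sadd_l.
    apply: cyc_le; apply: sadd_r; exists c => //; apply: sadd_r; exact: cycP.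
  apply: sadd_le; first by move=> a Aa; do 2!apply: sadd_l.
  move=> _ [_ [j [_ [Jj [b _ ->] ->]]] ->]; rewrite lmapD; apply: smemD.
    by apply: sadd_l; apply: sadd_r; exists j.
  by apply: sadd_r; exists b => //; rewrite /= scalerA.
rewrite E1; constructor; first by rewrite -E1.
by rewrite E2; apply: IH; exact: sle_trans HJ _.
Qed.
End PfilTransport.

Section Rank.
Variables (R : comNzRingType) (m : idealr R) (d : nat).
Hypotheses (lR : local_ring m) (dR : krull_dim R d).

Let nR : noeth (s0 : smod R^o) sT. Proof. by case: lR => /noetherian_noeth. Qed.
Let pm := local_prime lR.
Let lm := @local_max R m lR.
Local Notation mprimary := (mprimary (smod_of m)).

Lemma krull_chain : (exists q : smod R^o, pchain d q) /\ forall k (q : smod R^o), pchain k q -> (k <= d)%N.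
Proof.
have H0 : forall a : R, (s0 : smod R^o) a <-> a \in pred1 0.
  by move=> a; rewrite inE; split=> [->|/eqP].
have P k := prime_chainP k H0.
case: dR => /P[q _ pq] mx; split; first by exists q.
by move=> k q' pq'; apply: mx; apply/P; exists q'.
Qed.

(** A prime strictly below the bottom of a chain of length dim R would give a longer chain. *)
Lemma top_prime (q : smod R^o) : pchain d q -> exists p, [/\ psm p = q, minimal_prime p & quot_dim p d].
Proof.
move=> pq; have [p E] := prime_idealr_of (pchain_prime pq); exists p; split=> //.
  move=> q' q'p; apply: contrapT => nE.
  have : pchain d.+1 (psm q').
    split; first exact: sprime_of.
    exists q; rewrite -E in pq *; split=> // pq'.
    apply: nE => a; apply/idP/idP; first exact: q'p.
    by move=> pa; have := pq' a pa.
  by move=> /(proj2 krull_chain); rewrite ltnn.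
have P k := @prime_chainP R p (smod_of p) k (fun a => iff_refl _).
split; first by apply/P; exists q => //; rewrite -E.
by move=> j /P[q' _ /(proj2 krull_chain)].
Qed.

Lemma sop_mprimary (x : 'I_d -> R) : sop m x ->
  [/\ forall a, a \in xs x -> smod_of m a & mprimary (xs x) s0].
Proof.
move=> [_ xm Hx]; split; first by move=> _ /mapP[i _ ->]; exact: xm.
move=> q pq Hq y my; have [k [c E]] := Hx y my.
apply: (sprime_exp pq (t := k)); rewrite E; apply: smem_sum => i _.
apply: (@smemMl _ q (c i) (x i)); apply: Hq; apply: idgen_mem.
by rewrite map_f // mem_enum.
Qed.

Lemma sop_ex : exists x : 'I_d -> R, sop m x.
Proof.
have [x [sx mx fx]] : exists x : seq R, [/\ size x = d, forall a, a \in x -> smod_of m a & mprimary x s0].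
  by apply: sop_exists => // q _ /(proj2 krull_chain); rewrite ltnn.
exists (fun i => x`_i); split=> //; first by move=> i; apply: mx; rewrite mem_nth ?sx.
move=> y my; have [t Ht] := rad_pow nR fx my.
exists t; have : lspan (fun i : 'I_d => (x`_i : R^o)) (y ^+ t).
  move: Ht; move: (y ^+ t); apply/idgen_le; split=> // a /(nthP 0)[i]; rewrite sx => id <-.
  apply/lspanP; exists (fun j => (j == Ordinal id)%:R).
  rewrite (bigD1 (Ordinal id)) //= eqxx scale1r big1 ?addr0 // => j /negPf ->.
  exact: scale0r.
by move=> /lspanP.
Qed.

Section Module.
Variable M : lmodType R.
Hypothesis fgM : fingen M.
Let nM : noeth (s0 : smod M) sT.
Proof. by case: lR => nn _ _; exact: fingen_noeth. Qed.

(** Each new generator adds a cyclic factor R/(W : g0). A filtration of R through W : g0 counts [p]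
    as often as [sR] does, both counts being the length of R_p, so the factor contributes at most
    that much. *)
Lemma ncount_gen p n (g : 'I_n -> M) sR : minimal_prime p ->
  pfil (s0 : smod R^o) sT sR ->
  exists2 s, pfil (s0 : smod M) (lspan g) s & (ncount (psm p) s <= n * ncount (psm p) sR)%N.
Proof.
move=> pmin HsR; elim: n g => [|n IH] g.
  by exists [::]; rewrite /lspan ?big_ord0 /ncount ?big_nil //; exact: pf0.
have [s Hs les] := IH (fun i => g (lift ord0 i)).
set W := lspan _ in Hs; pose g0 := g ord0.
have EW : lspan g = sadd W (cyc g0).
  by rewrite /lspan big_ord_recl; apply: smod_eq; apply: sadd_le.
have [t1 H1] : exists t, pfil (s0 : smod R^o) (colon W g0) t.
  by apply: prime_fil => //; exact: noeth_sub nR.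
have [t2 H2] : exists t, pfil (colon W g0) sT t by apply: prime_fil => //; exact: noeth_sub nR.
have := pfil_transport H2 (sle_refl (A := colon W g0)).
have -> : sadd W (simg (lact g0) (colon W g0)) = W.
  by apply: smod_eq; [apply: sadd_le => // _ [a Ha ->]|exact: sadd_l].
rewrite -/(cyc g0) -EW => H3; exists (s ++ t2); first exact: pfil_cat Hs H3.
rewrite /ncount big_cat /= mulSn addnC; apply: leq_add => //.
have E := mlength_loc pmin (pfil_cat H1 H2); rewrite (mlength_loc pmin HsR) in E.
by rewrite [leqRHS]E /ncount big_cat /= leq_addl.
Qed.

Variable r : rat.
Hypothesis rkM : has_rank M r.

Lemma rank_count p sM sR : minimal_prime p -> quot_dim p d ->
  pfil (s0 : smod M) sT sM -> pfil (s0 : smod R^o) sT sR ->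
  (ncount (psm p) sM)%:R = r * (ncount (psm p) sR)%:R.
Proof.
move=> pmin pd HM HR; have := rkM pmin dR pd.
by rewrite mlength_locR (mlength_loc pmin HM) (mlength_loc pmin HR).
Qed.

Lemma fil_ex (V : lmodType R) : noeth (s0 : smod V) sT -> exists s, pfil (s0 : smod V) sT s.
Proof. by move=> nV; apply: prime_fil. Qed.

Lemma rank_bounds : 0 <= r <= (nu m M)%:R.
Proof.
have [[q pq] _] := krull_chain; have [p [E pmin pd]] := top_prime pq.
have [sR HR] := fil_ex nR; have [g Eg] := nu_gen lR fgM.
have [sM HM le_s] := ncount_gen g pmin HR; rewrite Eg in HM.
have H := rank_count pmin pd HM HR.
(* Some factor of the filtration of R lies inside [p] and equals it by minimality, so the division
   below is legitimate. *)
have R0 : (0 < ncount (psm p) sR)%N.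
  have [|q' q'p q's] := pfil_ann HR (sprime_of p).
    by apply: sle_trans (@ann2_sT _ _) _.
  have [pq' _] := pfil_mem HR q's.
  have {}q's : List.In (psm p) sR by rewrite -(min_prime_eq pmin pq' q'p).
  elim: {HR H le_s q' q'p pq'} sR q's => //= q1 s IH [->|/IH]; rewrite /ncount big_cons.
    by rewrite asboolT.
  by rewrite /ncount => h; rewrite (leq_trans h) // leq_addl.
have R0' : 0 < (ncount (psm p) sR)%:R :> rat by rewrite ltr0n.
have -> : r = (ncount (psm p) sM)%:R / (ncount (psm p) sR)%:R.
  by rewrite H mulfK // gt_eqF.
rewrite divr_ge0 ?ler0n //= ler_pdivrMr // -natrM ler_nat.
exact: le_s.
Qed.

Lemma sum_count (T : eqType) (F : T -> int) (L s : seq T) : uniq L -> {subset s <= L} ->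
  \sum_(q <- s) F q = \sum_(q <- L) F q *+ count_mem q s.
Proof.
move=> uL; elim: s => [|q s IH] sL; first by rewrite big_nil big1.
rewrite big_cons IH; last by move=> z zs; apply: sL; rewrite inE zs orbT.
have qL : q \in L by apply: sL; rewrite mem_head.
rewrite !(bigD1_seq q) //= eqxx mulrS addrA; congr (_ + _).
by apply: eq_bigr => z zq; rewrite eq_sym (negPf zq).
Qed.

Lemma chi_rank (x : seq R) : size x = d -> mprimary x s0 ->
  (chi x (s0 : smod M) sT)%:~R = r * (chi x (s0 : smod R^o) sT)%:~R :> rat.
Proof.
move=> sx fx; have okM := ok0 nM fx; have okR := ok0 nR fx.
have [sM HM] := fil_ex nM; have [sR HR] := fil_ex nR.
rewrite (chi_pfil nR lm HM okM) (chi_pfil nR lm HR okR).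
(* Classical decidable equality allows the factors of both filtrations to be grouped by prime. *)
pose T : eqType := {classic smod R^o}.
pose F (q : T) : int := chi x (q : smod R^o) sT.
pose L : seq T := undup ((sM : seq T) ++ sR).
have uL : uniq L by exact: undup_uniq.
rewrite -[\sum_(q <- sM) _]/(\sum_(q <- (sM : seq T)) F q).
rewrite -[\sum_(q <- sR) _]/(\sum_(q <- (sR : seq T)) F q).
rewrite !(@sum_count T F L) //; try by move=> q qs; rewrite mem_undup mem_cat qs ?orbT.
rewrite !rmorph_sum mulr_sumr; apply: eq_bigr => q _; rewrite !rmorphMn.
have cntE (s : seq T) : count_mem q s = ncount (q : smod R^o) s.
  elim: s => [|q' s IH]; rewrite /ncount ?big_nil ?big_cons //= IH; congr (_ + _)%N.
have scale_count (a : rat) (k l : nat) : k%:R = r * l%:R -> a *+ k = r * (a *+ l).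
  by move=> E; rewrite -mulr_natr E mulrCA mulr_natr.
rewrite !cntE; case: (pselect (pchain d (q : smod R^o))) => pq.
  have [p [<- pmin pd]] := top_prime pq.
  exact/scale_count/(rank_count pmin pd HM HR).
(* A [q] that is not prime occurs in no filtration, and both counts are zero. *)
case: (pselect (sprime (q : smod R^o))) => prq; last first.
  have nc V (A B : smod V) s : pfil A B s -> ncount (q : smod R^o) s = 0%N.
    elim=> [{}A|{}A {}B u {}s pu _ IH]; rewrite /ncount ?big_nil // big_cons -/(ncount _ _) IH addn0.
    by rewrite asboolF // => E; apply: prq; rewrite -E.
  by rewrite (nc _ _ _ _ HM) (nc _ _ _ _ HR) !mulr0n mulr0.
suff -> : F q = 0 by rewrite !mul0rn mulr0.
rewrite /F; apply: (chi_dim nR pm lm).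
  by apply: (admissible_sub okR).
(* A chain of length d above [q] starts either at [q], which [pq] excludes, or strictly above it,
   and then [q] prolongs it beyond dim R. *)
move=> q' qq'; rewrite sx => pq'; have [e|ne] := pselect (q' <=s (q : smod R^o)).
  apply: pq; have <- // : q' = q.
  apply: smod_eq => //; apply: sle_trans qq' => a qa v _; exact: smemMr.
suff : pchain d.+1 (q : smod R^o) by move=> /(proj2 krull_chain); rewrite ltnn.
split=> //; exists q'; split=> //.
by apply: sle_trans qq' => a qa v _; exact: smemMr.
Qed.

(** h_0 is the length of [B] modulo [A] and the products of [B] with [x], all of which [A']
    contains. *)
Lemma kl0_ge (A A' B : smod M) (x : seq R) : admissible (smod_of m) x A B -> A <=s A' -> A' <=s B ->
  (forall a v, a \in x -> B v -> A' (a *: v)) ->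
  fin A' B /\ (len A' B <= klen x A B 0)%N.
Proof.
elim: x A => [|c x IH] A okx AA' A'B H; have [AB _ _] := okx.
  have [F _ ->] := chi_nil AB; have fAB : fin A B by apply/F/(kfin_admissible nR lm okx).
  have [/(_ fAB)[_ f2] _] := (len_add AA' A'B).1; split=> //.
  by rewrite (len_add AA' A'B).2 // leq_addl.
rewrite (kl0_rec nR lm okx); apply: IH => //; first exact: admissible_E okx.
  by apply: sadd_le => // _ [v Bv ->]; apply: H => //; rewrite mem_head.
by move=> a v ax; apply: H; rewrite inE ax orbT.
Qed.

Lemma nu_le (x : seq R) : (forall a, a \in x -> smod_of m a) -> mprimary x s0 ->
  (nu m M <= klen x (s0 : smod M) sT 0)%N.
Proof.
move=> mx fx; have [|||f le_k] := @kl0_ge s0 (mM m M) sT x (ok0 nM fx) => //.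
  by move=> a v ax _; apply: mM_mem; exact: mx.
by apply: leq_trans le_k; apply: schain_len => //; exact: nu_schain.
Qed.

Lemma nu_rank (x : seq R) : size x = d -> (forall a, a \in x -> smod_of m a) -> mprimary x s0 ->
  (nu m M)%:R <= (chi x (s0 : smod R^o) sT)%:~R * r + (pchi1 x (s0 : smod M) sT)%:~R :> rat.
Proof.
move=> sx mx fx; rewrite mulrC -chi_rank // /pchi1 -intrD addrC subrK.
by rewrite -pmulrn ler_nat; exact: nu_le.
Qed.
End Module.
End Rank.

(** A dimension requires a prime over the annihilator, and the annihilator of a zero module is the
    unit ideal. *)
Lemma mod_dim_nonzero (R : comNzRingType) (M : lmodType R) d : mod_dim M d -> exists v : M, v != 0.
Proof.
move=> [[p [Hp _]] _]; apply: contrapT => nex.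
have : (1 : R) \in p ord0; last by rewrite idealr1.
apply: Hp; apply/asboolP => v; rewrite scale1r; apply/eqP.
by apply: contrapT => /negP nv; apply: nex; exists v.
Qed.

(** * Comparison of the asymptotic conditions *)

Section Main.
Variables (R : comNzRingType) (m : idealr R) (d : nat).
Variables (M : nat -> lmodType R) (r : nat -> rat).
Hypotheses (lR : local_ring m) (dR : krull_dim R d) (fgM : forall n, fingen (M n)).
Hypothesis rkM : forall n, has_rank (M n) (r n).

Let nR : noeth (s0 : smod R^o) sT. Proof. by case: lR => /noetherian_noeth. Qed.
Let nM n : noeth (s0 : smod (M n)) sT.
Proof. by case: lR => nn _ _; exact: fingen_noeth. Qed.
Let pm := local_prime lR.
Let lm := @local_max R m lR.
Local Notation nus := (nu_seq m M).

Lemma o_rank_nu a : little_o a r -> little_o a nus.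
Proof.
apply: (little_o_leR (C := 1)) => //; exists 0%N => n _; rewrite mul1r.
have /andP[r0 rn] := rank_bounds lR dR (fgM n) (rkM n).
by rewrite /nu_seq (ger0_norm r0) ger0_norm ?ler0n.
Qed.

(** The condition on chi_1 makes nu = O(rank). The sequence [a] is left free, so that the same step
    serves the lengths h_i and chi_1 itself. *)
Lemma o_nu_rank (x : 'I_d -> R) a : sop m x -> chi1_o M x nus -> little_o a nus -> little_o a r.
Proof.
move=> sx Hx Ha; have [mx fx] := sop_mprimary sx.
(* The added 1 makes the constant positive without an appeal to chi(x; R) > 0. *)
pose e : rat := `|(chi (xs x) (s0 : smod R^o) sT)%:~R| + 1.
have e0 : 0 < e by rewrite ltr_wpDl.
apply: (little_o_leR (C := 2 * e)) Ha; first by rewrite mulr_gt0.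
apply: little_o_absorb Hx => // n.
apply: le_trans (nu_rank lR dR (fgM n) (rkM n) (size_xs x) mx fx) _.
rewrite chi1_pchi1; apply: lerD => //; apply: le_trans (ler_norm _) _.
by rewrite normrM; apply: ler_wpM2r => //; rewrite lerDl.
Qed.

Lemma homology_chi1 (x : 'I_d -> R) b : homology_o M x b -> chi1_o M x b.
Proof.
(* [little_o_sum] asks for every index while the hypothesis starts at 1; [maxn i 1] takes care of
   index 0, which lies outside the range of summation. *)
move=> H; apply: (little_o_leL (C := 1) _ (little_o_sum (index_iota 1 d.+1)
  (F := fun i n => (-1) ^+ i.-1 * (lengthH x (M n) (maxn i 1))%:R) (c := b) _)).
  move=> n; rewrite mul1r /Defs.chi1 rmorph_sum /= le_eqVlt; apply/orP; left; apply/eqP.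
  congr `|_|; rewrite big_nat [RHS]big_nat; apply: eq_bigr => i /andP[i1 _].
  by rewrite rmorphM rmorphXn rmorphN1 (maxn_idPl i1).
move=> i; apply: (little_o_leL (C := 1) _ (H (maxn i 1) (leq_maxr _ _))) => n.
by rewrite mul1r normrM normrX normrN1 expr1n mul1r.
Qed.

Lemma homology_equiv (x : 'I_d -> R) : sop m x -> homology_o M x nus <-> homology_o M x r.
Proof.
move=> sx; split=> H i i1; last exact: o_rank_nu (H i i1).
by apply: (o_nu_rank sx); [exact: homology_chi1|exact: H].
Qed.

Lemma chi1_equiv (x : 'I_d -> R) : sop m x -> chi1_o M x nus <-> chi1_o M x r.
Proof. by move=> sx; split=> H; [exact: (o_nu_rank sx H H)|exact: o_rank_nu]. Qed.

Lemma homology_indep (x y : 'I_d -> R) b : sop m x -> sop m y -> homology_o M x b -> homology_o M y b.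
Proof.
move=> sx sy H i i1; have [mx fx] := sop_mprimary sx; have [my fy] := sop_mprimary sy.
have sxy : size (xs x) = size (xs y) by rewrite !size_xs.
have [C HC] := klen_sop nR lm sxy mx fx fy.
apply: (little_o_leL (C := C%:R) _ (little_o_sum (index_iota 1 d.+1)
  (F := fun j n => (lengthH x (M n) (maxn j 1))%:R) (c := b) _)); last first.
  by move=> j; apply: H; rewrite leq_maxr.
move=> n; rewrite -natr_sum !ger0_norm ?ler0n // -natrM ler_nat lengthH_klen.
apply: (leq_trans (HC _ (@nM n) i i1)); rewrite size_xs leq_mul2l; apply/orP; right.
rewrite big_nat [leqRHS]big_nat; apply: leq_sum => j /andP[j1 _].
by rewrite (maxn_idPl j1) lengthH_klen.
Qed.

Lemma chi1_indep (x y : 'I_d -> R) b : sop m x -> sop m y -> chi1_o M x b -> chi1_o M y b.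
Proof.
move=> sx sy; have [mx fx] := sop_mprimary sx; have [my fy] := sop_mprimary sy.
have sxy : size (xs x) = size (xs y) by rewrite !size_xs.
have [C HC] := bdd_sop nR pm lm (w := [::]) sxy mx my fx fy.
apply: (little_o_leL (C := C%:R)) => n; rewrite !chi1_pchi1.
(* Nonnegativity turns the integer inequality of [bdd_sop] into one between absolute values. *)
have g0 z : mprimary (smod_of m) z s0 -> 0 <= (pchi1 z (s0 : smod (M n)) sT)%:~R :> rat.
  by move=> fz; rewrite ler0z; apply: (pchi1_ge0 nR lm); exact: ok0.
rewrite !ger0_norm ?g0 //; have := HC _ (@nM n).
by rewrite -(ler_int rat) intrM -pmulrn.
Qed.
End Main.

Theorem theorem4p17 (R : comNzRingType) (m : idealr R) (d : nat)
    (M : nat -> lmodType R) (r : nat -> rat) :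
  local_ring m -> krull_dim R d ->
  (forall n, fingen (M n)) ->
  (forall n, mod_dim (M n) d) ->
  (forall n, has_rank (M n) (r n)) ->
  [/\ (forall x : 'I_d -> R, sop m x ->
         (homology_o M x (nu_seq m M) <-> homology_o M x r) /\
         (chi1_o M x (nu_seq m M) <-> chi1_o M x r)),
      (lim_CM m d M <->
         exists x : 'I_d -> R, sop m x /\ homology_o M x r),
      (lim_CM m d M <->
         forall x : 'I_d -> R, sop m x -> homology_o M x r),
      (weakly_lim_CM m d M <->
         exists x : 'I_d -> R, sop m x /\ chi1_o M x r) &
      (weakly_lim_CM m d M <->
         forall x : 'I_d -> R, sop m x -> chi1_o M x r)].
Proof.
move=> lR dR fgM dM rkM.
have HE x : sop m x -> _ := homology_equiv lR dR fgM rkM (x := x).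
have CE x : sop m x -> _ := chi1_equiv lR dR fgM rkM (x := x).
have HI (x y : 'I_d -> R) : sop m x -> sop m y -> _ := homology_indep lR fgM (x := x) (y := y) (b := r).
have CI (x y : 'I_d -> R) : sop m x -> sop m y -> _ := chi1_indep lR fgM (x := x) (y := y) (b := r).
(* Without an existing system of parameters, the statements about every system would be vacuous and
   could not imply those about some system. *)
have [x0 sx0] := sop_ex lR dR.
have nz n : fingen (M n) /\ exists v : M n, v != 0.
  by split=> //; exact: mod_dim_nonzero (dM n).
split.
- by move=> x sx; split; [exact: HE|exact: CE].
- split=> [[_ [x [sx Hx]]]|[x [sx Hx]]]; first by exists x; split=> //; apply/HE.
  by split=> //; exists x; split=> //; apply/HE.
- split=> [[_ [x [sx Hx]]] y sy|H].
    by apply: (HI x y sx sy); apply/(HE x sx).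
  by split=> //; exists x0; split=> //; apply/HE => //; exact: H.
- split=> [[_ H]|[x [sx Hx]]]; first by exists x0; split=> //; apply/CE => //; exact: H.
  by split=> [n|y sy]; [exact: conj (fgM n) (dM n)|exact: (proj2 (CE y sy) (CI x y sx sy Hx))].
split=> [[_ H] y sy|H]; first by apply/CE => //; exact: H.
by split=> [n|y sy]; [exact: conj (fgM n) (dM n)|exact: (proj2 (CE y sy) (H y sy))].
Qed.
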